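(* Let $N\ge 2$ and $\alpha,b,c\in\mathbb{R}$. There exists a constant $C>0$ such that $$\int_{\mathbb{R}^N}|x|^{2\alpha}|Lu|^2\,dx\ \ge\ C^2\int_{\mathbb{R}^N}|x|^{2\alpha-4}|u|^2\,dx\qquad\text{for every }u\in C_c^\infty(\mathbb{R}^N\setminus\{0\})$$ if and only if $b+\lambda_n\notin\mathcal{P}_{2,\alpha,c}$ for every $n\in\mathbb{N}_0$. In that case the optimal constant satisfies $C^2=\min_{n\in\mathbb{N}_0}C_n^2$, where $$C_n^2=\begin{cases}\bigl(b+\lambda_n+\gamma_2(\alpha,c)\bigr)^2 & \text{if } b+\lambda_n+\bigl(\tfrac N2-1+\tfrac c2\bigr)^2+\bigl(1-\alpha+\tfrac c2\bigr)^2\ge 0,\\[4pt] 4\bigl(1-\alpha+\tfrac c2\bigr)^2\Bigl[-b-\bigl(\tfrac N2-1+\tfrac c2\bigr)^2-\lambda_n\Bigr] & \text{if } b+\lambda_n+\bigl(\tfrac N2-1+\tfrac c2\bigr)^2+\bigl(1-\alpha+\tfrac c2\bigr)^2<0,\end{cases}$$ and this minimum is strictly positive.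
   Context: $L u=\Delta u+c\,\frac{x}{|x|^2}\cdot\nabla u-\frac{b}{|x|^2}u$. $\lambda_n=n(n+N-2)$, $n\in\mathbb{N}_0=\{0,1,2,\dots\}$, are the eigenvalues of $-\Delta_0$, where $\Delta_0$ is the Laplace–Beltrami operator on the unit sphere $S^{N-1}$. $\gamma_2(\alpha,c)=\bigl(\frac N2-2+\alpha\bigr)\bigl(\frac N2-\alpha+c\bigr)=\bigl(\frac N2-1+\frac c2\bigr)^2-\bigl(1-\alpha+\frac c2\bigr)^2$. $\mathcal{P}_{2,\alpha,c}=\{-\xi^2+i\xi(2-2\alpha+c)-\gamma_2(\alpha,c):\ \xi\in\mathbb{R}\}\subset\mathbb{C}$. *)

(* Defs.v *)
From HB Require Import structures.
From mathcomp Require Import all_boot all_order all_algebra.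
From mathcomp Require Import all_classical all_reals all_analysis.
From mathcomp Require Import complex.

Set Implicit Arguments.
Unset Strict Implicit.
Unset Printing Implicit Defensive.

Import Order.TTheory GRing.Theory Num.Theory.
Import numFieldNormedType.Exports.
Local Open Scope classical_set_scope.
Local Open Scope ring_scope.

Section Rellich.
Variable R : realType.
Variable N : nat.

Definition point := 'rV[R]_N.

(* Euclidean norm |x| (the library norm on 'rV is the sup norm). *)
Definition enorm (x : point) : R := Num.sqrt (\sum_(i < N) (x 0 i) ^+ 2).

Definition ebasis (i : 'I_N) : point := delta_mx 0 i.

Definition partial (i : 'I_N) (f : point -> R) : point -> R :=
  fun x => 'D_(ebasis i) f x.

Fixpoint iter_partial (s : seq 'I_N) (f : point -> R) : point -> R :=
  match s with
  | [::] => f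
  | i :: s' => partial i (iter_partial s' f)
  end.

Definition smooth (f : point -> R) : Prop :=
  forall s : seq 'I_N,
    continuous (iter_partial s f) /\
    forall (i : 'I_N) (x : point), derivable (iter_partial s f) x (ebasis i).

(* C_c^infty(R^N \ {0}): smooth, and support contained in a closed annulus
   r <= |x| <= r' with 0 < r (i.e. compact support away from the origin). *)
Definition test_fun (u : point -> R) : Prop :=
  smooth u /\
  exists r r' : R, 0 < r /\ r < r' /\
    forall x : point, (enorm x < r \/ r' < enorm x) -> u x = 0.

Definition laplacian (u : point -> R) : point -> R :=
  fun x => \sum_(i < N) partial i (partial i u) x.

Definition x_dot_grad (u : point -> R) : point -> R :=
  fun x => \sum_(i < N) x 0 i * partial i u x.

Definition Lop (b c : R) (u : point -> R) : point -> R :=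
  fun x => laplacian u x + c * x_dot_grad u x / (enorm x ^+ 2)
           - b / (enorm x ^+ 2) * u x.

Definition setcoord (x : point) (k : nat) (t : R) : point :=
  \row_(j < N) (if (j : nat) == k then t else x 0 j).

(* Lebesgue integral over R^N of a nonnegative function, as the iterated
   (Tonelli) integral with respect to one-dimensional Lebesgue measure. *)
Fixpoint iint (k : nat) (g : point -> \bar R) (x : point) : \bar R :=
  match k with
  | 0 => g x
  | k'.+1 => (\int[lebesgue_measure]_(t in [set: R]) iint k' g (setcoord x k' t))%E
  end.

Definition integral_RN (g : point -> R) : \bar R :=
  iint N (fun x => (g x)%:E) 0.

Definition wt (a : R) (x : point) : R := powR (enorm x) a.

Definition lambda (n : nat) : R := n%:R * (n%:R + N%:R - 2).

Definition gamma2 (alpha c : R) : R :=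
  (N%:R / 2 - 2 + alpha) * (N%:R / 2 - alpha + c).

Definition P2 (alpha c : R) : set R[i] :=
  [set z | exists xi : R,
     z = Complex (- xi ^+ 2 - gamma2 alpha c) (xi * (2 - 2 * alpha + c))].

Definition Cn2 (alpha b c : R) (n : nat) : R :=
  let A := N%:R / 2 - 1 + c / 2 in
  let B := 1 - alpha + c / 2 in
  if 0 <= b + lambda n + A ^+ 2 + B ^+ 2
  then (b + lambda n + gamma2 alpha c) ^+ 2
  else 4 * B ^+ 2 * (- b - A ^+ 2 - lambda n).

Definition rellich_ineq (alpha b c K : R) (u : point -> R) : Prop :=
  (K%:E * integral_RN (fun x => wt (2 * alpha - 4) x * (u x) ^+ 2)%R
   <= integral_RN (fun x => wt (2 * alpha) x * (Lop b c u x) ^+ 2)%R)%E.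

End Rellich.

(* Main.v *)
Require Import Defs.
From HB Require Import structures.
From mathcomp Require Import all_boot all_order all_algebra.
From mathcomp Require Import all_classical all_reals all_analysis.
From mathcomp Require Import complex ring lra zify.

Set Implicit Arguments.
Unset Strict Implicit.
Unset Printing Implicit Defensive.

Import Order.TTheory GRing.Theory Num.Theory.
Import numFieldNormedType.Exports.
Local Open Scope classical_set_scope.
Local Open Scope ring_scope.

(** The weight [|x|^(2 alpha - 4)] makes [D = x . grad + sg], with
    [2 sg = N + 2 alpha - 4], antisymmetric, and
    [|x|^2 L = D^2 + 2 B D + Delta_S - (b + gamma2)] with [B = 1 - alpha + c / 2].
    On a component [v = f(|x|) h(x)], [h] a harmonic polynomial of degree [n],
    [Delta_S] is [- lambda_n]; with [mu = b + lambda_n + gamma2] and [<D v, v> = 0],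
      [|| |x|^2 L v ||^2 = ||D^2 v||^2 + (4 B^2 + 2 mu) ||D v||^2 + mu^2 ||v||^2],
    and this is at least [C_n^2 ||v||^2] because [||D^2 v - (mu + 2 B^2) v||^2 >= 0].
    Components of different degrees are orthogonal by the divergence theorem, and
    finite sums of components suffice: Bernstein polynomials approximate a test
    function together with its pure second derivatives, and the Fischer decomposition
    splits a polynomial into [|x|^(2j)] times harmonic ones.
    Conversely, testing with [|x|^(- n - sg) phi(ln |x|) exp(i xi ln |x|) h] for a long
    plateau [phi] bounds every admissible constant by the symbol
    [(mu + xi^2)^2 + 4 B^2 xi^2]. Its minimum over [xi] is [C_n^2], and it vanishes for
    some [xi] exactly when [b + lambda_n] lies on the parabola. *)

(** * The iterated Lebesgue integral as a positive functional *)

(** The integral is iterated over the coordinates, so its properties are proved one variable at a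
    time for uniformly continuous functions of bounded support: linearity, monotonicity, a sup
    bound, strict positivity, the change of variables x -> a x + v. Translations then give
    integration by parts, and dilations the invariance needed for sharpness. Polar coordinates and
    Delta_S are avoided: on f(|x|) h(x) the formula for |x|^2 Delta follows from Delta h = 0 and x .
    grad h = n h. As the inequality contains second derivatives, the approximation must control u
    and |x|^2 L u together; uniform closeness on a fixed annulus suffices, because the weight is
    bounded there. Lower and upper bounds meet for one reason. If mu + 2 B^2 < 0, the discarded
    square is that of (D^2 - (mu + 2 B^2)) v. On exp(i xi ln |x|) the operator D^2 acts as - xi^2,
    so nothing is lost at the frequency xi^2 = - (mu + 2 B^2), where the symbol takes the value
    C_n^2. *)

Section Integral1.
Variable R : realType.
Implicit Types f g : R -> R.
Notation mu := (@lebesgue_measure R).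

Definition int1 f : R := \int[mu]_t f t.

Definition cc1 (rho : R) f := continuous f /\ forall t, rho <= `|t| -> f t = 0.

Lemma cc1_setT rho f : cc1 rho f ->
  (\int[mu]_t (f t)%:E = \int[mu]_(t in `[(- rho)%R, rho]) (f t)%:E)%E.
Proof.
move=> [_ fv]; rewrite [RHS]integral_mkcond; apply: eq_integral => t _.
rewrite patchE; case: ifPn => // /negP ht; rewrite fv// leNgt.
apply/negP => h; apply: ht; rewrite inE/= in_itv/=.
by move: h; rewrite ltr_norml => /andP[/ltW -> /ltW ->].
Qed.

Lemma cc1_integrable rho f : cc1 rho f -> mu.-integrable setT (EFin \o f).
Proof.
move=> [cf fv].
have H : mu.-integrable `[- rho, rho] (EFin \o f).
  apply: continuous_compact_integrable; first exact: segment_compact.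
  by apply: continuous_subspaceT.
have -> : EFin \o f = (EFin \o f) \_ `[- rho, rho].
  apply/funext => t; rewrite patchE; case: ifPn => // /negP ht /=; rewrite fv// leNgt.
  apply/negP => h; apply: ht; rewrite inE/= in_itv/=.
  by move: h; rewrite ltr_norml => /andP[/ltW -> /ltW ->].
by rewrite -integrable_mkcond.
Qed.

Lemma int1E rho f : cc1 rho f -> (\int[mu]_t (f t)%:E = (int1 f)%:E)%E.
Proof.
move=> h; rewrite /int1 /Rintegral fineK// integrable_fin_num//.
exact: cc1_integrable h.
Qed.

Lemma int1D rho f g : cc1 rho f -> cc1 rho g ->
  int1 (fun t => f t + g t) = int1 f + int1 g.
Proof.
move=> hf hg; rewrite /int1 RintegralD//; apply: cc1_integrable; eassumption.
Qed.

Lemma int1Z rho f (k : R) : cc1 rho f -> int1 (fun t => k * f t) = k * int1 f.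
Proof. by move=> hf; rewrite /int1 RintegralZl//; exact: cc1_integrable hf. Qed.

Lemma int1_le rho f g : cc1 rho f -> cc1 rho g -> (forall t, f t <= g t) ->
  int1 f <= int1 g.
Proof.
by move=> hf hg h; apply: le_Rintegral => //; apply: cc1_integrable; eassumption.
Qed.

Lemma int1_bound (rho : R) f (M : R) : 0 <= rho -> cc1 rho f ->
  (forall t, `|f t| <= M) -> `|int1 f| <= 2 * rho * M.
Proof.
move=> r0 hf hM.
have mI : measurable `[- rho, rho] by [].
have iI : mu.-integrable `[- rho, rho] (EFin \o f).
  by apply: integrableS (cc1_integrable hf).
have -> : int1 f = \int[mu]_(t in `[- rho, rho]) f t.
  by rewrite /int1 /Rintegral (cc1_setT hf).
apply: le_trans (le_normr_Rintegral _ _) _ => //.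
apply: (@le_trans _ _ (\int[mu]_(t in `[- rho, rho]) M)).
  apply: le_Rintegral => //; first exact: integrable_abse iI.
  apply: continuous_compact_integrable; first exact: segment_compact.
  by move=> ?; exact: cvg_cst.
rewrite Rintegral_cst// [X in fine X](lebesgue_measure_itv `[- rho, rho])/= lte_fin.
case: ifPn => h; rewrite -?EFinD /=; first by rewrite opprK; lra.
by rewrite mulr0 mulr_ge0// ?mulr_ge0// (le_trans _ (hM 0)).
Qed.

(** Substitution is applied on a segment whose image contains the support; both integrals are then
    extended by zero to the whole line. *)
Lemma int1_affine (rho : R) f (a b : R) : 0 < a -> cc1 rho f ->
  int1 (fun t => f (a * t + b)) = a^-1 * int1 f.
Proof.
move=> a0 hf.
pose F := fun t : R => a * t + b.
have FD (t : R) : is_derive t 1 F a.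
  have -> : a = a *: 1 + 0 :> R by rewrite addr0 /GRing.scale/= mulr1.
  by apply: is_deriveD.
have F' : derive1 F = cst a by apply/funext => t; rewrite derive1E; apply: derive_val.
(* No sign is known for [rho]; a positive [rho1] keeps the segment from [c] to [d], the preimages of
   [- rho1] and [rho1], nondegenerate. *)
pose rho1 : R := `|b| + `|rho| + 1.
have r1 : 0 < rho1 by rewrite /rho1; have := normr_ge0 b; have := normr_ge0 rho; lra.
pose c := a^-1 * (- rho1 - b); pose d := a^-1 * (rho1 - b).
have Fc : F c = - rho1 by rewrite /F /c; field; lra.
have Fd : F d = rho1 by rewrite /F /d; field; lra.
have cd : c <= d by rewrite /c /d ler_pM2l ?invr_gt0//; lra.
have hf1 : cc1 rho1 f.
  split=> [|t ht]; first exact: hf.1.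
  apply: hf.2; apply: le_trans ht; have := ler_norm rho; have := normr_ge0 b; rewrite /rho1; lra.
have Fcts : continuous F.
  by move=> t; apply/differentiable_continuous/derivable1_diffP; exact: ex_derive.
have hfF : continuous (fun t => f (F t)).
  by move=> t; apply: continuous_comp; [exact: Fcts|exact: hf.1].
have E1 : (\int[mu]_t (f t)%:E = \int[mu]_(t in `[c, d]) ((f \o F) t * a)%:E)%E.
  rewrite (cc1_setT hf1) -Fc -Fd integration_by_substitution_increasing// ?F'//.
  - by move=> x y _ _ xy; rewrite /F ltrD2r ltr_pM2l.
  - by move=> x _; exact: cvg_cst.
  - exact: is_cvg_cst.
  - exact: is_cvg_cst.
  - split; first by [].
      by apply: cvg_at_right_filter; exact: Fcts.
    by apply: cvg_at_left_filter; exact: Fcts.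
  - by apply: continuous_subspaceT; exact: hf.1.
have E2 : (\int[mu]_(t in `[c, d]) ((f \o F) t * a)%:E = \int[mu]_t ((f (F t)) * a)%:E)%E.
  rewrite integral_mkcond; apply: eq_integral => t _.
  rewrite patchE; case: ifPn => // /negP ht; rewrite /= hf1.2 ?mul0r// leNgt.
  apply/negP => h; apply: ht; rewrite inE/= in_itv/=.
  move: h; rewrite ltr_norml -Fc -Fd /F !ltrD2r !ltr_pM2l//.
  by move=> /andP[/ltW -> /ltW ->].
have h2 : int1 f = int1 (fun t => (f (F t)) * a) by rewrite /int1 /Rintegral E1 E2.
rewrite h2; transitivity (a^-1 * int1 (fun t => a * f (F t))).
  rewrite (@int1Z (Num.max `|c| `|d|) (fun t => f (F t))) ?mulrA ?mulVf ?mul1r// ?gt_eqF//.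
  split=> // t; rewrite ge_max => /andP[ht1 ht2]; apply: hf1.2.
  rewrite leNgt; apply/negP; rewrite ltr_norml -Fc -Fd /F !ltrD2r !ltr_pM2l// => /andP[h3 h4].
  suff : `|t| < Num.max `|c| `|d| by rewrite lt_max !ltNge ht1 ht2.
  by rewrite lt_max; case: (lerP 0 t) => t0;
   rewrite ?(ger0_norm t0) ?(ltr0_norm t0); apply/orP; [right|left];
   have := ler_norm d; have := ler_norm (- c); rewrite ?normrN; lra.
by congr (_ * _); congr int1; apply/funext => t; rewrite mulrC.
Qed.

Lemma int1_gt0 rho f t0 : cc1 rho f -> (forall t, 0 <= f t) -> 0 < f t0 -> 0 < int1 f.
Proof.
move=> hf f0 ft0.
have : \forall t \near t0, f t0 / 2 < f t.
  have /cvgr_gt := hf.1 t0; apply; rewrite ltr_pdivrMr//; lra.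
move=> /nbhs_ballP[d /= d0 hd].
pose D := `[t0 - d / 2, t0 + d / 2]%classic.
have mD : measurable D by exact: measurable_itv.
have iD : mu.-integrable D (EFin \o f) by apply: integrableS (cc1_integrable hf).
apply: (@lt_le_trans _ _ (\int[mu]_(t in D) f t)).
  apply: (@lt_le_trans _ _ (\int[mu]_(t in D) (f t0 / 2))).
    rewrite Rintegral_cst// [X in fine X](lebesgue_measure_itv `[t0 - d / 2, t0 + d / 2])/= lte_fin.
    case: ifPn => h; last by lra.
    rewrite -EFinD /=; apply: mulr_gt0; lra.
  apply: le_Rintegral => //.
    apply: continuous_compact_integrable; first exact: segment_compact.
    by move=> ?; exact: cvg_cst.
  move=> t; rewrite /D/= in_itv/= => /andP[h1 h2]; apply/ltW/hd.
  by rewrite /ball/= ltr_norml; apply/andP; split; lra.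
rewrite /int1 /Rintegral fine_le//.
- exact: integrable_fin_num.
- by apply: integrable_fin_num => //; exact: cc1_integrable hf.
- apply: ge0_subset_integral => //.
  + exact: measurable_int (cc1_integrable hf).
  + by move=> t _; rewrite lee_fin.
Qed.

End Integral1.

(** * Iterated integrals of compactly supported functions *)

Section IterInt.
Variables (R : realType) (N : nat).
Notation pt := 'rV[R]_N.
Implicit Types (f g : pt -> R) (x y : pt) (rho : R).

(** Uniformity is what survives integrating out a variable: a uniform bound on the difference of two
    slices passes to their integrals over a bounded interval. *)
Definition ucont f := forall e : R, 0 < e -> exists d : R, 0 < d /\
  forall x y, (forall i, `|x 0 i - y 0 i| < d) -> `|f x - f y| < e.

(** The index [k] counts the variables already integrated out. The function no longer depends on
    those, so the support is only constrained in the remaining ones. *)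
Definition vanish (k : nat) (rho : R) f :=
  forall x (j : 'I_N), (k <= j)%N -> rho <= `|x 0 j| -> f x = 0.

Definition ccK k rho f := [/\ 0 < rho, ucont f & vanish k rho f].

Definition jstep (k : nat) f : pt -> R := fun x => int1 (fun t => f (setcoord x k t)).

Definition pintN (k : nat) f : pt -> R := iteri k jstep f.

Lemma ccK_slice k rho f x : (k < N)%N -> ccK k rho f ->
  cc1 rho (fun t => f (setcoord x k t)).
Proof.
move=> kN [r0 fu fv]; split=> [t|t ht]; last first.
  by apply: (fv _ (Ordinal kN)) => //=; rewrite mxE eqxx.
apply/cvgrPdist_lt => e e0; have [d [d0 hd]] := fu _ e0.
apply/nbhs_ballP; exists d => //= s; rewrite /ball/= => hs; apply: hd => i.
by rewrite !mxE; case: eqP => // _; rewrite subrr normr0.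
Qed.

Lemma ccKN k rho f (c : R) : ccK k rho f -> ccK k rho (fun x => c * f x).
Proof.
move=> [r0 fu fv]; split=> // [e e0|x j kj h]; last by rewrite (fv x j) ?mulr0.
have c0 : 0 < `|c| + 1 by have := normr_ge0 c; lra.
have [|d [d0 hd]] := fu (e / (`|c| + 1)); first by rewrite divr_gt0.
exists d; split=> // x y /hd h; rewrite -mulrBr normrM.
rewrite ltr_pdivlMr// in h.
apply: le_lt_trans h; rewrite mulrC ler_wpM2l//; lra.
Qed.

Lemma ccKD k rho f g : ccK k rho f -> ccK k rho g -> ccK k rho (fun x => f x + g x).
Proof.
move=> [r0 fu fv] [_ gu gv]; split=> // [e e0|x j kj h]; last by rewrite (fv x j) ?(gv x j) ?addr0.
have e2 : 0 < e / 2 by lra.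
have [d [d0 hd]] := fu _ e2; have [d' [d0' hd']] := gu _ e2.
exists (Num.min d d'); split; first by rewrite lt_min d0 d0'.
move=> x y h.
have h1 : `|f x - f y| < e / 2 by apply: hd => i; have := h i; rewrite lt_min => /andP[].
have h2 : `|g x - g y| < e / 2 by apply: hd' => i; have := h i; rewrite lt_min => /andP[].
have -> : f x + g x - (f y + g y) = (f x - f y) + (g x - g y) by ring.
by apply: le_lt_trans (ler_normD _ _) _; lra.
Qed.

Lemma ccK_step k rho f : (k < N)%N -> ccK k rho f -> ccK k.+1 rho (jstep k f).
Proof.
move=> kN hf; have [r0 fu fv] := hf; split=> // [e e0|x j kj h].
  (* Slices live on an interval of length [2 * rho], so this tolerance integrates to [e / 2]. *)
  have [|d [d0 hd]] := fu (e / (4 * rho)); first by rewrite divr_gt0// mulr_gt0.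
  exists d; split=> // x y h.
  have hx := ccK_slice x kN hf; have hy := ccK_slice y kN hf.
  have hB : cc1 rho (fun t => f (setcoord x k t) + (-1) * f (setcoord y k t)).
    split=> [t|t ht]; last by rewrite hx.2// hy.2// mulr0 addr0.
    by apply: cvgD; [exact: hx.1|apply: cvgMr; exact: hy.1].
  have hy' : cc1 rho (fun t => (-1) * f (setcoord y k t)).
    split=> [t|t ht]; last by rewrite hy.2// mulr0.
    by apply: cvgMr; exact: hy.1.
  have -> : jstep k f x - jstep k f y =
      int1 (fun t => f (setcoord x k t) + (-1) * f (setcoord y k t)).
    by rewrite (int1D hx hy') (int1Z _ hy) mulN1r.
  apply: (@le_lt_trans _ _ (2 * rho * (e / (4 * rho)))).
    apply: int1_bound => //; first exact: ltW.
    move=> t; rewrite mulN1r; apply/ltW/hd => i; rewrite !mxE.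
    by case: ifP => // _; rewrite subrr normr0.
  have -> : 2 * rho * (e / (4 * rho)) = e / 2 by field; rewrite gt_eqF.
  lra.
rewrite /jstep.
have -> : (fun t => f (setcoord x k t)) = (fun t => 0 * 0 ).
  apply/funext => t; rewrite mulr0; apply: (fv _ j); first exact: ltnW.
  by rewrite mxE; case: eqP => // jk; move: kj; rewrite jk ltnn.
rewrite (@int1Z _ rho) ?mul0r//; split=> // t; exact: cvg_cst.
Qed.

Lemma ccK_pintN k rho f : (k <= N)%N -> ccK 0 rho f -> ccK k rho (pintN k f).
Proof. by move=> + hf; elim: k => //= k IH kN; apply: ccK_step => //; apply: IH; exact: ltnW. Qed.

Lemma pintN_D k rho f g : (k <= N)%N -> ccK 0 rho f -> ccK 0 rho g ->
  pintN k (fun x => f x + g x) = (fun x => pintN k f x + pintN k g x).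
Proof.
move=> + hf hg; elim: k => //= k IH kN; rewrite IH ?(ltnW kN)//.
apply/funext => x; rewrite {1}/jstep (@int1D _ rho)//.
  by apply: ccK_slice => //; apply: ccK_pintN => //; exact: ltnW.
by apply: ccK_slice => //; apply: ccK_pintN => //; exact: ltnW.
Qed.

Lemma pintN_Z k rho f c : (k <= N)%N -> ccK 0 rho f ->
  pintN k (fun x => c * f x) = (fun x => c * pintN k f x).
Proof.
move=> + hf; elim: k => //= k IH kN; rewrite IH ?(ltnW kN)//.
apply/funext => x; rewrite {1}/jstep (@int1Z _ rho)//.
by apply: ccK_slice => //; apply: ccK_pintN => //; exact: ltnW.
Qed.

Lemma pintN_le k rho f g : (k <= N)%N -> ccK 0 rho f -> ccK 0 rho g ->
  (forall x, f x <= g x) -> forall x, pintN k f x <= pintN k g x.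
Proof.
move=> + hf hg fg; elim: k => //= k IH kN x.
apply: (@int1_le _ rho) => [||t]; last by apply: IH; exact: ltnW.
  by apply: ccK_slice => //; apply: ccK_pintN => //; exact: ltnW.
by apply: ccK_slice => //; apply: ccK_pintN => //; exact: ltnW.
Qed.

Lemma pintN_bound k rho f (M : R) : (k <= N)%N -> ccK 0 rho f ->
  (forall x, `|f x| <= M) -> forall x, `|pintN k f x| <= (2 * rho) ^+ k * M.
Proof.
move=> + hf fM; elim: k => [|k IH kN x]; first by move=> _ x /=; rewrite mul1r.
rewrite exprS -mulrA; apply: int1_bound; first by apply/ltW; case: hf.
  by apply: ccK_slice => //; apply: ccK_pintN => //; exact: ltnW.
by move=> t; apply: IH; exact: ltnW.
Qed.

Lemma setcoord_id (x : pt) (k : nat) (kN : (k < N)%N) : setcoord x k (x 0 (Ordinal kN)) = x.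
Proof.
apply/rowP => j; rewrite mxE; case: eqP => // jk; congr (x _ _).
by apply/val_inj.
Qed.

(** The slice through [x] in direction [k] passes through [x] itself, so positivity at [x] persists
    at each integration. *)
Lemma pintN_gt0 k rho f x : (k <= N)%N -> ccK 0 rho f -> (forall y, 0 <= f y) ->
  0 < f x -> (forall y, 0 <= pintN k f y) /\ 0 < pintN k f x.
Proof.
move=> + hf f0 fx; elim: k => //= k IH kN.
have [h1 h2] := IH (ltnW kN).
have hs y := ccK_slice y kN (ccK_pintN (ltnW kN) hf).
split=> [y|]; last first.
  by apply: (@int1_gt0 _ rho _ (x 0 (Ordinal kN))) => //; rewrite setcoord_id.
by rewrite /jstep; apply: Rintegral_ge0.
Qed.

Lemma pintN_affine k rho f (a : R) (v : pt) : 0 < a -> (k <= N)%N -> ccK 0 rho f ->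
  pintN k (fun x => f (a *: x + v)) = (fun x => a^-1 ^+ k * pintN k f (a *: x + v)).
Proof.
move=> a0 + hf; elim: k => [_|k IH kN]; first by apply/funext => x; rewrite mul1r.
rewrite /= IH ?(ltnW kN)//; apply/funext => x; rewrite /jstep.
have hs y := ccK_slice y kN (ccK_pintN (ltnW kN) hf).
have -> : (fun t => a^-1 ^+ k * pintN k f (a *: setcoord x k t + v)) =
  (fun t => a^-1 ^+ k * pintN k f (setcoord (a *: x + v) k (a * t + v 0 (Ordinal kN)))).
  apply/funext => t; congr (_ * pintN _ _ _); apply/rowP => j; rewrite !mxE.
  case: eqP => // jk; congr (_ + v _ _); exact: val_inj.
have hs1 := int1_affine (v 0 (Ordinal kN)) a0 (hs (a *: x + v)).
have [rho' hs2] : exists rho' : R,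
    cc1 rho' (fun t => pintN k f (setcoord (a *: x + v) k (a * t + v 0 (Ordinal kN)))).
  exists (a^-1 * (rho + `|v 0 (Ordinal kN)|)); split=> [t|t ht].
    apply: (@continuous_comp _ _ _ (fun t : R => a * t + v 0 (Ordinal kN))
      (fun t => pintN k f (setcoord (a *: x + v) k t))); last exact: (hs _).1.
    by apply: cvgD; [apply: cvgMr; exact: cvg_id|exact: cvg_cst].
  apply: (hs _).2; rewrite -(ler_pM2l a0) mulrA mulfV ?gt_eqF// mul1r in ht.
  rewrite -(ger0_norm (ltW a0)) -normrM in ht.
  have := lerB_dist (a * t) (- v 0 (Ordinal kN)); rewrite normrN opprK; lra.
by rewrite (int1Z _ hs2) hs1 exprS mulrA [_ * a^-1]mulrC.
Qed.

(** The first [k] coordinates have become bound variables. For [k = N] this allows the base point to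
    be changed freely. *)
Lemma pintN_indep k f x y : (forall i : 'I_N, (k <= i)%N -> x 0 i = y 0 i) -> pintN k f x = pintN k f y.
Proof.
elim: k x y => [|k IH] x y h /=; first by congr f; apply/rowP => i; rewrite h.
rewrite /jstep; congr int1; apply/funext => t; apply: IH => i ki.
rewrite !mxE; case: eqP => // /eqP ik; apply: h; by rewrite ltn_neqAle eq_sym ik.
Qed.

Lemma iint_pintN k rho f x : (k <= N)%N -> ccK 0 rho f ->
  iint k (fun x => (f x)%:E) x = (pintN k f x)%:E.
Proof.
move=> + hf; elim: k x => //= k IH x kN.
under eq_integral do rewrite IH ?(ltnW kN)//.
by rewrite (@int1E _ rho)//; apply: ccK_slice => //; apply: ccK_pintN => //; exact: ltnW.
Qed.

Definition cc f := exists rho, ccK 0 rho f.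

Lemma ccK_widen k rho rho' f : rho <= rho' -> ccK k rho f -> ccK k rho' f.
Proof.
move=> h [r0 fu fv]; split=> //; first exact: lt_le_trans h.
by move=> x j kj hj; apply: (fv x j) => //; exact: le_trans hj.
Qed.

Lemma cc_common f g : cc f -> cc g -> exists rho, ccK 0 rho f /\ ccK 0 rho g.
Proof.
move=> [a ha] [b hb]; exists (Num.max a b).
by split; [apply: ccK_widen ha|apply: ccK_widen hb]; rewrite le_max lexx ?orbT.
Qed.

Lemma ccZ f (c : R) : cc f -> cc (fun x => c * f x).
Proof. by case=> rho h; exists rho; exact: ccKN. Qed.

Lemma ccD f g : cc f -> cc g -> cc (fun x => f x + g x).
Proof. by move=> hf hg; have [rho [h1 h2]] := cc_common hf hg; exists rho; exact: ccKD. Qed.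

Definition intN f : R := pintN N f 0.

Lemma intN_D f g : cc f -> cc g -> intN (fun x => f x + g x) = intN f + intN g.
Proof. by move=> hf hg; have [rho [h1 h2]] := cc_common hf hg; rewrite /intN (pintN_D _ h1 h2). Qed.

Lemma intN_Z f c : cc f -> intN (fun x => c * f x) = c * intN f.
Proof. by case=> rho h; rewrite /intN (pintN_Z _ _ h). Qed.

Lemma intN_le f g : cc f -> cc g -> (forall x, f x <= g x) -> intN f <= intN g.
Proof. by move=> hf hg; have [rho [h1 h2]] := cc_common hf hg => h; apply: (pintN_le _ h1 h2). Qed.

Lemma intN_bound rho f (M : R) : ccK 0 rho f -> (forall x, `|f x| <= M) ->
  `|intN f| <= (2 * rho) ^+ N * M.
Proof. by move=> h hM; exact: (pintN_bound _ h). Qed.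

Lemma intN_gt0 f x : cc f -> (forall y, 0 <= f y) -> 0 < f x -> 0 < intN f.
Proof.
move=> [rho h] f0 fx; have [_] := pintN_gt0 (leqnn N) h f0 fx.
by rewrite (pintN_indep _ (y := 0))// => i; rewrite leqNgt ltn_ord.
Qed.

Lemma intN_affine f (a : R) (v : pt) : 0 < a -> cc f ->
  intN (fun x => f (a *: x + v)) = a^-1 ^+ N * intN f.
Proof.
move=> a0 [rho h]; rewrite /intN (pintN_affine v a0 (leqnn N) h) /=; congr (_ * _).
by apply: pintN_indep => i; rewrite leqNgt ltn_ord.
Qed.

Lemma integral_RN_intN f : cc f -> integral_RN f = (intN f)%:E.
Proof. by case=> rho h; rewrite /integral_RN (iint_pintN _ _ h). Qed.

End IterInt.

(** * Directional derivatives and integration by parts *)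

Section Calculus.
Variables (R : realType) (N : nat).
Notation pt := 'rV[R]_N.
Implicit Types (f g : pt -> R) (x y : pt) (rho : R).

(** A relation instead of the operator [partial]: it carries existence of the derivative, so the
    rules of calculus compose without derivability side conditions. *)
Definition dpart (i : 'I_N) f g := forall x : pt, is_derive x (ebasis R i) f (g x).

Lemma dpartE i f g : dpart i f g -> partial i f = g.
Proof. by move=> h; apply/funext => x; rewrite /partial; have hx := h x; rewrite derive_val. Qed.

Lemma dpart_derivable i f g x : dpart i f g -> derivable f x (ebasis R i).
Proof. by move=> h; case: (h x). Qed.

Lemma dpart_ext i f g f' g' : f =1 f' -> g =1 g' -> dpart i f g -> dpart i f' g'.
Proof. by move=> /funext <- /funext <-. Qed.

Lemma dpart_cst i (c : R) : dpart i (fun=> c) (fun=> 0).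
Proof. by move=> x; exact: is_derive_cst. Qed.

Lemma dpartD i f g f' g' : dpart i f f' -> dpart i g g' ->
  dpart i (fun x => f x + g x) (fun x => f' x + g' x).
Proof. by move=> h1 h2 x; have := h1 x; have := h2 x => ? ?; exact: is_deriveD. Qed.

Lemma dpartM i f g f' g' : dpart i f f' -> dpart i g g' ->
  dpart i (fun x => f x * g x) (fun x => f' x * g x + f x * g' x).
Proof.
move=> h1 h2 x; have := h1 x; have := h2 x => ? ?.
have := is_deriveM (f := f) (g := g) (x := x) (v := ebasis R i) (h1 x) (h2 x).
by rewrite /GRing.scale/= [g x * _]mulrC addrC.
Qed.

Lemma dpartZ i f f' (c : R) : dpart i f f' ->
  dpart i (fun x => c * f x) (fun x => c * f' x).
Proof.
move=> h; apply: dpart_ext (dpartM (dpart_cst i c) h) => // x.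
by rewrite mul0r add0r.
Qed.

Lemma dpart_sum i (T : Type) (s : seq T) (F G : T -> pt -> R) :
  (forall k, dpart i (F k) (G k)) ->
  dpart i (fun x => \sum_(k <- s) F k x) (fun x => \sum_(k <- s) G k x).
Proof.
move=> h; elim: s => [|a s IH].
  by apply: dpart_ext (dpart_cst i 0) => x; rewrite big_nil.
by apply: dpart_ext (dpartD (h a) IH) => x; rewrite big_cons.
Qed.

(** Reduces directional derivatives to one real variable, where the chain rule and the mean value
    theorem are applied. *)
Lemma is_derive_slice f x (v : pt) (df : R) :
  is_derive x v f df <-> is_derive (0 : R) 1 (fun h : R => f (h *: v + x)) df.
Proof.
have E : 'D_v f x = 'D_1 (fun h : R => f (h *: v + x)) 0.
  rewrite /derive; set g1 := fun h => h^-1 *: _; set g2 := fun h => h^-1 *: _.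
  suff -> : g1 = g2 by [].
  apply/funext => h; rewrite /g1 /g2 /=.
  by rewrite scale0r add0r addr0 /GRing.scale/= mulr1.
split=> -[h1 h2]; split.
- exact: (derivable1P _ _ _).1 h1.
- by rewrite -E.
- exact: (derivable1P _ _ _).2 h1.
- by rewrite E.
Qed.

Lemma is_derive_line f x (v : pt) (t df : R) : is_derive (t *: v + x) v f df ->
  is_derive t 1 (fun h : R => f (h *: v + x)) df.
Proof.
move=> /is_derive_slice h.
have h2 : is_derive t 1 ((fun h : R => f (h *: v + (t *: v + x))) \o (fun s : R => s - t)) df.
  rewrite -[df]mulr1.
  apply: is_derive1_comp.
    by rewrite subrr.
  exact: (is_derive_shift t 1 (- t)).
apply: near_eq_is_derive h2.
by near=> s => /=; rewrite addrA -scalerDl subrK.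
Unshelve. all: by end_near. Qed.

Lemma dpart_comp i (a da : pt -> R) (F : R -> R) (dF : R) x :
  is_derive x (ebasis R i) a (da x) -> is_derive (a x) 1 F dF ->
  is_derive x (ebasis R i) (fun y => F (a y)) (dF * da x).
Proof.
move=> /is_derive_slice h1 h2; apply/is_derive_slice.
apply: (@is_derive1_comp _ F (fun h : R => a (h *: ebasis R i + x))) => //.
by rewrite scale0r add0r.
Qed.

Lemma is_derive_affine (a b t : R) : is_derive t 1 (fun s : R => a * s + b) a.
Proof.
set F := fun s : R => _.
have -> : a = a *: 1 + 0 :> R by rewrite addr0 /GRing.scale/= mulr1.
by apply: is_deriveD.
Qed.

Lemma dpart_coord i j : dpart i (fun x => x 0 j) (fun=> (i == j)%:R).
Proof.
move=> x; apply/is_derive_slice.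
have -> : (fun h : R => (h *: ebasis R i + x) 0 j) = (fun h : R => (i == j)%:R * h + x 0 j).
  by apply/funext => h; rewrite !mxE eqxx /= eq_sym mulrC.
exact: is_derive_affine.
Qed.

Lemma mean_value i f g x (h : R) : dpart i f g -> 0 <= h ->
  exists2 c : R, 0 <= c <= h &
    f (h *: ebasis R i + x) - f x = h * g (c *: ebasis R i + x).
Proof.
move=> D h0.
have dl t := is_derive_line (D (t *: ebasis R i + x)).
have ct : {within `[0, h], continuous (fun t : R => f (t *: ebasis R i + x))}.
  apply: continuous_subspaceT => t; apply/differentiable_continuous/derivable1_diffP.
  by case: (dl t).
have [c cI E] := MVT_segment h0 (fun t _ => dl t) ct.
exists c; first by move: cI; rewrite in_itv.
by move: E; rewrite scale0r add0r subr0 mulrC.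
Qed.

Lemma continuous_cc f rho : 0 < rho -> continuous f ->
  (forall x (j : 'I_N), rho <= `|x 0 j| -> f x = 0) -> cc f.
Proof.
move=> r0 cf fv; exists rho; split=> //; last by move=> x j _; exact: fv.
move=> e e0.
(* The margin 1 ensures that a point outside [K] and any point within distance 1 of it are both
   outside the support. *)
pose K := [set v : pt | forall i, `[- (rho + 1), rho + 1]%classic (v ord0 i)].
have cK : compact K.
  exact: (@rV_compact R N (fun=> `[- (rho + 1), rho + 1]%classic) (fun=> @segment_compact _ _ _)).
pose P (d : R) x := forall y, (forall i, `|x 0 i - y 0 i| < d) -> `|f x - f y| < e.
have H x : K x -> \forall x' \near x & d \near (0:R)^'+, P d x'.
  move=> Kx.
  have e2 : 0 < e / 2 by lra.
  have /cvgrPdist_lt/(_ _ e2)/nbhs_ballP[d /= d0 hd] := cf x.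
  exists (ball x (d / 2), [set t : R | t < d / 2]) => /=.
    split; first by apply: nbhsx_ballx; lra.
    by exists (d / 2) => /=; [lra|move=> t /= ht t0; move: ht; rewrite sub0r normrN gtr0_norm].
  move=> [x' t] /= [hx' ht] y hy.
  have xx' : ball x d x' by apply: le_ball hx'; lra.
  have xy : ball x d y.
    split=> // i j; rewrite (ord1 i).
    have := hx'.2 0 j; rewrite /ball/= => h1; have h2 := hy j.
    have -> : x 0 j - y 0 j = (x 0 j - x' 0 j) + (x' 0 j - y 0 j) by ring.
    apply: le_lt_trans (ler_normD _ _) _; lra.
  have -> : f x' - f y = (f x - f y) - (f x - f x') by ring.
  apply: le_lt_trans (ler_normB _ _) _.
  have := hd _ xx'; have := hd _ xy; lra.
(* Compactness turns the radii that work near each point of [K] into a single one. *)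
have [d /= d0 hd] := (compact_near_coveringP K).1 cK R _ P _ H.
exists (Num.min (d / 2) 1); split; first by rewrite lt_min; apply/andP; split; lra.
move=> x y h.
have h1 i : `|x 0 i - y 0 i| < d / 2 by have := h i; rewrite lt_min => /andP[].
have h2 i : `|x 0 i - y 0 i| < 1 by have := h i; rewrite lt_min => /andP[].
have [Kx|nKx] := pselect (K x).
  have hd2 : `|0 - d / 2| < d by rewrite sub0r normrN gtr0_norm; lra.
  have hd3 : 0 < d / 2 by lra.
  exact: (hd (d / 2) hd2 hd3 x Kx y h1).
have [j hj] : exists j, rho + 1 < `|x 0 j|.
  apply: contrapT => nh; apply: nKx => i; rewrite /= in_itv/= -ler_norml leNgt.
  by apply/negP => hi; apply: nh; exists i.
rewrite (fv x j) ?(fv y j) ?subrr ?normr0//; last by lra.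
have := lerB_dist (x 0 j) (y 0 j); have := h2 j.
have := ler_dist_dist (x 0 j) (y 0 j); have := ler_norm (`|x 0 j| - `|y 0 j|); lra.
Qed.

Lemma ccK_shift rho f (v : pt) : (forall i, `|v 0 i| <= 1) -> ccK 0 rho f ->
  ccK 0 (rho + 1) (fun x => f (1 *: x + v)).
Proof.
move=> hv [r0 fu fv]; split; first by lra.
  move=> e /fu [d [d0 hd]]; exists d; split=> // x y h; apply: hd => i.
  by rewrite !mxE !mul1r opprD addrACA subrr addr0.
move=> x j _ hj; apply: (fv _ j) => //; rewrite !mxE mul1r.
have := lerB_dist (x 0 j) (- v 0 j); rewrite normrN opprK; have := hv j; lra.
Qed.

(* Translation invariance of [intN] makes the integral of every difference quotient vanish. *)
Lemma intN_dpart i f g : cc f -> cc g -> dpart i f g -> intN g = 0.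
Proof.
move=> hf hg D; have [rho [kf kg]] := cc_common hf hg.
have [r0 _ _] := kf.
suff H e : 0 < e -> `|intN g| <= (2 * (rho + 1)) ^+ N * e.
  apply/eqP; rewrite -normr_le0; apply/ler_addgt0Pl => e e0; rewrite addr0.
  pose A := (2 * (rho + 1)) ^+ N.
  have A0 : 0 < A by apply: exprn_gt0; lra.
  by have := H (e / A) (divr_gt0 e0 A0); rewrite -/A mulrC divfK// gt_eqF.
move=> e0; have [_ gu _] := kg; have [d [d0 hd]] := gu e e0.
pose h := Num.min (d / 2) 1.
have h0 : 0 < h by rewrite lt_min; apply/andP; split; lra.
have h1 : h <= 1 by rewrite ge_min lexx orbT.
have hd2 : h < d by rewrite gt_min; apply/orP; left; lra.
pose v := h *: ebasis R i.
have hv j : `|v 0 j| <= 1.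
  rewrite !mxE eqxx/=; case: (_ == _); rewrite ?mulr1 ?mulr0 ?normr0//.
  by rewrite gtr0_norm.
have kfs := ccK_shift hv kf.
have rr : rho <= rho + 1 by lra.
have kf' := ccKN (-1) (ccK_widen rr kf); have kg' := ccKN (- h) (ccK_widen rr kg).
have kA := ccKD (ccKD kfs kf') kg'.
have := intN_bound (M := h * e) kA.
have -> : intN (fun x => f (1 *: x + v) + -1 * f x + - h * g x) = - h * intN g.
  rewrite intN_D; [|by exists (rho + 1); exact: ccKD|by exists (rho+1)].
  rewrite intN_D; [|by exists (rho + 1)|by exists (rho+1)].
  rewrite intN_affine// !intN_Z// invr1 expr1n; ring.
rewrite normrM normrN (gtr0_norm h0) mulrCA => /(_ _); rewrite ler_pM2l//; apply.
move=> x; have [c /andP[c0 ch] E] := mean_value x D (ltW h0).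
have -> : f (1 *: x + v) + -1 * f x + - h * g x = h * (g (c *: ebasis R i + x) - g x).
  by rewrite mulrBr -E scale1r [x + v]addrC /v; ring.
rewrite normrM (gtr0_norm h0) ler_pM2l//; apply/ltW/hd => j.
rewrite !mxE eqxx/= addrK; case: (_ == _); rewrite ?mulr1 ?mulr0 ?normr0//.
by rewrite ger0_norm//; lra.
Qed.

End Calculus.

(** * Smooth functions and cut-offs *)

Section Smooth1.
Variable R : realType.
Implicit Types (f g : R -> R) (S : (R -> R) -> Prop).

Definition d1 f g := forall t : R, is_derive t 1 f (g t).

Lemma d1_ext f g f' g' : f =1 f' -> g =1 g' -> d1 f g -> d1 f' g'.
Proof. by move=> /funext <- /funext <-. Qed.

Lemma d1_cst (c : R) : d1 (fun=> c) (fun=> 0).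
Proof. by move=> t; exact: is_derive_cst. Qed.

Lemma d1_id : d1 id (fun=> 1).
Proof. by move=> t; exact: is_derive_id. Qed.

Lemma d1D f g f' g' : d1 f f' -> d1 g g' -> d1 (fun t => f t + g t) (fun t => f' t + g' t).
Proof. by move=> h1 h2 t; have := h1 t; have := h2 t => ? ?; exact: is_deriveD. Qed.

Lemma is_derive1_mul f g (t df dg : R) : is_derive t 1 f df -> is_derive t 1 g dg ->
  is_derive t 1 (fun t => f t * g t) (df * g t + f t * dg).
Proof.
move=> h1 h2.
by have := is_deriveM h1 h2; rewrite /GRing.scale/= [g t * _]mulrC addrC.
Qed.

Lemma d1M f g f' g' : d1 f f' -> d1 g g' ->
  d1 (fun t => f t * g t) (fun t => f' t * g t + f t * g' t).
Proof. by move=> h1 h2 t; exact: is_derive1_mul. Qed.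

Lemma d1_comp f g f' g' : d1 f f' -> d1 g g' ->
  d1 (fun t => f (g t)) (fun t => f' (g t) * g' t).
Proof.
by move=> h1 h2 t; exact: (@is_derive1_comp _ f g t (f' (g t)) (g' t) (h1 _) (h2 _)).
Qed.

Lemma is_derive1_inv f (t df : R) : f t != 0 -> is_derive t 1 f df ->
  is_derive t 1 (fun t => (f t)^-1) (- (f t)^-1 ^+ 2 * df).
Proof.
move=> ft h; split; first by apply: derivableV => //; case: h.
rewrite deriveV//.
by rewrite derive_val exprVn /GRing.scale/=.
Qed.

Lemma d1V f f' : (forall t, f t != 0) -> d1 f f' ->
  d1 (fun t => (f t)^-1) (fun t => - (f t)^-1 ^+ 2 * f' t).
Proof. by move=> h0 h t; exact: is_derive1_inv. Qed.

Lemma d1_continuous f g : d1 f g -> continuous f.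
Proof. by move=> h t; apply/differentiable_continuous/derivable1_diffP; case: (h t). Qed.

Definition smooth1 f := exists g : nat -> R -> R, g 0%N = f /\ forall n, d1 (g n) (g n.+1).

(** Coinduction for smoothness: choosing a derivative inside the class again and again yields the
    whole sequence of derivatives. *)
Lemma smooth1_coind S : (forall f, S f -> exists g, S g /\ d1 f g) ->
  forall f, S f -> smooth1 f.
Proof.
move=> h f Sf.
have /choice[nxt Hn] : forall p : {f | S f}, exists q : {f | S f}, d1 (sval p) (sval q).
  by move=> [a Sa]; have [b [Sb ab]] := h a Sa; exists (exist _ b Sb).
by exists (fun n => sval (iter n nxt (exist _ f Sf))); split=> // n; exact: Hn.
Qed.

Lemma smooth1_d1 f : smooth1 f -> exists g, smooth1 g /\ d1 f g.
Proof.
move=> [g [<- h]]; exists (g 1%N); split=> //.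
by exists (fun n => g n.+1); split=> // n; exact: h.
Qed.

(** A syntactic class closed under differentiation, hence made of smooth functions by
    [smooth1_coind]; it settles all closure properties of smoothness at once. *)
Inductive sm1_gen : (R -> R) -> Prop :=
| sm1_base f of smooth1 f : sm1_gen f
| sm1_cst c : sm1_gen (fun=> c)
| sm1_id : sm1_gen id
| sm1_expR : sm1_gen expR
| sm1_cos : sm1_gen cos
| sm1_sin : sm1_gen sin
| sm1_add f g of sm1_gen f & sm1_gen g : sm1_gen (fun t => f t + g t)
| sm1_mul f g of sm1_gen f & sm1_gen g : sm1_gen (fun t => f t * g t)
| sm1_comp f g of sm1_gen f & sm1_gen g : sm1_gen (fun t => f (g t))
| sm1_inv f of (forall t, f t != 0) & sm1_gen f : sm1_gen (fun t => (f t)^-1).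

Lemma sm1_gen_smooth1 f : sm1_gen f -> smooth1 f.
Proof.
apply: smooth1_coind => {}f; elim.
- by move=> a /smooth1_d1[b [hb hab]]; exists b; split=> //; exact: sm1_base.
- by move=> c; exists (fun=> 0); split; [exact: sm1_cst|exact: d1_cst].
- by exists (fun=> 1); split; [exact: sm1_cst|exact: d1_id].
- by exists expR; split; [exact: sm1_expR|move=> t; exact: is_derive_expR].
- exists (fun t => -1 * sin t); split; first by apply: sm1_mul; [exact: sm1_cst|exact: sm1_sin].
  by move=> t; rewrite mulN1r; exact: is_derive_cos.
- by exists cos; split; [exact: sm1_cos|move=> t; exact: is_derive_sin].
- move=> a b _ [a' [ha ka]] _ [b' [hb kb]].
  by exists (fun t => a' t + b' t); split; [exact: sm1_add|exact: d1D].
- move=> a b sa [a' [ha ka]] sb [b' [hb kb]].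
  exists (fun t => a' t * b t + a t * b' t); split; last exact: d1M.
  by apply: sm1_add; exact: sm1_mul.
- move=> a b sa [a' [ha ka]] sb [b' [hb kb]].
  exists (fun t => a' (b t) * b' t); split; last exact: d1_comp.
  by apply: sm1_mul => //; exact: sm1_comp.
- move=> a a0 sa [a' [ha ka]].
  exists (fun t => - (a t)^-1 ^+ 2 * a' t); split; last exact: d1V.
  have -> : (fun t => - (a t)^-1 ^+ 2 * a' t) =
      (fun t => (-1) * ((a t)^-1 * (a t)^-1) * a' t).
    by apply/funext => t; rewrite mulN1r expr2.
  apply: sm1_mul => //; apply: sm1_mul; first exact: sm1_cst.
  by apply: sm1_mul; exact: sm1_inv.
Qed.

(* All derivatives of [exp (- 1 / t)], extended by [0] to [t <= 0], have this form. *)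
Definition flat (p : {poly R}) (t : R) : R :=
  if 0 < t then p.[t^-1] * expR (- t^-1) else 0.

(** With [y = 1 / t] and [n = 2] it bounds [flat p t] by a multiple of [t ^+ 2] on (0, 1], which
    gives differentiability at the origin. *)
Lemma poly_exp_bound (p : {poly R}) (n : nat) : exists2 C : R, 0 <= C &
  forall y : R, 1 <= y -> `|p.[y]| * y ^+ n <= C * expR y.
Proof.
elim/poly_ind: p n => [|p c IH] n.
  by exists 0 => // y _; rewrite horner0 normr0 !mul0r.
have [C C0 hC] := IH n.+1.
exists (C + `|c| * (n.+1)`!%:R) => [|y y1]; first by rewrite addr_ge0// mulr_ge0.
have y0 : 0 <= y by lra.
have h1 : y ^+ n <= n.+1`!%:R * expR y.
  have h : y ^+ n.+1 / n.+1`!%:R <= expR y by have := expR_ge1Dxn n y0; lra.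
  rewrite ler_pdivrMr ?ltr0n ?fact_gt0// mulrC in h.
  by apply: le_trans h; rewrite exprS ler_peMl// exprn_ge0.
rewrite hornerMXaddC; apply: (@le_trans _ _ ((`|p.[y]| * y + `|c|) * y ^+ n)).
  rewrite ler_wpM2r ?exprn_ge0//; apply: le_trans (ler_normD _ _) _.
  by rewrite normrM (ger0_norm y0).
rewrite !mulrDl; apply: lerD; first by rewrite -mulrA -exprS; exact: hC.
by rewrite -mulrA ler_wpM2l.
Qed.

Lemma is_derive_quadratic f (C : R) : f 0 = 0 -> 0 <= C ->
  (forall h : R, `|h| <= 1 -> `|f h| <= C * `|h| ^+ 2) -> is_derive (0 : R) 1 f 0.
Proof.
move=> f0 C0 hf.
have H : (fun h : R => h^-1 *: ((f \o shift 0) (h *: 1) - f 0)) @ 0^' --> (0 : R).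
  apply/cvgrPdist_lt => e e0.
  exists (Num.min 1 (e / (C + 1))) => /=.
    by rewrite lt_min ltr01 divr_gt0//; lra.
  move=> h /=; rewrite sub0r normrN lt_min => /andP[h1 h2] h0.
  rewrite sub0r normrN f0 subr0 addr0 /GRing.scale/= mulr1 normrM normfV.
  have hp : 0 < `|h| by rewrite normr_gt0.
  rewrite ltr_pdivrMl//; apply: le_lt_trans (hf h (ltW h1)) _.
  rewrite expr2 mulrCA ltr_pM2l//.
  rewrite ltr_pdivlMr in h2; last by lra.
  by apply: le_lt_trans h2; rewrite mulrC; nra.
by split; [apply/cvg_ex; exists 0|apply/cvg_lim].
Qed.

(** For [t > 0] the factor [X^2] comes from differentiating [1 / t], the term [p] from the
    exponential and [- p'] from the polynomial. *)
Lemma d1_flat p : d1 (flat p) (flat ('X^2 * (p - p^`()))).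
Proof.
move=> t; have [t0|t0|<-] := ltgtP 0 t.
- have H : is_derive t 1 (fun s => p.[s^-1] * expR (- s^-1)) (flat ('X^2 * (p - p^`())) t).
    have i0 : is_derive t 1 (fun s : R => s^-1) (- t^-1 ^+ 2).
      have -> : - t^-1 ^+ 2 = - t^-1 ^+ 2 * 1 by rewrite mulr1.
      by apply: is_derive1_inv; rewrite gt_eqF.
    have i1 : is_derive t 1 (fun s => p.[s^-1]) (p^`().[t^-1] * - t^-1 ^+ 2).
      exact: (@is_derive1_comp _ (horner p) _ _ _ _ (is_derive_poly p t^-1) i0).
    have i2 : is_derive t 1 (fun s : R => - s^-1) (t^-1 ^+ 2).
      by rewrite -[t^-1 ^+ 2]opprK; exact: is_deriveN.
    have i3 : is_derive t 1 (fun s => expR (- s^-1)) (expR (- t^-1) * t^-1 ^+ 2).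
      exact: (@is_derive1_comp _ expR _ _ _ _ (is_derive_expR _) i2).
    have := is_derive1_mul i1 i3; congr (is_derive _ _ _ _).
    by rewrite /flat t0 hornerM hornerXn hornerD hornerN; ring.
  apply: near_eq_is_derive H.
  have := @lt_nbhsr R 0 t t0; apply: filterS => s /= s0.
  by rewrite /flat s0.
- have -> : flat ('X^2 * (p - p^`())) t = 0 by rewrite /flat ltNge (ltW t0).
  apply: near_eq_is_derive (is_derive_cst (0:R) _ _).
  have := @lt_nbhsl R t 0 t0; apply: filterS => s /= s0.
  by rewrite /flat ltNge (ltW s0).
(* At the junction the derivative is 0 because the function is of order [t ^+ 2]. *)
- have -> : flat ('X^2 * (p - p^`())) 0 = 0 by rewrite /flat ltxx.
  have [C C0 hC] := poly_exp_bound p 2.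
  apply: (@is_derive_quadratic _ C) => // [|h h1]; first by rewrite /flat ltxx.
  rewrite /flat; case: ifPn => h0; last by rewrite normr0 mulr_ge0// exprn_ge0.
  rewrite (gtr0_norm h0) in h1 *.
  have h2 : 1 <= h^-1 by rewrite -[1]invr1 lef_pV2 ?posrE.
  have := hC _ h2; rewrite exprVn ler_pdivrMr ?exprn_gt0// => K.
  by rewrite normrM (ger0_norm (expR_ge0 _)) expRN ler_pdivrMr ?expR_gt0// mulrAC.
Qed.

Lemma smooth1_flat p : smooth1 (flat p).
Proof.
apply: (@smooth1_coind (fun f => exists p, f = flat p)); last by exists p.
by move=> f [q ->]; eexists; split; [eexists; reflexivity|exact: d1_flat].
Qed.

(** The usual smooth transition from 0 on t <= 0 to 1 on t >= 1; the denominator is positive because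
    [t] and [1 - t] are never both nonpositive. *)
Definition step (t : R) : R := flat 1 t / (flat 1 t + flat 1 (1 - t)).

Lemma flat1_ge0 t : 0 <= flat 1 t.
Proof. by rewrite /flat; case: ifP => // _; rewrite hornerC mul1r expR_ge0. Qed.

Lemma flat1_gt0 t : 0 < t -> 0 < flat 1 t.
Proof. by rewrite /flat => ->; rewrite hornerC mul1r expR_gt0. Qed.

Lemma flat1_le0 t : t <= 0 -> flat 1 t = 0.
Proof. by rewrite /flat ltNge => ->. Qed.

Lemma step_den t : 0 < flat 1 t + flat 1 (1 - t).
Proof.
have [t0|t0] := lerP t 0.
  by rewrite ltr_wpDl ?flat1_ge0// flat1_gt0//; lra.
by rewrite ltr_pwDl ?flat1_ge0// flat1_gt0.
Qed.

Lemma step_le0 t : t <= 0 -> step t = 0.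
Proof. by move=> t0; rewrite /step flat1_le0// mul0r. Qed.

Lemma step_ge1 t : 1 <= t -> step t = 1.
Proof.
move=> t1; rewrite /step; have := step_den t; rewrite [flat 1 (1 - t)]flat1_le0; last by lra.
by rewrite addr0 => h; rewrite divff// gt_eqF.
Qed.

Lemma step_itv t : 0 <= step t <= 1.
Proof.
have := step_den t => h; rewrite /step divr_ge0 ?flat1_ge0 ?(ltW h)//=.
by rewrite ler_pdivrMr// mul1r lerDl flat1_ge0.
Qed.

Lemma smooth1_step : smooth1 step.
Proof.
apply: sm1_gen_smooth1; apply: sm1_mul; first by apply/sm1_base/smooth1_flat.
apply: sm1_inv => [t|]; first by rewrite gt_eqF ?step_den.
apply: sm1_add; first by apply/sm1_base/smooth1_flat.
apply: (@sm1_comp _ (fun t => 1 - t)); first by apply/sm1_base/smooth1_flat.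
have -> : (fun t : R => 1 - t) = (fun t => 1 + (-1) * t) by apply/funext => t; rewrite mulN1r.
by apply: sm1_add; [exact: sm1_cst|apply: sm1_mul; [exact: sm1_cst|exact: sm1_id]].
Qed.

Definition testR f := smooth1 f /\ exists k : R, 0 < k /\ forall t, k <= `|t| -> f t = 0.

Lemma testR_d1 f : testR f -> exists g, testR g /\ d1 f g.
Proof.
move=> [/smooth1_d1[g [hg D]] [k [k0 hk]]]; exists g; split=> //; split=> //.
exists (k + 1); split=> [|t ht]; first by lra.
have H : is_derive t 1 f 0.
  apply: near_eq_is_derive (is_derive_cst (0:R) _ _).
  apply/nbhs_ballP; exists 1 => //= s; rewrite /ball/= => hs; rewrite hk//.
  have := lerB_dist t (t - s); have -> : t - (t - s) = s by ring.
  lra.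
by case: (D t) => _ <-; case: H.
Qed.

Lemma testRM f g : smooth1 f -> testR g -> testR (fun t => f t * g t).
Proof.
move=> hf [hg [k [k0 hk]]]; split; last by exists k; split=> // t /hk ->; rewrite mulr0.
by apply: sm1_gen_smooth1; apply: sm1_mul; exact: sm1_base.
Qed.

Lemma testRD f g : testR f -> testR g -> testR (fun t => f t + g t).
Proof.
move=> [hf [k [k0 hk]]] [hg [l [l0 hl]]]; split.
  by apply: sm1_gen_smooth1; apply: sm1_add; exact: sm1_base.
exists (Num.max k l); split=> [|t]; first by rewrite lt_max k0.
by rewrite ge_max => /andP[/hk -> /hl ->]; rewrite addr0.
Qed.

Lemma testR_shift f (s : R) : testR f -> testR (fun t => f (t + s)).
Proof.
move=> [hf [k [k0 hk]]]; split.
  apply: sm1_gen_smooth1; apply: (@sm1_comp f (fun t => t + s)); first exact: sm1_base.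
  by apply: sm1_add; [exact: sm1_id|exact: sm1_cst].
exists (k + `|s|); split=> [|t ht]; first by rewrite ltr_wpDr.
apply: hk; have := lerB_dist t (- s); rewrite normrN opprK; lra.
Qed.

End Smooth1.

Lemma continuous_add (R : realType) (T : topologicalType) (f g : T -> R) :
  continuous f -> continuous g -> continuous (fun x => f x + g x).
Proof. by move=> cf cg x; apply: (continuousD (cf x) (cg x)). Qed.

Lemma continuous_mul (R : realType) (T : topologicalType) (f g : T -> R) :
  continuous f -> continuous g -> continuous (fun x => f x * g x).
Proof. by move=> cf cg x; apply: (continuousM (cf x) (cg x)). Qed.

(** * Smooth functions of several variables and radial profiles *)

Section SmoothN.
Variables (R : realType) (N : nat).
Notation pt := 'rV[R]_N.
Implicit Types (f g : pt -> R) (G H : R -> R) (x y : pt).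

Lemma iter_partial_rcons s i f : iter_partial (rcons s i) f = iter_partial s (partial i f).
Proof. by elim: s => //= j s ->. Qed.

Lemma smooth_continuous f : smooth f -> continuous f.
Proof. by move=> /(_ [::])[]. Qed.

Lemma smooth_partial f i : smooth f -> smooth (partial i f) /\ dpart i f (partial i f).
Proof.
move=> sf; split=> [s|x]; first by rewrite -iter_partial_rcons; exact: sf.
by apply: derivableP; exact: (sf [::]).2.
Qed.

Lemma smooth_coind (S : (pt -> R) -> Prop) :
  (forall f, S f -> continuous f /\ forall i, exists2 g, S g & dpart i f g) ->
  forall f, S f -> smooth f.
Proof.
move=> h f Sf s.
have Ss : S (iter_partial s f).
  elim: s => //= i s /h[_ /(_ i)[g Sg D]].
  by rewrite (dpartE D).
have [c d] := h _ Ss; split=> // i x; have [g _ D] := d i.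
exact: dpart_derivable D.
Qed.

Definition nsq x : R := \sum_(i < N) x 0 i ^+ 2.

Lemma nsq_ge0 x : 0 <= nsq x.
Proof. by apply: sumr_ge0 => i _; exact: sqr_ge0. Qed.

Lemma coord_le_nsq x i : x 0 i ^+ 2 <= nsq x.
Proof.
by rewrite /nsq (bigD1 i)//= lerDl; apply: sumr_ge0 => j _; exact: sqr_ge0.
Qed.

Lemma nsq_continuous : continuous nsq.
Proof.
rewrite /nsq; elim: (index_enum _) => [|i s IH].
  have -> : (fun y : pt => \sum_(i <- [::]) y 0 i ^+ 2) = (fun=> 0).
    by apply/funext => y; rewrite big_nil.
  by move=> x; exact: cst_continuous.
have -> : (fun y : pt => \sum_(i <- i :: s) y 0 i ^+ 2) =
    (fun y => y 0 i * y 0 i + \sum_(i <- s) y 0 i ^+ 2).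
  by apply/funext => y; rewrite big_cons expr2.
apply: continuous_add; last exact: IH.
by apply: continuous_mul => x; exact: coord_continuous.
Qed.

Lemma dpart_nsq i : dpart i nsq (fun x => 2 * x 0 i).
Proof.
have := @dpart_sum R N i _ (index_enum 'I_N) (fun j x => x 0 j * x 0 j)
  (fun j x => (i == j)%:R * x 0 j + x 0 j * (i == j)%:R)
  (fun j => dpartM (@dpart_coord R N i j) (@dpart_coord R N i j)).
apply: dpart_ext => x; first by apply: eq_bigr => j _; rewrite expr2.
rewrite (bigD1 i)//= eqxx big1 => [|j /negbTE ji] /=.
  by rewrite mul1r mulr1 addr0 mulr2n mulrDl mul1r.
by rewrite eq_sym ji mul0r mulr0 addr0.
Qed.

(* [ln (nsq x) / 2] is [ln |x|]: this is the radial function [G (ln |x|)], set to [0]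
   at the origin. *)
Definition Rad G x : R := if 0 < nsq x then G (ln (nsq x) / 2) else 0.

Lemma Rad_far (k : R) G x : 0 < k -> (forall t, k <= `|t| -> G t = 0) ->
  expR (2 * k) <= nsq x -> Rad G x = 0.
Proof.
move=> k0 hG h; rewrite /Rad; case: ifP => // q0; apply: hG.
have : 2 * k <= ln (nsq x) by rewrite -ler_expR lnK.
move=> h2; rewrite ger0_norm; lra.
Qed.

Lemma Rad_near (k : R) G x : 0 < k -> (forall t, k <= `|t| -> G t = 0) ->
  nsq x <= expR (- (2 * k)) -> Rad G x = 0.
Proof.
move=> k0 hG h; rewrite /Rad; case: ifP => // q0; apply: hG.
have : ln (nsq x) <= - (2 * k) by rewrite -ler_expR lnK.
move=> h2; rewrite ler0_norm; lra.
Qed.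

Lemma Rad_near0 G x : testR G -> nsq x = 0 -> \forall y \near x, Rad G y = 0.
Proof.
move=> [_ [k [k0 hk]]] qx.
have : \forall y \near x, nsq y < expR (- (2 * k)).
  by apply: (@cvgr_lt _ _ _ _ nsq _ (nsq_continuous (x := x))); rewrite qx expR_gt0.
by apply: filterS => y /ltW; exact: Rad_near.
Qed.

Lemma nsq_near_pos x : 0 < nsq x -> \forall y \near x, 0 < nsq y.
Proof. by move=> h; apply: (@cvgr_gt _ _ _ _ nsq _ (nsq_continuous (x := x))). Qed.

Lemma nsq0Vpos x : nsq x = 0 \/ 0 < nsq x.
Proof. by have := nsq_ge0 x; rewrite le_eqVlt => /orP[/eqP ->|]; [left|right]. Qed.

Lemma Rad_continuous G : testR G -> continuous (Rad G).
Proof.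
move=> tG x; have [q0|q0] := nsq0Vpos x.
  exact: near_cst_continuous (Rad_near0 tG q0).
have /smooth1_d1[G' [_ D]] := tG.1.
have : (fun y => G (ln (nsq y) / 2)) @ x --> G (ln (nsq x) / 2).
  apply: (@continuous_comp _ _ _ nsq (fun s => G (ln s / 2))); first exact: nsq_continuous.
  apply: (@continuous_comp _ _ _ (fun s : R => ln s / 2) G); last exact: d1_continuous D _.
  by apply: cvgMl; exact: continuous_ln.
have -> : G (ln (nsq x) / 2) = Rad G x by rewrite /Rad q0.
rewrite /continuous_at; apply: cvg_trans.
apply: (@near_eq_cvg _ _ (nbhs x) _ (fun y => G (ln (nsq y) / 2)) (Rad G)).
near=> y; rewrite /Rad ifT//; near: y; exact: nsq_near_pos.
Unshelve. all: by end_near. Qed.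

(** The gradient of ln |x| is x / |x|^2, and |x|^(-2) is exp(- 2 t) at t = ln |x|, so the derivative
    is a coordinate times another radial profile. Near the origin everything vanishes because [G]
    has bounded support. *)
Lemma dpart_Rad i G G' : testR G -> d1 G G' ->
  dpart i (Rad G) (fun x => x 0 i * Rad (fun t => expR (- (2 * t)) * G' t) x).
Proof.
move=> tG D x; have [q0|q0] := nsq0Vpos x.
  have -> : x 0 i * Rad (fun t => expR (- (2 * t)) * G' t) x = 0 by rewrite /Rad q0 ltxx mulr0.
  apply: near_eq_is_derive (is_derive_cst (0:R) _ _).
  by have := Rad_near0 tG q0; apply: filterS => y ->.
have -> : x 0 i * Rad (fun t => expR (- (2 * t)) * G' t) x =
    (G' (ln (nsq x) / 2) * ((nsq x)^-1 / 2)) * (2 * x 0 i).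
  have e2 : 2 * (ln (nsq x) / 2) = ln (nsq x) by lra.
  by rewrite /Rad q0 e2 expRN lnK//; field; rewrite gt_eqF.
apply: (@near_eq_is_derive _ _ _ (fun y => G (ln (nsq y) / 2))).
  by have := nsq_near_pos q0; apply: filterS => y; rewrite /Rad => ->.
apply: (@dpart_comp R N i nsq (fun x => 2 * x 0 i) (fun s => G (ln s / 2))).
  exact: dpart_nsq.
apply: (@is_derive1_comp _ G (fun s => ln s / 2)); first exact: D.
have := is_derive1_mul (is_derive1_ln q0) (@is_derive_cst R R R (2^-1 : R) (nsq x) 1).
by rewrite mulr0 addr0.
Qed.

Lemma testR_exp (a : R) G : testR G -> testR (fun t => expR (a * t) * G t).
Proof.
apply: testRM; apply: sm1_gen_smooth1; apply: (@sm1_comp _ _ (fun t => a * t)).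
  exact: sm1_expR.
by apply: sm1_mul; [exact: sm1_cst|exact: sm1_id].
Qed.

(** As in one variable, a class stable under every partial derivative; [dpart_Rad] is what makes the
    radial generators admissible. *)
Inductive smooth_gen : (pt -> R) -> Prop :=
| sg_base f of smooth f : smooth_gen f
| sg_cst c : smooth_gen (fun=> c)
| sg_coord j : smooth_gen (fun x => x 0 j)
| sg_rad G of testR G : smooth_gen (Rad G)
| sg_add f g of smooth_gen f & smooth_gen g : smooth_gen (fun x => f x + g x)
| sg_mul f g of smooth_gen f & smooth_gen g : smooth_gen (fun x => f x * g x).

Lemma smooth_gen_smooth f : smooth_gen f -> smooth f.
Proof.
apply: smooth_coind => {}f; elim.
- move=> g sg; split=> [|i]; first exact: smooth_continuous.
  by have [s D] := smooth_partial i sg; exists (partial i g) => //; exact: sg_base.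
- move=> c; split=> [|i]; first by move=> x; exact: cst_continuous.
  by exists (fun=> 0); [exact: sg_cst|exact: dpart_cst].
- move=> j; split=> [|i]; first by move=> x; exact: coord_continuous.
  by exists (fun=> (i == j)%:R); [exact: sg_cst|exact: dpart_coord].
- move=> G tG; split=> [|i]; first exact: Rad_continuous.
  have [G' [tG' D]] := testR_d1 tG.
  eexists; last by apply: dpart_Rad tG D.
  apply: sg_mul; first exact: sg_coord.
  apply: sg_rad; have := testR_exp (-2) tG'.
  by under eq_fun do rewrite mulNr.
- move=> a b _ [ca da] _ [cb db]; split=> [|i]; first exact: continuous_add.
  have [a' sa Da] := da i; have [b' sb Db] := db i.
  by exists (fun x => a' x + b' x); [exact: sg_add|exact: dpartD].
- move=> a b ga [ca da] gb [cb db]; split=> [|i]; first exact: continuous_mul.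
  have [a' sa Da] := da i; have [b' sb Db] := db i.
  exists (fun x => a' x * b x + a x * b' x); last exact: dpartM.
  by apply: sg_add; exact: sg_mul.
Qed.

Lemma smoothD f g : smooth f -> smooth g -> smooth (fun x => f x + g x).
Proof. by move=> ? ?; apply: smooth_gen_smooth; apply: sg_add; exact: sg_base. Qed.

Lemma smoothM f g : smooth f -> smooth g -> smooth (fun x => f x * g x).
Proof. by move=> ? ?; apply: smooth_gen_smooth; apply: sg_mul; exact: sg_base. Qed.

Lemma smooth_Rad G : testR G -> smooth (Rad G).
Proof. by move=> ?; apply: smooth_gen_smooth; exact: sg_rad. Qed.

Lemma smooth_cst c : smooth (fun _ : pt => c).
Proof. by apply: smooth_gen_smooth; exact: sg_cst. Qed.

Lemma smooth_coord j : smooth (fun x : pt => x 0 j).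
Proof. by apply: smooth_gen_smooth; exact: sg_coord. Qed.

Lemma nsq_coord_norm (r : R) x j : 0 <= r -> r <= `|x 0 j| -> r ^+ 2 <= nsq x.
Proof.
move=> r0 h; apply: le_trans (coord_le_nsq x j).
by rewrite -[leRHS]real_normK ?num_real// lerXn2r ?nnegrE.
Qed.

Lemma cc_Rad G f : testR G -> continuous f -> cc (fun x => Rad G x * f x).
Proof.
move=> tG cf; have [_ [k [k0 hk]]] := tG.
apply: (@continuous_cc _ _ _ (expR k)); first exact: expR_gt0.
  by apply: continuous_mul => //; exact: Rad_continuous.
move=> x j /(nsq_coord_norm (expR_ge0 k)) h.
have h2 : expR (2 * k) <= nsq x by rewrite expRM_natl.
by rewrite (Rad_far k0 hk) ?mul0r.
Qed.

Lemma enorm_sqr x : enorm x ^+ 2 = nsq x.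
Proof. by rewrite sqr_sqrtr// nsq_ge0. Qed.

Lemma enorm_ge0 x : 0 <= enorm x.
Proof. exact: sqrtr_ge0. Qed.

Lemma enorm_gt0 x : (0 < enorm x) = (0 < nsq x).
Proof. by rewrite sqrtr_gt0. Qed.

Lemma ln_enorm x : 0 < nsq x -> ln (enorm x) = ln (nsq x) / 2.
Proof. by rewrite -enorm_gt0 => h; rewrite -enorm_sqr lnXn// mulr2n; lra. Qed.

(** Powers of |x| are absorbed into the profile. At the origin both sides are 0, whatever value the
    power takes there. *)
Lemma wt_Rad (a : R) G x : wt a x * Rad G x = Rad (fun t => expR (a * t) * G t) x.
Proof.
rewrite /Rad; case: ifP => q0; last by rewrite mulr0.
by rewrite /wt /powR gt_eqF ?enorm_gt0// ln_enorm.
Qed.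

Lemma RadM G H x : Rad G x * Rad H x = Rad (fun t => G t * H t) x.
Proof. by rewrite /Rad; case: ifP => // _; rewrite mulr0. Qed.

Lemma RadD G H x : Rad G x + Rad H x = Rad (fun t => G t + H t) x.
Proof. by rewrite /Rad; case: ifP => // _; rewrite addr0. Qed.

Lemma RadZ (c : R) G x : c * Rad G x = Rad (fun t => c * G t) x.
Proof. by rewrite /Rad; case: ifP => // _; rewrite mulr0. Qed.

Lemma test_fun_Rad G f : testR G -> smooth f -> test_fun (fun x => Rad G x * f x).
Proof.
move=> tG sf; split; first by apply: smoothM => //; exact: smooth_Rad.
have [_ [k [k0 hk]]] := tG.
exists (expR (- k)), (expR k); split; first exact: expR_gt0.
split; first by rewrite ltr_expR; lra.
move=> x [h|h].
  rewrite (Rad_near k0 hk) ?mul0r//.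
  by rewrite -enorm_sqr -mulrN expRM_natl lerXn2r ?nnegrE ?enorm_ge0 ?expR_ge0// ltW.
have h2 : expR (2 * k) <= nsq x.
  by rewrite -enorm_sqr expRM_natl lerXn2r ?nnegrE ?enorm_ge0 ?expR_ge0// ltW.
by rewrite (Rad_far k0 hk) ?mul0r.
Qed.

End SmoothN.

(** * Homogeneous polynomials and the Fischer decomposition *)

#[local] Opaque smooth partial.

Section Operators.
Variables (R : realType) (N : nat).
Notation pt := 'rV[R]_N.
Implicit Types (f g : pt -> R) (G H : R -> R) (x y : pt).

Lemma smooth_dpart f i : smooth f -> dpart i f (partial i f).
Proof. by move=> /(smooth_partial i)[]. Qed.

Lemma smooth_pd f i : smooth f -> smooth (partial i f).
Proof. by move=> /(smooth_partial i)[]. Qed.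

Lemma smoothZ c f : smooth f -> smooth (fun x => c * f x).
Proof. by move=> sf; exact: (smoothM (smooth_cst c) sf). Qed.

Lemma partialD i f g : smooth f -> smooth g ->
  partial i (fun x => f x + g x) = (fun x => partial i f x + partial i g x).
Proof. by move=> sf sg; apply/dpartE/dpartD; exact: smooth_dpart. Qed.

Lemma partialM i f g : smooth f -> smooth g ->
  partial i (fun x => f x * g x) = (fun x => partial i f x * g x + f x * partial i g x).
Proof. by move=> sf sg; apply/dpartE/dpartM; exact: smooth_dpart. Qed.

Lemma partialZ i c f : smooth f ->
  partial i (fun x => c * f x) = (fun x => c * partial i f x).
Proof. by move=> sf; apply/dpartE/dpartZ; exact: smooth_dpart. Qed.

Lemma partial_cst i c : partial i (fun _ : pt => c) = (fun=> 0).
Proof. exact/dpartE/dpart_cst. Qed.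

Lemma partial_coord i j : partial i (fun x : pt => x 0 j) = (fun=> (i == j)%:R).
Proof. exact/dpartE/dpart_coord. Qed.

Lemma lapD f g : smooth f -> smooth g ->
  laplacian (fun x => f x + g x) = (fun x => laplacian f x + laplacian g x).
Proof.
move=> sf sg; apply/funext => x; rewrite /laplacian -big_split/=; apply: eq_bigr => i _.
by rewrite (partialD i sf sg) (partialD i (smooth_pd i sf) (smooth_pd i sg)).
Qed.

Lemma lapZ c f : smooth f -> laplacian (fun x => c * f x) = (fun x => c * laplacian f x).
Proof.
move=> sf; apply/funext => x; rewrite /laplacian mulr_sumr; apply: eq_bigr => i _.
by rewrite (partialZ i c sf) (partialZ i c (smooth_pd i sf)).
Qed.

Lemma lapM f g : smooth f -> smooth g -> laplacian (fun x => f x * g x) =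
  (fun x => laplacian f x * g x + 2 * (\sum_i partial i f x * partial i g x)
            + f x * laplacian g x).
Proof.
move=> sf sg; apply/funext => x; rewrite /laplacian mulr_suml mulr_sumr mulr_sumr -!big_split/=.
apply: eq_bigr => i _.
have h1 := smooth_pd i sf; have h2 := smooth_pd i sg.
rewrite (partialM i sf sg) (partialD i (smoothM h1 sg) (smoothM sf h2)).
rewrite (partialM i h1 sg) (partialM i sf h2).
move: (partial i (partial i f) x) (partial i (partial i g) x) (partial i f x) (partial i g x).
by move: (f x) (g x) => *; ring.
Qed.

Lemma eulD f g : smooth f -> smooth g ->
  x_dot_grad (fun x => f x + g x) = (fun x => x_dot_grad f x + x_dot_grad g x).
Proof.
move=> sf sg; apply/funext => x; rewrite /x_dot_grad -big_split/=; apply: eq_bigr => i _.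
by rewrite (partialD i sf sg) mulrDr.
Qed.

Lemma eulZ c f : smooth f -> x_dot_grad (fun x => c * f x) = (fun x => c * x_dot_grad f x).
Proof.
move=> sf; apply/funext => x; rewrite /x_dot_grad mulr_sumr; apply: eq_bigr => i _.
by rewrite (partialZ i c sf) mulrCA.
Qed.

Lemma eulM f g : smooth f -> smooth g -> x_dot_grad (fun x => f x * g x) =
  (fun x => x_dot_grad f x * g x + f x * x_dot_grad g x).
Proof.
move=> sf sg; apply/funext => x; rewrite /x_dot_grad mulr_suml mulr_sumr -big_split/=.
by apply: eq_bigr => i _; rewrite (partialM i sf sg); ring.
Qed.

Lemma lap_cst c : laplacian (fun _ : pt => c) = (fun=> 0).
Proof. by apply/funext => x; rewrite /laplacian big1// => i _; rewrite !partial_cst. Qed.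

Lemma eul_cst c : x_dot_grad (fun _ : pt => c) = (fun=> 0).
Proof. by apply/funext => x; rewrite /x_dot_grad big1// => i _; rewrite !partial_cst mulr0. Qed.

Lemma smooth_sum (T : Type) (s : seq T) (F : T -> pt -> R) : (forall k, smooth (F k)) ->
  smooth (fun x => \sum_(k <- s) F k x).
Proof.
move=> h; elim: s => [|a s IH].
  by under eq_fun do rewrite big_nil; exact: smooth_cst.
by under eq_fun do rewrite big_cons; exact: (smoothD (h a) IH).
Qed.

Lemma smooth_eul f : smooth f -> smooth (x_dot_grad f).
Proof.
move=> sf; apply: smooth_sum => i; exact: (smoothM (smooth_coord R i) (smooth_pd i sf)).
Qed.

Lemma smooth_lap f : smooth f -> smooth (laplacian f).
Proof. by move=> sf; apply: smooth_sum => i; exact: (smooth_pd i (smooth_pd i sf)). Qed.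

Inductive homog : nat -> (pt -> R) -> Prop :=
| homog_cst c : homog 0 (fun=> c)
| homog_zero n : homog n (fun=> 0)
| homog_coord n i p of homog n p : homog n.+1 (fun x => x 0 i * p x)
| homog_add n p q of homog n p & homog n q : homog n (fun x => p x + q x).

Lemma homog_smooth n p : homog n p -> smooth p.
Proof.
elim=> [c|k|k i q _ IH|k q r _ IHq _ IHr]; try exact: smooth_cst.
  exact: (smoothM (smooth_coord R i) IH).
exact: (smoothD IHq IHr).
Qed.

Lemma homogZ n p c : homog n p -> homog n (fun x => c * p x).
Proof.
elim=> [d|k|k i q _ IH|k q r _ IHq _ IHr].
- exact: homog_cst.
- by under eq_fun do rewrite mulr0; exact: homog_zero.
- by under eq_fun do rewrite mulrCA; exact: homog_coord.
- by under eq_fun do rewrite mulrDr; exact: homog_add.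
Qed.

Lemma homogM n p m q : homog n p -> homog m q -> homog (n + m) (fun x => p x * q x).
Proof.
move=> + hq; elim=> [d|k|k i p' _ IH|k p' r _ IHq _ IHr].
- exact: homogZ.
- by under eq_fun do rewrite mul0r; exact: homog_zero.
- by under eq_fun do rewrite -mulrA; exact: homog_coord.
- by under eq_fun do rewrite mulrDl; exact: homog_add.
Qed.

Lemma homog_eul n p : homog n p -> x_dot_grad p = (fun x => n%:R * p x).
Proof.
elim=> [c|k|k i q hq IH|k q r hq IHq hr IHr].
- by rewrite eul_cst; apply/funext => x; rewrite mul0r.
- by rewrite eul_cst; apply/funext => x; rewrite mulr0.
- have sq := homog_smooth hq; rewrite (eulM (smooth_coord R i) sq).
  apply/funext => x; rewrite IH /x_dot_grad (bigD1 i)//= big1.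
    by rewrite partial_coord eqxx/= -natr1; ring.
  by move=> j /negbTE ji; rewrite partial_coord ji mulr0.
- rewrite (eulD (homog_smooth hq) (homog_smooth hr)).
  by apply/funext => x; rewrite IHq IHr mulrDr.
Qed.

(** The degree after [d] differentiations. Subtraction of naturals truncates, so the case [n < d]
    must say explicitly that the function is zero. *)
Definition homm (n d : nat) f := if (d <= n)%N then homog (n - d) f else f = (fun=> 0).

Lemma homm_add n d f g : homm n d f -> homm n d g -> homm n d (fun x => f x + g x).
Proof.
rewrite /homm; case: ifP => _; first exact: homog_add.
by move=> -> ->; apply/funext => x; rewrite addr0.
Qed.

Lemma homm_coord n d i f : homm n d f -> homm n.+1 d (fun x => x 0 i * f x).
Proof.
rewrite /homm; case: ifP => dn.
  by rewrite (leq_trans dn)// subSn//; exact: homog_coord.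
move=> ->; have -> : (fun x : pt => x 0 i * 0) = (fun=> 0) by apply/funext => x; rewrite mulr0.
by case: ifP => // _; exact: homog_zero.
Qed.

Lemma homm_zero n d : homm n d (fun=> 0).
Proof. by rewrite /homm; case: ifP => // _; exact: homog_zero. Qed.

Lemma hommZ n d c f : homm n d f -> homm n d (fun x => c * f x).
Proof.
rewrite /homm; case: ifP => _; first exact: homogZ.
by move=> ->; apply/funext => x; rewrite mulr0.
Qed.

Lemma homog_partial n p i : homog n p -> homm n 1 (partial i p).
Proof.
elim=> [c|k|k j q hq IH|k q r hq IHq hr IHr].
- by rewrite partial_cst; exact: homm_zero.
- by rewrite partial_cst; exact: homm_zero.
- rewrite (partialM i (smooth_coord R j) (homog_smooth hq)).
  rewrite partial_coord; apply: homm_add; last exact: homm_coord.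
  by apply: hommZ; rewrite /homm subSS subn0.
- rewrite (partialD i (homog_smooth hq) (homog_smooth hr)).
  exact: homm_add.
Qed.

Lemma lap_coordM i f : smooth f -> laplacian (fun x => x 0 i * f x) =
  (fun x => 2 * partial i f x + x 0 i * laplacian f x).
Proof.
move=> sf; rewrite (lapM (smooth_coord R i) sf).
apply/funext => x; rewrite {1}/laplacian big1 => [|j _]; last first.
  by rewrite partial_coord partial_cst.
rewrite mul0r add0r (bigD1 i)//= partial_coord eqxx mul1r big1 ?addr0// => j /negbTE ji.
by rewrite partial_coord ji mul0r.
Qed.

Lemma homog_lap n p : homog n p -> homm n 2 (laplacian p).
Proof.
elim=> [c|k|k j q hq IH|k q r hq IHq hr IHr].
- by rewrite lap_cst; exact: homm_zero.
- by rewrite lap_cst; exact: homm_zero.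
- rewrite (lap_coordM j (homog_smooth hq)).
  apply: homm_add; last exact: homm_coord.
  by apply: hommZ; have := homog_partial j hq; rewrite /homm ltnS subSS.
- rewrite (lapD (homog_smooth hq) (homog_smooth hr)).
  exact: homm_add.
Qed.

Lemma homog_nsq : homog 2 (@nsq R N).
Proof.
rewrite /nsq; elim: (index_enum _) => [|i s IH].
  by under eq_fun do rewrite big_nil; exact: homog_zero.
under eq_fun do rewrite big_cons.
apply: homog_add => //; have := homog_coord i (homog_coord i (homog_cst 1)).
by under eq_fun do rewrite mulr1 -expr2.
Qed.

Lemma partial_nsq i : partial i (@nsq R N) = (fun x => 2 * x 0 i).
Proof. exact/dpartE/dpart_nsq. Qed.

Lemma lap_nsqM f : smooth f -> laplacian (fun x => nsq x * f x) =
  (fun x => 2 * N%:R * f x + 4 * x_dot_grad f x + nsq x * laplacian f x).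
Proof.
move=> sf; rewrite (lapM (homog_smooth homog_nsq) sf).
apply/funext => x; congr (_ + _ + _).
  congr (_ * _); rewrite /laplacian.
  under eq_bigr => i _.
    rewrite partial_nsq (partialZ i 2 (smooth_coord R i)).
    rewrite partial_coord eqxx mulr1; over.
  by rewrite sumr_const card_ord mulr_natr.
rewrite /x_dot_grad !mulr_sumr; apply: eq_bigr => i _.
by rewrite partial_nsq; ring.
Qed.

Definition harmonic_homog n h := homog n h /\ laplacian h = (fun=> 0).

Lemma harmonicZ n c h : harmonic_homog n h -> harmonic_homog n (fun x => c * h x).
Proof.
move=> [hh lh]; split; first exact: homogZ.
by rewrite (lapZ c (homog_smooth hh)) lh; apply/funext => x; rewrite mulr0.
Qed.

Inductive fischer : nat -> (pt -> R) -> Prop :=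
| fischer_base k j h of harmonic_homog k h : fischer (k + j.*2) (fun x => nsq x ^+ j * h x)
| fischer_add n p q of fischer n p & fischer n q : fischer n (fun x => p x + q x).

Lemma fischerZ n c p : fischer n p -> fischer n (fun x => c * p x).
Proof.
elim=> [k j h hh|k p' q _ IHp _ IHq].
  by under eq_fun do rewrite mulrCA; apply: fischer_base; exact: harmonicZ.
by under eq_fun do rewrite mulrDr; exact: fischer_add.
Qed.

Lemma homog_nsqX j : homog j.*2 (fun x => nsq x ^+ j).
Proof.
elim: j => [|j IH]; first exact: homog_cst.
by under eq_fun do rewrite exprS; exact: (homogM homog_nsq IH).
Qed.

Lemma homog_nsqXM k j h : homog k h -> homog (k + j.*2) (fun x => nsq x ^+ j * h x).
Proof. by move=> hh; rewrite addnC; exact: (homogM (homog_nsqX j) hh). Qed.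

Lemma fischer_hom n p : fischer n p -> homog n p.
Proof.
elim=> [k j h [hh _]|k p' q _ IHp _ IHq]; first exact: homog_nsqXM.
exact: homog_add.
Qed.

(** Induction on [j] through [lap_nsqM], Euler's identity supplying the degree. The Laplacian thus
    acts on Fischer terms as an explicit scalar. *)
Lemma lap_nsqXM k j h : harmonic_homog k h ->
  laplacian (fun x => nsq x ^+ j.+1 * h x) =
  (fun x => 2 * j.+1%:R * (2 * j%:R + N%:R + 2 * k%:R) * (nsq x ^+ j * h x)).
Proof.
move=> [hh lh]; elim: j => [|j IH].
  have -> : (fun x => nsq x ^+ 1 * h x) = (fun x => nsq x * h x) by [].
  rewrite (lap_nsqM (homog_smooth hh)).
  by apply/funext => x; rewrite lh (homog_eul hh) expr0; ring.
have -> : (fun x => nsq x ^+ j.+2 * h x) = (fun x => nsq x * (nsq x ^+ j.+1 * h x)).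
  by apply/funext => x; rewrite exprS mulrA.
have hj := homog_nsqXM j.+1 hh.
rewrite (lap_nsqM (homog_smooth hj)).
apply/funext => x; rewrite IH (homog_eul hj) natrD -muln2 natrM !exprS -!natr1; ring.
Qed.

(** The scalar of [lap_nsqXM] is positive, so each term |x|^(2 j) h is the Laplacian of a multiple
    of |x|^(2 j + 2) h. *)
Lemma fischer_lap_onto n p : (0 < N)%N -> fischer n p ->
  exists2 q, fischer n.+2 q & laplacian q = p.
Proof.
move=> N0; elim=> [k j h hh|k p' q hp [p1 hp1 lp1] hq [q1 hq1 lq1]]; last first.
  exists (fun x => p1 x + q1 x); first exact: fischer_add.
  by rewrite (lapD (homog_smooth (fischer_hom hp1)) (homog_smooth (fischer_hom hq1))) lp1 lq1.
pose c : R := 2 * j.+1%:R * (2 * j%:R + N%:R + 2 * k%:R).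
have c0 : c != 0.
  rewrite gt_eqF// mulr_gt0 ?mulr_gt0 ?ltr0n//.
  have : (0 : R) < N%:R by rewrite ltr0n.
  have := ler0n R j; have := ler0n R k; lra.
exists (fun x => c^-1 * (nsq x ^+ j.+1 * h x)).
  by apply: fischerZ; rewrite -!addnS -doubleS; exact: fischer_base.
rewrite (lapZ _ (homog_smooth (homog_nsqXM j.+1 hh.1))).
by rewrite (lap_nsqXM j hh); apply/funext => x; rewrite -/c mulKf.
Qed.

(** By induction the Laplacian of [p], of degree [n - 2], is decomposed, hence equals the Laplacian
    of some decomposed [q] of degree [n]; the difference [p - q] is harmonic. *)
Lemma fischer_decomposition n p : (0 < N)%N -> homog n p -> fischer n p.
Proof.
move=> N0; elim/ltn_ind: n p => n IH p hp.
have hh h : harmonic_homog n h -> fischer n h.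
  move=> /(fischer_base 0); rewrite addn0.
  by under eq_fun do rewrite expr0 mul1r.
have := homog_lap hp; rewrite /homm; case: ifPn => n2; last first.
  by move=> lp; exact: hh.
have n2' : (n - 2 < n)%N by lia.
move=> /(IH _ n2')/(fischer_lap_onto N0)[q].
have -> : (n - 2).+2 = n by lia.
move=> hq lq.
have -> : p = (fun x => (p x + -1 * q x) + q x) by apply/funext => x; ring.
apply: (fischer_add _ hq); apply: hh; split.
  exact: (homog_add hp (homogZ (-1) (fischer_hom hq))).
have sp := homog_smooth hp; have sq := homog_smooth (fischer_hom hq).
rewrite (lapD sp (smoothZ (-1) sq)) (lapZ (-1) sq) lq.
by apply/funext => x; ring.
Qed.

End Operators.

(** * Spherical components *)

Section Plateau.
Variable R : realType.

(** A cut-off equal to 1 on [-k, k] and to 0 outside (-k - 1, k + 1). *)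
Definition plat (k t : R) : R := step (t + k + 1) * step (k + 1 - t).

Lemma plat1 (k t : R) : - k <= t <= k -> plat k t = 1.
Proof. by move=> /andP[h1 h2]; rewrite /plat !step_ge1 ?mulr1//; lra. Qed.

Lemma smooth1_affine (a b : R) : smooth1 (fun t => a * t + b).
Proof.
apply: sm1_gen_smooth1; apply: sm1_add; last exact: sm1_cst.
by apply: sm1_mul; [exact: sm1_cst|exact: sm1_id].
Qed.

Lemma testR_plat (k : R) : 0 < k -> testR (plat k).
Proof.
move=> k0; split.
  apply: sm1_gen_smooth1.
  have -> : plat k = (fun t => step (1 * t + (k + 1)) * step (-1 * t + (k + 1))).
    by apply/funext => t; rewrite /plat mul1r mulN1r addrA [- t + _]addrC.
  by apply: sm1_mul; apply: (@sm1_comp _ (@step R)); apply: sm1_base;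
    (exact: smooth1_step || exact: smooth1_affine).
exists (k + 1); split; first by lra.
move=> t; rewrite ler_normr => /orP[h|h].
  by rewrite /plat [step (k + 1 - t)]step_le0 ?mulr0//; lra.
by rewrite /plat step_le0 ?mul0r//; lra.
Qed.

End Plateau.

(** * Functions supported in an annulus *)

Section Annular.
Variables (R : realType) (N : nat).
Notation pt := 'rV[R]_N.
Implicit Types (f g v w h : pt -> R) (G H : R -> R) (x y : pt) (k a : R).

(** Support in exp(- k) <= |x| <= exp k, that is ln |x| in [-k, k], squared so that the polynomial
    [nsq] can be used. *)
Definition ann k f :=
  forall x, nsq x < expR (- (2 * k)) \/ expR (2 * k) < nsq x -> f x = 0.

Lemma ann_widen k k' f : k <= k' -> ann k f -> ann k' f.
Proof.
move=> kk hf x [h|h]; apply: hf; [left; apply: lt_le_trans h _|right; apply: le_lt_trans h];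
  rewrite ler_expR; lra.
Qed.

Lemma annD k f g : ann k f -> ann k g -> ann k (fun x => f x + g x).
Proof. by move=> hf hg x hx; rewrite hf// hg// addr0. Qed.

Lemma annMl k f g : ann k f -> ann k (fun x => f x * g x).
Proof. by move=> hf x hx; rewrite hf// mul0r. Qed.

Lemma annMr k f g : ann k f -> ann k (fun x => g x * f x).
Proof. by move=> hf x hx; rewrite hf// mulr0. Qed.

Lemma ann_partial k f i : smooth f -> ann k f -> ann k (partial i f).
Proof.
move=> sf hf x hx; have D := smooth_dpart i sf.
have H : is_derive x (ebasis R i) f 0.
  apply: near_eq_is_derive (is_derive_cst (0:R) _ _).
  case: hx => hx.
    have : \forall y \near x, nsq y < expR (- (2 * k)).
      by apply: (@cvgr_lt _ _ _ _ (@nsq R N) _ (nsq_continuous (x := x))).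
    by apply: filterS => y hy; rewrite hf//; left.
  have : \forall y \near x, expR (2 * k) < nsq y.
    by apply: (@cvgr_gt _ _ _ _ (@nsq R N) _ (nsq_continuous (x := x))).
  by apply: filterS => y hy; rewrite hf//; right.
by case: (D x) => _ <-; case: H.
Qed.

Lemma Rad_plat k x : 0 < k -> expR (- (2 * k)) <= nsq x -> nsq x <= expR (2 * k) ->
  Rad (plat k) x = 1.
Proof.
move=> k0 h1 h2; have q0 : 0 < nsq x by apply: lt_le_trans h1; exact: expR_gt0.
rewrite /Rad q0 plat1//.
have e1 : - (2 * k) <= ln (nsq x) by rewrite -ler_expR lnK.
have e2 : ln (nsq x) <= 2 * k by rewrite -ler_expR lnK.
by apply/andP; split; lra.
Qed.

Lemma ann_plat k f x : 0 < k -> ann k f -> Rad (plat k) x * f x = f x.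
Proof.
move=> k0 hf; have [h1|h1] := ltP (nsq x) (expR (- (2 * k))).
  by rewrite hf ?mulr0//; left.
have [h2|h2] := ltP (expR (2 * k)) (nsq x).
  by rewrite hf ?mulr0//; right.
by rewrite Rad_plat// mul1r.
Qed.

(** On the annulus the weight may be replaced by a smooth compactly supported radial function, which
    gives continuity and integrability of the product. *)
Lemma wt_ann a k f x : 0 < k -> ann k f ->
  wt a x * f x = Rad (fun t => expR (a * t) * plat k t) x * f x.
Proof. by move=> k0 hf; rewrite -{1}(ann_plat x k0 hf) mulrA wt_Rad. Qed.

Lemma cc_wt a k f : 0 < k -> ann k f -> continuous f -> cc (fun x => wt a x * f x).
Proof.
move=> k0 hf cf; under eq_fun do rewrite (wt_ann _ _ k0 hf).
by apply: cc_Rad => //; apply: testR_exp; exact: testR_plat.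
Qed.

Lemma cc_ann k f : 0 < k -> ann k f -> continuous f -> cc f.
Proof.
move=> k0 hf cf; have -> : f = (fun x => Rad (plat k) x * f x).
  by apply/funext => x; rewrite ann_plat.
by apply: cc_Rad => //; exact: testR_plat.
Qed.

Lemma cc0 : cc (fun _ : pt => 0).
Proof. by apply: (@cc_ann 1) => // x; exact: cst_continuous. Qed.

Lemma intN_sum (T : Type) (s : seq T) (F : T -> pt -> R) : (forall j, cc (F j)) ->
  cc (fun x => \sum_(j <- s) F j x) /\
  intN (fun x => \sum_(j <- s) F j x) = \sum_(j <- s) intN (F j).
Proof.
move=> h; elim: s => [|j s [IH1 IH2]].
  have -> : (fun x => \sum_(j <- [::]) F j x) = (fun _ : pt => 0).
    by apply/funext => x; rewrite big_nil.
  rewrite big_nil; split; first exact: cc0.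
  by rewrite -[RHS](mul0r (intN (fun _ : pt => 0))) -intN_Z ?mul0r//; exact: cc0.
have -> : (fun x => \sum_(j <- j :: s) F j x) =
    (fun x => F j x + \sum_(j <- s) F j x).
  by apply/funext => x; rewrite big_cons.
by rewrite big_cons -IH2; split; [exact: ccD|exact: intN_D].
Qed.

Lemma intN_div k (z : 'I_N -> pt -> R) : 0 < k -> (forall i, smooth (z i)) ->
  (forall i, ann k (z i)) -> intN (fun x => \sum_i partial i (z i) x) = 0.
Proof.
move=> k0 sz az.
have cz i : cc (partial i (z i)).
  apply: (cc_ann k0); first exact: (ann_partial i (sz i) (az i)).
  exact: (smooth_continuous (smooth_pd i (sz i))).
have [_ ->] := @intN_sum _ (index_enum _) (fun i => partial i (z i)) cz.
rewrite big1// => i _; apply: (intN_dpart _ _ (smooth_dpart i (sz i))) => //.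
exact: (cc_ann k0 (az i) (smooth_continuous (sz i))).
Qed.

Lemma nsq_Rad G x : nsq x * Rad G x = Rad (fun t => expR (2 * t) * G t) x.
Proof.
rewrite /Rad; case: ifP => q0; last by rewrite mulr0.
have -> : 2 * (ln (nsq x) / 2) = ln (nsq x) by lra.
by rewrite lnK.
Qed.

Lemma expN2K (t : R) : expR (2 * t) * expR (- (2 * t)) = 1.
Proof. by rewrite -expRD subrr expR0. Qed.

Lemma partial_Rad i G G' : testR G -> d1 G G' -> partial (N := N) i (Rad G) =
  (fun x => x 0 i * Rad (fun t => expR (- (2 * t)) * G' t) x).
Proof. by move=> tG D; apply/dpartE; exact: dpart_Rad. Qed.

Lemma sum_sqr x (r : R) : \sum_i x 0 i * (x 0 i * r) = nsq x * r.
Proof. by rewrite /nsq mulr_suml; apply: eq_bigr => i _; rewrite mulrA expr2. Qed.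

Lemma eul_Rad G G' : testR G -> d1 G G' -> x_dot_grad (N := N) (Rad G) = Rad G'.
Proof.
move=> tG D; apply/funext => x; rewrite /x_dot_grad.
under eq_bigr do rewrite (partial_Rad _ tG D).
by rewrite sum_sqr nsq_Rad; congr Rad; apply/funext => t; rewrite mulrA expN2K mul1r.
Qed.

Lemma d1_exp (a : R) : d1 (fun t : R => expR (a * t)) (fun t => a * expR (a * t)).
Proof.
move=> t; have := @is_derive1_comp R expR (fun s => a * s + 0) t _ _
  (is_derive_expR _) (is_derive_affine a 0 t).
by rewrite /comp addr0 mulrC; under eq_fun do rewrite addr0.
Qed.

(** In the variable t = ln |x|, the radial part of |x|^2 Delta is the constant coefficient operator
    d^2/dt^2 + (N - 2) d/dt. *)
Lemma lap_Rad G G' G'' x : testR G -> testR G' -> d1 G G' -> d1 G' G'' ->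
  nsq x * laplacian (Rad G) x = Rad (fun t => G'' t + (N%:R - 2) * G' t) x.
Proof.
move=> tG tG' D D'.
pose G1 (t : R) := expR (- (2 * t)) * G' t.
have tG1 : testR G1.
  have := testR_exp (-2) tG'; congr testR; apply/funext => t; by rewrite mulNr.
have D1 : d1 G1 (fun t => -2 * expR (-2 * t) * G' t + expR (-2 * t) * G'' t).
  have := d1M (d1_exp (-2)) D'; apply: d1_ext => t //.
  by rewrite /G1 mulNr.
have -> : laplacian (Rad G) x = N%:R * Rad G1 x + nsq x *
    Rad (fun t => expR (- (2 * t)) * (-2 * expR (-2 * t) * G' t + expR (-2 * t) * G'' t)) x.
  rewrite /laplacian.
  under eq_bigr => i _.
    rewrite (partial_Rad i tG D) (partialM i (smooth_coord R i) (smooth_Rad tG1)).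
    rewrite partial_coord eqxx mul1r (partial_Rad i tG1 D1); over.
  rewrite big_split/= sum_sqr; congr (_ + _).
  by rewrite sumr_const card_ord mulr_natl.
rewrite mulrDr mulrCA !nsq_Rad RadZ RadD; congr Rad; apply/funext => t.
rewrite /G1.
have e2 : expR (-2 * t) = expR (- (2 * t)) by rewrite mulNr.
rewrite e2; have := expN2K t; move: (expR (2 * t)) (expR (- (2 * t))) => A B AB.
transitivity ((A * B) * N%:R * G' t + (A * B) * (A * B) * (G'' t - 2 * G' t)); first by ring.
by rewrite AB; ring.
Qed.

End Annular.

(** * Components of fixed degree *)

Section Spherical.
Variables (R : realType) (N : nat).
Notation pt := 'rV[R]_N.
Implicit Types (f g v w h : pt -> R) (G H : R -> R) (x y : pt) (k a : R).

Lemma eul_ann k f : smooth f -> ann k f -> ann k (x_dot_grad f).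
Proof.
move=> sf hf x hx; rewrite /x_dot_grad big1// => i _.
by rewrite (ann_partial i sf hf hx) mulr0.
Qed.

Lemma lap_ann k f : smooth f -> ann k f -> ann k (laplacian f).
Proof.
move=> sf hf x hx; rewrite /laplacian big1// => i _.
by rewrite (ann_partial i (smooth_pd i sf) (ann_partial i sf hf) hx).
Qed.

(** The field x f has divergence N f + x . grad f, whose integral is zero. *)
Lemma intN_eul_ann k f : 0 < k -> smooth f -> ann k f ->
  intN (x_dot_grad f) = - N%:R * intN f.
Proof.
move=> k0 sf hf.
have cf := cc_ann k0 hf (smooth_continuous sf).
have ce := cc_ann k0 (eul_ann sf hf) (smooth_continuous (smooth_eul sf)).
have := @intN_div R N k (fun i x => x 0 i * f x) k0
  (fun i => smoothM (smooth_coord R i) sf) (fun i => annMr _ hf).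
have -> : (fun x => \sum_i partial i (fun x0 : pt => x0 0 i * f x0) x) =
    (fun x => N%:R * f x + x_dot_grad f x).
  apply/funext => x; rewrite /x_dot_grad.
  under eq_bigr => i _.
    rewrite (partialM i (smooth_coord R i) sf) partial_coord eqxx mul1r; over.
  by rewrite big_split/= sumr_const card_ord mulr_natl.
rewrite intN_D//; last exact: ccZ.
by rewrite intN_Z// => E; rewrite mulNr; apply/eqP; rewrite -addr_eq0 addrC E.
Qed.

Lemma intN_eul_wt a k f : 0 < k -> smooth f -> ann k f ->
  intN (fun x => wt a x * x_dot_grad f x) = - (N%:R + a) * intN (fun x => wt a x * f x).
Proof.
move=> k0 sf hf.
have [ph [tph Dph]] := testR_d1 (testR_plat k0).
have tpl := testR_plat k0.
have sF : smooth (fun x => Rad (fun t => expR (a * t) * plat k t) x * f x).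
  exact: (smoothM (smooth_Rad (testR_exp a tpl)) sf).
have hF : ann k (fun x => Rad (fun t => expR (a * t) * plat k t) x * f x) by exact: annMr.
(* Differentiating the identity [Rad (plat k) x * f x = f x] shows that the derivative of the
   plateau annihilates [f]; only the power contributes to the radial derivative of the weight. *)
have Rph x : Rad ph x * f x = 0.
  have := congr1 (fun F => x_dot_grad F x)
    (funext (fun x => ann_plat x k0 hf) : (fun x => Rad (plat k) x * f x) = f).
  rewrite (eulM (smooth_Rad tpl) sf) (eul_Rad N tpl Dph).
  by rewrite (ann_plat _ k0 (eul_ann sf hf)) => /(canRL (addrK _)); rewrite subrr.
have := intN_eul_ann k0 sF hF.
have -> : (fun x => Rad (fun t => expR (a * t) * plat k t) x * f x) =
    (fun x => wt a x * f x).
  by apply/funext => x; rewrite -(wt_ann _ _ k0 hf).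
have -> : x_dot_grad (fun x => wt a x * f x) =
    (fun x => a * (wt a x * f x) + wt a x * x_dot_grad f x).
  have -> : (fun x => wt a x * f x) =
      (fun x => Rad (fun t => expR (a * t) * plat k t) x * f x).
    by apply/funext => x; rewrite -(wt_ann _ _ k0 hf).
  rewrite (eulM (smooth_Rad (testR_exp a tpl)) sf).
  rewrite (eul_Rad N (testR_exp a tpl) (d1M (d1_exp a) Dph)).
  apply/funext => x; rewrite -(wt_ann _ _ k0 (eul_ann sf hf)); congr (_ + _).
  rewrite -RadD mulrDl -(wt_Rad a ph) -(mulrA (wt a x) (Rad ph x)) Rph mulr0 addr0.
  rewrite (wt_ann a x k0 hf) mulrA RadZ; congr (Rad _ _ * _); by apply/funext => t; rewrite mulrA.
have c1 := cc_wt a k0 hf (smooth_continuous sf).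
have c2 := cc_wt a k0 (eul_ann sf hf) (smooth_continuous (smooth_eul sf)).
rewrite (intN_D (ccZ a c1) c2) intN_Z// => E.
by move: E => /(canRL (addKr _)) ->; ring.
Qed.

Lemma ann_Rad G : testR G -> exists2 k, 0 < k & ann k (Rad (N := N) G).
Proof.
move=> [_ [k [k0 hk]]]; exists k => // x [h|h].
  by rewrite (Rad_near k0 hk)// ltW.
by rewrite (Rad_far k0 hk)// ltW.
Qed.

Lemma sum4 (p q r s : R) (a b c d : 'I_N -> R) :
  \sum_i (p * a i - q * b i + r * c i - s * d i) =
  p * \sum_i a i - q * \sum_i b i + r * \sum_i c i - s * \sum_i d i.
Proof. by rewrite !mulr_sumr -!sumrN -!big_split. Qed.

(* The fields [|x|^2 K (g grad h - h grad g)] and [K h g x] have divergences of integral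
   zero; since [h] and [g] are harmonic, these are two linear relations between the
   integrals of [K h g] and [K' h g], independent when [n != m]. *)
Lemma intN_harmonic_orth K n m h g : (2 <= N)%N -> testR K -> harmonic_homog n h -> harmonic_homog m g ->
  n != m -> intN (fun x => Rad K x * (h x * g x)) = 0.
Proof.
move=> N2 tK [hh lh] [hg lg] nm.
have [k k0 ak] := ann_Rad tK.
have [K' [tK' DK]] := testR_d1 tK.
have sh := homog_smooth hh; have sg := homog_smooth hg.
have shg := smoothM sh sg.
have sKhg := smoothM (smooth_Rad (N := N) tK) shg.
have aKhg : ann k (fun x => Rad K x * (h x * g x)) by exact: annMl.
have cKhg := cc_ann k0 aKhg (smooth_continuous sKhg).
have cK'hg := cc_Rad tK' (smooth_continuous shg).
have E1 : intN (fun x => Rad K' x * (h x * g x)) =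
    - (N%:R + n%:R + m%:R) * intN (fun x => Rad K x * (h x * g x)).
  have := intN_eul_ann k0 sKhg aKhg.
  rewrite (eulM (smooth_Rad tK) shg) (eul_Rad N tK DK) (eulM sh sg) (homog_eul hh) (homog_eul hg).
  have -> : (fun x => Rad K' x * (h x * g x) + Rad K x * (n%:R * h x * g x + h x * (m%:R * g x)))
     = (fun x => Rad K' x * (h x * g x) + (n%:R + m%:R) * (Rad K x * (h x * g x))).
    by apply/funext => x; ring.
  rewrite (intN_D cK'hg (ccZ _ cKhg)) intN_Z// => /(canRL (addrK _)) ->; ring.
pose K2 (t : R) := expR (2 * t) * K t.
have tK2 : testR K2 by exact: testR_exp.
have DK2 := d1M (d1_exp 2) DK.
have aK2 : ann k (Rad (N := N) K2).
  by move=> x hx; rewrite -nsq_Rad ak// mulr0.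
pose z i x := Rad K2 x * (g x * partial i h x + (-1) * (h x * partial i g x)).
have s1 i := smoothM sg (smooth_pd i sh).
have s2 i := smoothM sh (smooth_pd i sg).
have s3 i := smoothD (s1 i) (smoothZ (-1) (s2 i)).
have := intN_div k0 (fun i => smoothM (smooth_Rad tK2) (s3 i)) (fun i => annMl _ aK2).
have -> : (fun x => \sum_i partial i (fun x0 => Rad K2 x0 *
      (g x0 * partial i h x0 + -1 * (h x0 * partial i g x0))) x) =
    (fun x => (2 * (n%:R - m%:R)) * (Rad K x * (h x * g x)) +
       (n%:R - m%:R) * (Rad K' x * (h x * g x))).
  apply/funext => x.
  pose Z := Rad (fun t => 2 * K t + K' t) x.
  have hZ : forall i : 'I_N, partial i (Rad K2) x = x 0 i * Z.
    move=> i; rewrite (partial_Rad i tK2 DK2) /Z; congr (_ * Rad _ _); apply/funext => t.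
    have := expN2K t; move: (expR (2 * t)) (expR (- (2 * t))) => A B AB.
    by transitivity ((A * B) * (2 * K t + K' t)); [ring|rewrite AB mul1r].
  have Ei i : partial i (fun x0 => Rad K2 x0 *
      (g x0 * partial i h x0 + -1 * (h x0 * partial i g x0))) x =
      Z * g x * (x 0 i * partial i h x) - Z * h x * (x 0 i * partial i g x) +
      Rad K2 x * g x * partial i (partial i h) x - Rad K2 x * h x * partial i (partial i g) x.
    rewrite (partialM i (smooth_Rad tK2) (s3 i)) (partialD i (s1 i) (smoothZ (-1) (s2 i))).
    rewrite (partialZ i (-1) (s2 i)) (partialM i sg (smooth_pd i sh)).
    rewrite (partialM i sh (smooth_pd i sg)) hZ.
    move: (partial i (partial i h) x) (partial i (partial i g) x) (partial i h x) (partial i g x).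
    by clearbody Z; clear hZ; move: (Rad K2 x) (g x) (h x) (x 0 i) Z => *; ring.
  under eq_bigr do rewrite Ei.
  transitivity (Z * g x * x_dot_grad h x - Z * h x * x_dot_grad g x +
      Rad K2 x * g x * laplacian h x - Rad K2 x * h x * laplacian g x).
    exact: (sum4 _ _ _ _ (fun i => x 0 i * partial i h x) (fun i => x 0 i * partial i g x)
      (fun i => partial i (partial i h) x) (fun i => partial i (partial i g) x)).
  rewrite lh lg (homog_eul hh) (homog_eul hg).
  rewrite /Z -RadD -RadZ; ring.
rewrite (intN_D (ccZ _ cKhg) (ccZ _ cK'hg)) !intN_Z// E1 => E.
have : (n%:R - m%:R) * (2 - N%:R - n%:R - m%:R) * intN (fun x => Rad K x * (h x * g x)) = 0.
  by rewrite -[RHS]E; ring.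
move/eqP; rewrite !mulf_eq0 subr_eq0 eqr_nat (negbTE nm)/= => /orP[|/eqP//].
rewrite lt_eqF//.
have : (2 : R) <= N%:R by rewrite ler_nat.
have : (1 : R) <= n%:R + m%:R by rewrite -natrD ler1n; lia.
lra.
Qed.

(** Sums are allowed because harmonic polynomials of one degree need not be proportional, and
    different homogeneous polynomials may contribute to the same [n]. *)
Inductive sph (n : nat) : (pt -> R) -> Prop :=
| sph_base G h of testR G & harmonic_homog n h : sph n (fun x => Rad G x * h x)
| sph_add v w of sph n v & sph n w : sph n (fun x => v x + w x).

Lemma sph_smooth n v : sph n v -> smooth v.
Proof.
elim=> [G h tG [hh _]|v1 v2 _ h1 _ h2]; last exact: (smoothD h1 h2).
exact: (smoothM (smooth_Rad tG) (homog_smooth hh)).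
Qed.

Lemma sph_ann n v : sph n v -> exists2 k, 0 < k & ann k v.
Proof.
elim=> [G h tG _|v1 v2 _ [k1 k10 h1] _ [k2 k20 h2]].
  by have [k k0 ak] := ann_Rad tG; exists k => //; exact: annMl.
exists (Num.max k1 k2); first by rewrite lt_max k10.
by apply: annD; [apply: ann_widen h1|apply: ann_widen h2]; rewrite le_max lexx ?orbT.
Qed.

Lemma sphZ n c v : sph n v -> sph n (fun x => c * v x).
Proof.
elim=> [G h tG hh|v1 v2 _ h1 _ h2].
  by under eq_fun do rewrite mulrCA; exact: (sph_base tG (harmonicZ c hh)).
by under eq_fun do rewrite mulrDr; exact: sph_add.
Qed.

Lemma harmonic0 n : harmonic_homog n (fun _ : pt => 0).
Proof. by split; [exact: homog_zero|exact: lap_cst]. Qed.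

Lemma sph0 n : sph n (fun=> 0).
Proof.
have tG := testR_plat (ltr01 (R := R)).
have := sph_base tG (harmonic0 n).
by under eq_fun do rewrite mulr0.
Qed.

Lemma eul_RadM G G' n h : testR G -> d1 G G' -> harmonic_homog n h ->
  x_dot_grad (fun x => Rad G x * h x) = (fun x => Rad (fun t => G' t + n%:R * G t) x * h x).
Proof.
move=> tG D [hh _]; rewrite (eulM (smooth_Rad tG) (homog_smooth hh)) (eul_Rad N tG D) (homog_eul hh).
by apply/funext => x; rewrite -RadD -RadZ; ring.
Qed.

Lemma testRZ c G : testR G -> testR (fun t => c * G t).
Proof. by apply: testRM; apply: sm1_gen_smooth1; exact: sm1_cst. Qed.

Lemma sph_eul n v : sph n v -> sph n (x_dot_grad v).
Proof.
elim=> [G h tG hh|v1 v2 hv1 h1 hv2 h2].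
  have [G' [tG' D]] := testR_d1 tG; rewrite (eul_RadM tG D hh).
  by apply: sph_base => //; apply: testRD => //; exact: testRZ.
by rewrite (eulD (sph_smooth hv1) (sph_smooth hv2)); exact: sph_add.
Qed.

(** With E = x . grad this is |x|^2 Delta = E^2 + (N - 2) E + Delta_S, where Delta_S has become a
    scalar: Delta h = 0 and E h = n h force E (E + N - 2) h = lambda_n h. *)
Lemma sph_lap n v : sph n v -> forall x,
  nsq x * laplacian v x =
  x_dot_grad (x_dot_grad v) x + (N%:R - 2) * x_dot_grad v x - lambda R N n * v x.
Proof.
elim=> [G h tG hh|v1 v2 hv1 h1 hv2 h2] x.
  have [G' [tG' D]] := testR_d1 tG; have [G'' [tG'' D']] := testR_d1 tG'.
  have [homog_h lh] := hh; have sh := homog_smooth homog_h.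
  rewrite (eul_RadM tG D hh).
  have tG1 : testR (fun t => G' t + n%:R * G t) by apply: testRD => //; exact: testRZ.
  have D1 := d1D D' (d1M (d1_cst n%:R) D).
  rewrite (eul_RadM tG1 D1 hh) (lapM (smooth_Rad tG) sh) lh.
  have -> : \sum_i partial i (Rad G) x * partial i h x =
      Rad (fun t => expR (- (2 * t)) * G' t) x * (n%:R * h x).
    rewrite -[n%:R * h x](congr1 (fun F => F x) (homog_eul homog_h)) /x_dot_grad mulr_sumr.
    by apply: eq_bigr => i _; rewrite (partial_Rad i tG D) mulrCA -mulrA.
  have hR : nsq x * Rad (fun t => expR (- (2 * t)) * G' t) x = Rad G' x.
    by rewrite nsq_Rad; congr (Rad _ _); apply/funext => t; rewrite mulrA expN2K mul1r.
  have hL := lap_Rad x tG tG' D D'.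
  transitivity (nsq x * laplacian (Rad G) x * h x + 2 * n%:R *
      (nsq x * Rad (fun t => expR (- (2 * t)) * G' t) x) * h x); first by ring.
  by rewrite hL hR /lambda -!RadD -!RadZ -!RadD -!RadZ; ring.
rewrite (lapD (sph_smooth hv1) (sph_smooth hv2)) mulrDr (h1 x) (h2 x).
have s1 := sph_smooth hv1; have s2 := sph_smooth hv2.
rewrite (eulD s1 s2) (eulD (smooth_eul s1) (smooth_eul s2)).
by move: (x_dot_grad (x_dot_grad v1) x) (x_dot_grad (x_dot_grad v2) x)
  (x_dot_grad v1 x) (x_dot_grad v2 x) (v1 x) (v2 x) => *; ring.
Qed.

End Spherical.

(** * The inequality on finite sums of components *)

Section LowerBound.
Variables (R : realType) (N : nat).
Hypothesis N2 : (2 <= N)%N.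
Variable be : R.
Notation pt := 'rV[R]_N.
Implicit Types (f g v w h : pt -> R) (x y : pt) (k a c : R).

(** The domain on which [ip] is bilinear; smoothness is not part of it. *)
Definition ac f := continuous f /\ exists2 k, 0 < k & ann k f.

Lemma ac_sph n v : sph n v -> ac v.
Proof. by move=> hv; split; [exact: (smooth_continuous (sph_smooth hv))|exact: sph_ann hv]. Qed.

Lemma acD f g : ac f -> ac g -> ac (fun x => f x + g x).
Proof.
move=> [cf [k k0 hf]] [cg [l l0 hg]]; split; first exact: continuous_add.
exists (Num.max k l); first by rewrite lt_max k0.
by apply: annD; [apply: ann_widen hf|apply: ann_widen hg]; rewrite le_max lexx ?orbT.
Qed.

Lemma acZ c f : ac f -> ac (fun x => c * f x).
Proof.
move=> [cf [k k0 hf]]; split; last by exists k => //; exact: annMr.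
by apply: continuous_mul => //; move=> x; exact: cst_continuous.
Qed.

Lemma ac0 : ac (fun=> 0).
Proof. by split; [move=> x; exact: cst_continuous|exists 1]. Qed.

Definition ip f g : R := intN (fun x => wt be x * (f x * g x)).

Lemma cc_ip f g : ac f -> ac g -> cc (fun x => wt be x * (f x * g x)).
Proof.
move=> [cf [k k0 hf]] [cg _]; apply: (cc_wt be k0); first exact: annMl.
exact: continuous_mul.
Qed.

Lemma ipC f g : ip f g = ip g f.
Proof. by rewrite /ip; congr intN; apply/funext => x; rewrite [f x * _]mulrC. Qed.

Lemma ipDl f g h : ac f -> ac g -> ac h -> ip (fun x => f x + g x) h = ip f h + ip g h.
Proof.
move=> af ag ah; rewrite /ip -(intN_D (cc_ip af ah) (cc_ip ag ah)); congr intN.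
by apply/funext => x; ring.
Qed.

Lemma ipZl c f h : ac f -> ac h -> ip (fun x => c * f x) h = c * ip f h.
Proof.
move=> af ah; rewrite /ip -(intN_Z _ (cc_ip af ah)); congr intN.
by apply/funext => x; ring.
Qed.

Lemma ipDr f g h : ac f -> ac g -> ac h -> ip h (fun x => f x + g x) = ip h f + ip h g.
Proof. by move=> af ag ah; rewrite ipC ipDl// !(ipC h). Qed.

Lemma ipZr c f h : ac f -> ac h -> ip h (fun x => c * f x) = c * ip h f.
Proof. by move=> af ah; rewrite ipC ipZl// (ipC h). Qed.

Lemma wt_ge0 x : 0 <= wt be x.
Proof. exact: powR_ge0. Qed.

Lemma ip_ge0 f : ac f -> 0 <= ip f f.
Proof.
move=> af; have c := cc_ip af af.
have -> : 0 = intN (fun x => 0 * (wt be x * (f x * f x))) by rewrite intN_Z// mul0r.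
apply: intN_le => [||x]; [exact: ccZ|by []|].
by rewrite mul0r mulr_ge0// ?wt_ge0// -expr2 sqr_ge0.
Qed.

(** By bilinearity both arguments are single terms; the weight and the two profiles then merge into
    one radial function. *)
Lemma ip_orth n m v w : sph n v -> sph m w -> n != m -> ip v w = 0.
Proof.
move=> hv hw nm; elim: hv => [G h tG hh|v1 v2 h1 e1 h2 e2]; last first.
  by rewrite (ipDl (ac_sph h1) (ac_sph h2) (ac_sph hw)) e1 e2 addr0.
have hb := sph_base tG hh.
elim: hw => [H g tH hg|w1 w2 h1 e1 h2 e2]; last first.
  by rewrite (ipDr (ac_sph h1) (ac_sph h2) (ac_sph hb)) e1 e2 addr0.
rewrite -(intN_harmonic_orth N2 (testRM tG.1 (testR_exp be tH)) hh hg nm) /ip; congr intN.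
apply/funext => x; rewrite -RadM -wt_Rad; ring.
Qed.

Let sg : R := (N%:R + be) / 2.

Definition eulD_op v : pt -> R := fun x => x_dot_grad v x + sg * v x.

Lemma sph_eulD n v : sph n v -> sph n (eulD_op v).
Proof. by move=> hv; apply: sph_add; [exact: sph_eul|exact: sphZ]. Qed.

(** [intN_eul_wt] for the product [v w] leaves the defect [N + be], shared equally between the two
    sides by [sg]. *)
Lemma ip_eulD n v m w : sph n v -> sph m w -> ip (eulD_op v) w = - ip v (eulD_op w).
Proof.
move=> hv hw.
have sv := sph_smooth hv; have sw := sph_smooth hw.
have av := ac_sph hv; have aw := ac_sph hw.
have aEv := ac_sph (sph_eul hv); have aEw := ac_sph (sph_eul hw).
rewrite /eulD_op (ipDl aEv (acZ _ av) aw) (ipDr aEw (acZ _ aw) av).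
rewrite (ipZl _ av aw) (ipZr _ aw av).
have [k k0 hk] := sph_ann hv.
have := intN_eul_wt be k0 (smoothM sv sw) (annMl _ hk).
rewrite (eulM sv sw) -/(ip v w).
have -> : intN (fun x => wt be x * (x_dot_grad v x * w x + v x * x_dot_grad w x)) =
    ip (x_dot_grad v) w + ip v (x_dot_grad w).
  rewrite /ip -(intN_D (cc_ip aEv aw) (cc_ip av aEw)); congr intN.
  by apply/funext => x; ring.
rewrite /sg; lra.
Qed.

Section Degree.
Variables (n : nat) (v : pt -> R) (B mu : R).
Hypothesis hv : sph n v.

Let p := eulD_op (eulD_op v).
Let q := eulD_op v.
Let hq : sph n q := sph_eulD hv.
Let hp : sph n p := sph_eulD hq.

Lemma ip_pq : ip p q = 0.
Proof. have := ip_eulD hq hq; rewrite -/p [ip q p]ipC; lra. Qed.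

Lemma ip_qv : ip q v = 0.
Proof. have := ip_eulD hv hv; rewrite -/q [ip v q]ipC; lra. Qed.

Lemma ip_pv : ip p v = - ip q q.
Proof. by have := ip_eulD hq hv. Qed.

(** Antisymmetry kills the cross terms <p, q> and <q, v> and turns <p, v> into minus the square norm
    of [q]. It serves twice: for the operator itself, and with [s = 0] for an auxiliary square. *)
Lemma ip_square (s t : R) :
  ip (fun x => p x + (s * q x + t * v x)) (fun x => p x + (s * q x + t * v x)) =
  ip p p + (s ^+ 2 - 2 * t) * ip q q + t ^+ 2 * ip v v.
Proof.
have ap := ac_sph hp; have aq := ac_sph hq; have av := ac_sph hv.
have asq := acZ s aq; have atv := acZ t av; have aa := acD asq atv.
have aall := acD ap aa.
have E1 g : ac g -> ip g (fun x => s * q x + t * v x) = s * ip g q + t * ip g v.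
  by move=> ag; rewrite (ipDr asq atv ag) (ipZr s aq ag) (ipZr t av ag).
rewrite (ipDl ap aa aall) (ipDr ap aa ap) (ipDr ap aa aa) (E1 _ ap) (E1 _ aa).
pose F x := s * q x + t * v x.
rewrite -/F (ipC F p) (ipC F q) (ipC F v) (E1 _ ap) (E1 _ aq) (E1 _ av).
rewrite (ipC v q) ip_pq ip_qv ip_pv; ring.
Qed.

(** If [mu + 2 * B ^+ 2] is nonnegative, only the term in [v] is kept. Otherwise the square norm of
    D^2 v - (mu + 2 B^2) v is subtracted: its terms in [p] and [q] cancel exactly those of the
    form. *)
Lemma degree_bound :
  (if 0 <= mu + 2 * B ^+ 2 then mu ^+ 2 else mu ^+ 2 - (mu + 2 * B ^+ 2) ^+ 2) * ip v v <=
  ip (fun x => p x + (2 * B * q x + - mu * v x)) (fun x => p x + (2 * B * q x + - mu * v x)).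
Proof.
have ap := ac_sph hp; have aq := ac_sph hq; have av := ac_sph hv.
have p0 := ip_ge0 ap; have q0 := ip_ge0 aq; have v0 := ip_ge0 av.
rewrite ip_square.
(* the square norm of [D^2 v - (mu + 2 B^2) v] *)
have h3 : 0 <= ip p p + (0 ^+ 2 - 2 * - (mu + 2 * B ^+ 2)) * ip q q +
    (- (mu + 2 * B ^+ 2)) ^+ 2 * ip v v.
  by rewrite -ip_square; apply: ip_ge0; exact: (acD ap (acD (acZ _ aq) (acZ _ av))).
have E : (2 * B) ^+ 2 - 2 * - mu = 2 * (mu + 2 * B ^+ 2) by ring.
rewrite E; case: ifPn => h.
  have := mulr_ge0 h q0; rewrite sqrrN; lra.
move: h3; rewrite !sqrrN; lra.
Qed.

End Degree.
End LowerBound.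

(** * Finite sums of components *)

Section Decomposition.
Variables (R : realType) (N : nat).
Hypothesis N2 : (2 <= N)%N.
Notation pt := 'rV[R]_N.
Implicit Types (f g u w h : pt -> R) (x y : pt).

(* [|x|^2 L] *)
Definition mop (b c : R) u : pt -> R :=
  fun x => nsq x * laplacian u x + (c * x_dot_grad u x + - b * u x).

Lemma mopD b c u w : smooth u -> smooth w ->
  mop b c (fun x => u x + w x) = (fun x => mop b c u x + mop b c w x).
Proof.
move=> su sw; rewrite /mop (lapD su sw) (eulD su sw); apply/funext => x.
by move: (laplacian u x) (laplacian w x) (x_dot_grad u x) (x_dot_grad w x) => *; ring.
Qed.

Lemma mop0 b c : mop b c (fun=> 0) = (fun=> 0).
Proof. by apply/funext => x; rewrite /mop lap_cst eul_cst; ring. Qed.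

Section Spectral.
Variables (alpha b c : R).
Let be : R := 2 * alpha - 4.
Let B : R := 1 - alpha + c / 2.
Let mu (n : nat) : R := b + lambda R N n + gamma2 N alpha c.

(** Substituting E = D - sg in E^2 + (N - 2 + c) E - (lambda_n + b) gives the coefficient N - 2 + c
    - 2 sg = 2 B of D, and gamma2 is sg (N - 2 + c - sg). *)
Lemma mop_sph n (v : pt -> R) : sph n v -> mop b c v =
  (fun x => eulD_op be (eulD_op be v) x + (2 * B * eulD_op be v x + - mu n * v x)).
Proof.
move=> hv; apply/funext => x; rewrite /mop (sph_lap hv x).
have sv := sph_smooth hv; have sE := sph_smooth (sph_eul hv).
rewrite {1}/eulD_op {1}/eulD_op (eulD sE (smoothZ _ sv)) (eulZ _ sv) /eulD_op.
rewrite /mu /gamma2 /B /be.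
by move: (x_dot_grad (x_dot_grad v) x) (x_dot_grad v x) (v x) => *; field.
Qed.

Lemma sph_mop n (v : pt -> R) : sph n v -> sph n (mop b c v).
Proof.
move=> hv; rewrite (mop_sph hv).
have hq := sph_eulD be hv.
exact: (sph_add (sph_eulD be hq) (sph_add (sphZ _ hq) (sphZ _ hv))).
Qed.

(** With A = N / 2 - 1 + c / 2 one has gamma2 = A^2 - B^2, so the quantity tested in [Cn2] is mu + 2
    B^2, and the second branch is the difference of squares - 4 B^2 (mu + B^2). *)
Lemma Cn2E n : Cn2 N alpha b c n =
  if 0 <= mu n + 2 * B ^+ 2 then mu n ^+ 2 else mu n ^+ 2 - (mu n + 2 * B ^+ 2) ^+ 2.
Proof.
rewrite /Cn2.
have -> : b + lambda R N n + (N%:R / 2 - 1 + c / 2) ^+ 2 + (1 - alpha + c / 2) ^+ 2 =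
    mu n + 2 * B ^+ 2 by rewrite /mu /B /gamma2; field.
case: ifP => _; first by rewrite /mu.
by rewrite /mu /B /gamma2; field.
Qed.

Lemma sph_bound n (v : pt -> R) : sph n v ->
  Cn2 N alpha b c n * ip be v v <= ip be (mop b c v) (mop b c v).
Proof.
by move=> hv; rewrite Cn2E (mop_sph hv); exact: (degree_bound be B (mu n) hv).
Qed.

(** Pythagoras. Orthogonality of partial sums to all later degrees is carried along to make the
    induction go through. *)
Lemma ip_sph_sum (w : nat -> pt -> R) d : (forall n, sph n (w n)) ->
  [/\ ac (fun x => \sum_(n < d) w n x),
   (forall m v, (d <= m)%N -> sph m v -> ip be (fun x => \sum_(n < d) w n x) v = 0) &
   ip be (fun x => \sum_(n < d) w n x) (fun x => \sum_(n < d) w n x) =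
   \sum_(n < d) ip be (w n) (w n)].
Proof.
move=> hw; elim: d => [|d [IH1 IH2 IH3]].
  have -> : (fun x => \sum_(n < 0) w n x) = (fun _ : pt => 0).
    by apply/funext => x; rewrite big_ord0.
  have e (v : pt -> R) : ac v -> ip be (fun=> 0) v = 0.
    move=> av; rewrite -[RHS](mul0r (ip be (fun=> 0) v)) -(ipZl be 0 (@ac0 R N) av).
    by congr ip; apply/funext => x; rewrite mul0r.
  split; [exact: ac0| |by rewrite big_ord0 e//; exact: ac0].
  by move=> m v _ hv; apply: e; exact: ac_sph hv.
have -> : (fun x => \sum_(n < d.+1) w n x) = (fun x => \sum_(n < d) w n x + w d x).
  by apply/funext => x; rewrite big_ord_recr.
have awd := ac_sph (hw d).
split; first exact: acD.
  move=> m v dm hv; rewrite (ipDl be IH1 awd (ac_sph hv)) (IH2 m v (ltnW dm) hv) add0r.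
  by apply: (ip_orth N2 be (hw d) hv); rewrite ltn_eqF.
rewrite (ipDl be IH1 awd (acD IH1 awd)) (ipDr be IH1 awd IH1) (ipDr be IH1 awd awd).
rewrite IH3 (ipC be (w d)) (IH2 d _ (leqnn d) (hw d)) big_ord_recr /=.
by rewrite addr0 add0r.
Qed.

(** The family is indexed by all naturals and vanishes from [d] on, so two decompositions can be
    padded to a common length and added degree by degree. *)
Definition dec u := exists (v : nat -> pt -> R) (d : nat), [/\ forall n, sph n (v n),
  forall n, (d <= n)%N -> v n = (fun=> 0) & u = (fun x => \sum_(n < d) v n x)].

(** [mop] preserves degrees, so both sides split by orthogonality and are compared term by term. *)
Lemma dec_bound K u : (forall n, K <= Cn2 N alpha b c n) -> dec u ->
  K * ip be u u <= ip be (mop b c u) (mop b c u).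
Proof.
move=> hK [v [d [hv _ ->]]].
have -> : mop b c (fun x => \sum_(n < d) v n x) = (fun x => \sum_(n < d) mop b c (v n) x).
  elim: d => [|d IH].
    have -> : (fun x => \sum_(n < 0) v n x) = (fun _ : pt => 0).
      by apply/funext => x; rewrite big_ord0.
    by rewrite mop0; apply/funext => x; rewrite big_ord0.
  have -> : (fun x => \sum_(n < d.+1) v n x) = (fun x => \sum_(n < d) v n x + v d x).
    by apply/funext => x; rewrite big_ord_recr.
  rewrite (mopD _ _ (smooth_sum _ (fun n : 'I_d => sph_smooth (hv n))) (sph_smooth (hv d))) IH.
  by apply/funext => x; rewrite big_ord_recr.
have [_ _ ->] := ip_sph_sum d hv.
have [_ _ ->] := ip_sph_sum d (fun n => sph_mop (hv n)).
rewrite mulr_sumr; apply: ler_sum => n _.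
apply: le_trans (sph_bound (hv n)).
by rewrite ler_wpM2r// ip_ge0//; exact: ac_sph (hv n).
Qed.

Lemma dec_add u w : dec u -> dec w -> dec (fun x => u x + w x).
Proof.
move=> [v1 [d1 [h1 z1 ->]]] [v2 [d2 [h2 z2 ->]]].
have widen (v : nat -> pt -> R) d D x : (d <= D)%N -> (forall n, (d <= n)%N -> v n = (fun=> 0)) ->
    \sum_(n < d) v n x = \sum_(n < D) v n x.
  move=> dD z; rewrite -(subnKC dD) big_split_ord /= [X in _ = _ + X]big1 ?addr0// => i _.
  by rewrite z// leq_addr.
exists (fun n x => v1 n x + v2 n x), (maxn d1 d2); split=> [n|n|].
- exact: sph_add.
- by rewrite geq_max => /andP[/z1 -> /z2 ->]; apply/funext => x; rewrite addr0.
- apply/funext => x; rewrite (widen v1 d1 (maxn d1 d2) x (leq_maxl _ _) z1).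
  by rewrite (widen v2 d2 (maxn d1 d2) x (leq_maxr _ _) z2) big_split.
Qed.

Lemma dec_sph n (w : pt -> R) : sph n w -> dec w.
Proof.
move=> hw; exists (fun m => if m == n then w else (fun=> 0)), n.+1; split=> [m|m nm|].
- by case: eqP => [->|_]; [exact: hw|exact: sph0].
- by rewrite gtn_eqF.
- apply/funext => x; rewrite big_ord_recr/= eqxx big1 ?add0r// => i _.
  by rewrite ltn_eqF.
Qed.

Lemma nsqX_Rad j G x : nsq (N := N) x ^+ j * Rad G x =
  Rad (fun t : R => expR (j%:R * 2 * t) * G t) x.
Proof.
elim: j => [|j IH].
  by rewrite mul1r; congr (Rad _ _); apply/funext => t; rewrite !mul0r expR0 mul1r.
rewrite exprS -mulrA IH nsq_Rad; congr (Rad _ _); apply/funext => t.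
by rewrite mulrA -expRD -natr1; congr (expR _ * _); ring.
Qed.

(** The factor |x|^(2 j) is radial and joins the profile: the term belongs to the degree of its
    harmonic factor, not to the degree [n] of the polynomial. *)
Lemma dec_fischer n G p : testR G -> fischer n p -> dec (fun x => Rad G x * p x).
Proof.
move=> tG; elim=> [k j h hh|m p1 p2 _ h1 _ h2]; last first.
  by under eq_fun do rewrite mulrDr; exact: dec_add.
apply: (@dec_sph k).
have -> : (fun x => Rad G x * (nsq x ^+ j * h x)) =
    (fun x => Rad (fun t => expR (j%:R * 2 * t) * G t) x * h x).
  by apply/funext => x; rewrite -nsqX_Rad; ring.
exact: (sph_base (testR_exp _ tG) hh).
Qed.

Inductive polyfun : (pt -> R) -> Prop :=
| pf_hom n p of homog n p : polyfun p
| pf_add p q of polyfun p & polyfun q : polyfun (fun x => p x + q x).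

Lemma dec_polyfun G p : testR G -> polyfun p -> dec (fun x => Rad G x * p x).
Proof.
move=> tG; elim=> [n q hq|p1 p2 _ h1 _ h2]; last first.
  by under eq_fun do rewrite mulrDr; exact: dec_add.
by apply: dec_fischer => //; apply: (fischer_decomposition _ hq); lia.
Qed.

Lemma polyfun_mul p q : polyfun p -> polyfun q -> polyfun (fun x => p x * q x).
Proof.
move=> hp hq; elim: hp => [n p1 h1|p1 p2 _ h1 _ h2]; last first.
  by under eq_fun do rewrite mulrDl; exact: pf_add.
elim: hq => [m q1 h2|q1 q2 _ e1 _ e2]; first exact: (pf_hom (homogM h1 h2)).
by under eq_fun do rewrite mulrDr; exact: pf_add.
Qed.

Lemma polyfun_cst (a : R) : polyfun (fun=> a).
Proof. exact: (pf_hom (homog_cst N a)). Qed.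

Lemma polyfun_horner (p : {poly R}) j : polyfun (fun x => p.[x 0 j]).
Proof.
elim/poly_ind: p => [|p a IH].
  by under eq_fun do rewrite horner0; exact: polyfun_cst.
under eq_fun do rewrite hornerMXaddC.
apply: pf_add; last exact: polyfun_cst.
apply: polyfun_mul => //; have := pf_hom (homog_coord j (homog_cst N (1 : R))).
by under eq_fun do rewrite mulr1.
Qed.

Lemma polyfun_sum (T : Type) (s : seq T) (F : T -> pt -> R) : (forall k, polyfun (F k)) ->
  polyfun (fun x => \sum_(k <- s) F k x).
Proof.
move=> h; elim: s => [|a s IH].
  by under eq_fun do rewrite big_nil; exact: polyfun_cst.
by under eq_fun do rewrite big_cons; exact: pf_add.
Qed.

Lemma polyfun_prod (T : Type) (s : seq T) (F : T -> pt -> R) : (forall k, polyfun (F k)) ->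
  polyfun (fun x => \prod_(k <- s) F k x).
Proof.
move=> h; elim: s => [|a s IH].
  by under eq_fun do rewrite big_nil; exact: polyfun_cst.
by under eq_fun do rewrite big_cons; exact: polyfun_mul.
Qed.

End Spectral.
End Decomposition.

(** * Polynomial approximation *)

Section Schwarz.
Variables (R : realType) (N : nat).
Notation pt := 'rV[R]_N.
Implicit Types (f g u : pt -> R) (x y : pt).

Lemma dpart_shift i f f' (v : pt) : dpart i f f' ->
  dpart i (fun y => f (v + y)) (fun y => f' (v + y)).
Proof.
move=> D y; apply/is_derive_slice.
have /is_derive_slice := D (v + y).
by under eq_fun do rewrite addrCA.
Qed.

Lemma dpartB i f g f' g' : dpart i f f' -> dpart i g g' ->
  dpart i (fun x => f x - g x) (fun x => f' x - g' x).
Proof. by move=> h1 h2 x; have := h1 x; have := h2 x => ? ?; exact: is_deriveB. Qed.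

(** Two applications of the mean value theorem, one to the increment of [u] along [j] and one to its
    derivative along [i]. *)
Lemma second_difference i j u x (h : R) : smooth u -> 0 <= h ->
  exists2 c : R * R, (0 <= c.1 <= h) && (0 <= c.2 <= h) &
  u (h *: ebasis R j + (h *: ebasis R i + x)) - u (h *: ebasis R i + x)
   - (u (h *: ebasis R j + x) - u x) =
  h * (h * partial j (partial i u) (c.2 *: ebasis R j + (c.1 *: ebasis R i + x))).
Proof.
move=> su h0; have D := smooth_dpart i su.
have Dw := dpartB (dpart_shift (h *: ebasis R j) D) D.
have [c hc ->] := mean_value x Dw h0.
have [c' hc' ->] := mean_value (c *: ebasis R i + x) (smooth_dpart j (smooth_pd i su)) h0.
by exists (c, c') => //=; rewrite hc hc'.
Qed.

Lemma dist_half (a b q e : R) : `|a - q| < e / 2 -> `|b - q| < e / 2 -> `|a - b| <= e.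
Proof.
move=> h1 h2; have -> : a - b = (a - q) - (b - q) by ring.
by apply: le_trans (ler_normB _ _) _; lra.
Qed.

(** Needed to reorder the long iterated derivative from which the approximating polynomial is
    built. *)
Lemma partialC i j u : smooth u -> partial i (partial j u) = partial j (partial i u).
Proof.
move=> su; apply/funext => x; apply/eqP; rewrite -subr_eq0 -normr_le0.
apply/ler_addgt0Pl => e e0; rewrite addr0.
have e2 : 0 < e / 2 by lra.
have near_pt g : continuous g -> exists2 d : R, 0 < d & forall (h : R) (c : R * R) (k l : 'I_N),
    0 < h < d -> (0 <= c.1 <= h) && (0 <= c.2 <= h) ->
    `|g x - g (c.2 *: ebasis R k + (c.1 *: ebasis R l + x))| < e / 2.
  move=> /(_ x)/cvgrPdist_lt/(_ _ e2)/nbhs_ballP[d /= d0 hd].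
  exists (d / 2) => [|h c k l /andP[h0 hh] /andP[/andP[a1 a2] /andP[b1 b2]]]; first by lra.
  apply: hd; split=> // i' j'; rewrite (ord1 i') /ball/= !mxE eqxx/=.
  have -> : x 0 j' - (c.2 * (j' == k)%:R + (c.1 * (j' == l)%:R + x 0 j')) =
    - (c.2 * (j' == k)%:R + c.1 * (j' == l)%:R) by ring.
  rewrite normrN ger0_norm; last by rewrite addr_ge0// mulr_ge0.
  have : c.2 * (j' == k)%:R <= c.2 by rewrite ler_piMr// lern1 leq_b1.
  have : c.1 * (j' == l)%:R <= c.1 by rewrite ler_piMr// lern1 leq_b1.
  lra.
have [d1 d10 h1] := near_pt _ (smooth_continuous (smooth_pd i (smooth_pd j su))).
have [d2 d20 h2] := near_pt _ (smooth_continuous (smooth_pd j (smooth_pd i su))).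
pose h := Num.min d1 d2 / 2.
have m0 : 0 < Num.min d1 d2 by rewrite lt_min d10.
have h0 : 0 < h by rewrite /h; lra.
have m1 : Num.min d1 d2 <= d1 by rewrite ge_min lexx.
have m2 : Num.min d1 d2 <= d2 by rewrite ge_min lexx orbT.
have hd1 : h < d1 by rewrite /h; lra.
have hd2 : h < d2 by rewrite /h; lra.
have [c hc E] := second_difference i j x su (ltW h0).
have [c' hc' E'] := second_difference j i x su (ltW h0).
have {}h1 := h1 h c' i j; have {}h2 := h2 h c j i.
have hn : h != 0 by rewrite gt_eqF.
pose P := partial j (partial i u) (c.2 *: ebasis R j + (c.1 *: ebasis R i + x)).
pose Q := partial i (partial j u) (c'.2 *: ebasis R i + (c'.1 *: ebasis R j + x)).
(* Both sides are the same second difference of [u], read in the two orders; continuity then brings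
   [P] and [Q] close to the two mixed derivatives at [x]. *)
have H : h * (h * P) = h * (h * Q).
  rewrite -[LHS]E -[RHS]E'.
  have -> : h *: ebasis R j + (h *: ebasis R i + x) = h *: ebasis R i + (h *: ebasis R j + x).
    by rewrite addrCA.
  by rewrite -!addrA; congr (_ + _); rewrite !opprD !opprK; exact: addrCA.
have {}h1 := h1 _ hc'; have {}h2 := h2 _ hc; rewrite -/Q in h1; rewrite -/P in h2.
rewrite (mulfI hn (mulfI hn H)) in h2.
move: h1 h2; rewrite h0 hd1 hd2 => /(_ isT) h1 /(_ isT) h2.
exact: (dist_half h1 h2).
Qed.

Lemma smooth_iter s u : smooth u -> smooth (iter_partial s u).
Proof. by move=> su; elim: s => [|i s IH]; [exact: su|exact: (smooth_pd i IH)]. Qed.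

Lemma iter_partial_cat s t u : iter_partial (s ++ t) u = iter_partial s (iter_partial t u).
Proof. by elim: s => //= i s ->. Qed.

Lemma iter_partialC s t u : smooth u ->
  iter_partial s (iter_partial t u) = iter_partial t (iter_partial s u).
Proof.
move=> su; elim: s => //= i s ->.
elim: t => //= j t IH; rewrite -IH.
exact: (partialC i j (smooth_iter t (smooth_iter s su))).
Qed.

Lemma iter_partial_perm s t u : smooth u -> perm_eq s t -> iter_partial s u = iter_partial t u.
Proof.
move=> su; apply: (catCA_perm_subst (F := fun s => iter_partial s u)) => s1 s2 s3.
by rewrite !iter_partial_cat (iter_partialC s1 s2 (smooth_iter s3 su)).
Qed.

Lemma cc_bounded f : cc f -> exists2 M : R, 0 <= M & forall x, `|f x| <= M.
Proof.
move=> [rho [r0 fu fv]].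
pose K := [set v : pt | forall i, `[- rho, rho]%classic (v ord0 i)].
have cK : compact K.
  exact: (@rV_compact R N (fun=> `[- rho, rho]%classic) (fun=> @segment_compact _ _ _)).
have K0 : K !=set0 by exists 0 => i; rewrite /= in_itv/= mxE oppr_le0 ltW.
have cf0 : continuous f.
  move=> x; apply: (iffRL (@cvgrPdist_lt _ _ _ (nbhs x) (nbhs_filter x) f (f x))) => e e0.
  have [d [d0 hd]] := fu e e0.
  have hb : nbhs x (ball x d) by exact: nbhsx_ballx.
  apply: (@filterS _ (nbhs x) (nbhs_filter x) _ _ _ hb) => y [_ hy].
  by apply: hd => i; exact: (hy 0 i).
have cf : continuous (fun x => `|f x|).
  move=> x; apply: (@continuous_comp _ _ _ f (fun s : R => `|s|)); first exact: cf0.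
  exact: norm_continuous.
have [c _ hc] := EVT_max_rV K0 cK (continuous_subspaceT cf).
exists `|f c| => // x; have [Kx|nKx] := pselect (K x); first by apply: hc; rewrite inE.
have [j hj] : exists j, rho < `|x 0 j|.
  apply: contrapT => nh; apply: nKx => i; rewrite /= in_itv/= -ler_norml leNgt.
  by apply/negP => hi; apply: nh; exists i.
by rewrite (fv x j) ?normr0// ltW.
Qed.

End Schwarz.

(** * Bernstein polynomials on a cube *)

Section Bernstein.
Variables (R : realType) (N : nat).
Notation pt := 'rV[R]_N.
Variable rho : R.
Hypothesis rho0 : 0 < rho.

Let Y : {poly R} := (2 * rho)^-1 *: ('X + rho%:P).

(* [bern m k] is ['C(m, k) Y^k (1 - Y)^(m - k)]; [Y] maps [[-rho, rho]] onto [[0, 1]]. *)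
Fixpoint bern (m k : nat) : {poly R} :=
  match m with
  | 0 => (k == 0%N)%:R%:P
  | m'.+1 => (1 - Y) * bern m' k + Y * (if k is k'.+1 then bern m' k' else 0)
  end.

Lemma bern_gt m k : (m < k)%N -> bern m k = 0.
Proof.
elim: m k => [|m IH] [|k]//= mk.
by rewrite !IH ?mulr0 ?addr0// ltnW.
Qed.

Lemma YE (t : R) : Y.[t] = (t + rho) / (2 * rho).
Proof. by rewrite /Y hornerZ !hornerE mulrC. Qed.

Lemma bern_ge0 m k (t : R) : - rho <= t <= rho -> 0 <= (bern m k).[t].
Proof.
move=> /andP[t1 t2].
have h1 : 0 <= t + rho by lra.
have h2 : t + rho <= 2 * rho by lra.
have h3 : 0 < 2 * rho by rewrite mulr_gt0.
have y0 : 0 <= Y.[t] by rewrite YE divr_ge0// ltW.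
have y1 : 0 <= 1 - Y.[t] by rewrite YE subr_ge0 ler_pdivrMr// mul1r.
elim: m k => [|m IH] k /=; first by rewrite hornerC.
rewrite !(hornerD, hornerM, hornerN, hornerC) addr_ge0// mulr_ge0//.
by case: k => [|k]; rewrite ?horner0.
Qed.

(** The expectation over [m.+1] Bernoulli trials, conditioned on one of them. *)
Lemma bern_rec m (F : nat -> R) (t : R) :
  \sum_(k < m.+2) (bern m.+1 k).[t] * F k =
  (1 - Y.[t]) * (\sum_(k < m.+1) (bern m k).[t] * F k) +
  Y.[t] * (\sum_(k < m.+1) (bern m k).[t] * F k.+1).
Proof.
under eq_bigr do rewrite /= !(hornerD, hornerM, hornerN, hornerC) mulrDl -!mulrA.
rewrite big_split/= -!mulr_sumr; congr (_ * _ + _ * _).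
  by rewrite big_ord_recr/= bern_gt// horner0 mul0r addr0.
rewrite big_ord_recl/= horner0 mul0r add0r.
by apply: eq_bigr => k _; rewrite /bump.
Qed.

Lemma bern_sum m (t : R) : \sum_(k < m.+1) (bern m k).[t] = 1.
Proof.
elim: m => [|m IH]; first by rewrite big_ord_recl big_ord0/= hornerC addr0.
have := bern_rec m (fun=> 1) t; under eq_bigr do rewrite mulr1.
move=> ->; under eq_bigr do rewrite mulr1.
by rewrite IH; ring.
Qed.

(** The binomial variance: conditioning on one more trial adds the variance [Y (1 - Y)] of a single
    one. *)
Lemma bern_var m (t : R) :
  \sum_(k < m.+1) (bern m k).[t] * (k%:R - m%:R * Y.[t]) ^+ 2 = m%:R * Y.[t] * (1 - Y.[t]).
Proof.
elim: m => [|m IH].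
  by rewrite big_ord_recl big_ord0/= !mul0r subr0 expr0n/= mulr0 addr0.
rewrite (bern_rec m (fun k => (k%:R - m.+1%:R * Y.[t]) ^+ 2)) !mulr_sumr -big_split/=.
under eq_bigr => k _.
  have -> : (1 - Y.[t]) * ((bern m k).[t] * (k%:R - m.+1%:R * Y.[t]) ^+ 2) +
    Y.[t] * ((bern m k).[t] * (k.+1%:R - m.+1%:R * Y.[t]) ^+ 2) =
    (bern m k).[t] * (k%:R - m%:R * Y.[t]) ^+ 2 + Y.[t] * (1 - Y.[t]) * (bern m k).[t].
    by rewrite -!natr1; ring.
  over.
by rewrite big_split/= IH -mulr_sumr bern_sum -natr1; ring.
Qed.

Definition node (m k : nat) : R := 2 * rho * (k%:R / m%:R) - rho.

Lemma bern_node_var m (t : R) : - rho <= t <= rho -> (0 < m)%N ->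
  \sum_(k < m.+1) (bern m k).[t] * (node m k - t) ^+ 2 <= rho ^+ 2 / m%:R.
Proof.
move=> /andP[t1 t2] m0; have mn : m%:R != 0 :> R by rewrite pnatr_eq0 -lt0n.
have -> : \sum_(k < m.+1) (bern m k).[t] * (node m k - t) ^+ 2 =
    (2 * rho / m%:R) ^+ 2 * \sum_(k < m.+1) (bern m k).[t] * (k%:R - m%:R * Y.[t]) ^+ 2.
  rewrite mulr_sumr; apply: eq_bigr => k _; rewrite YE /node.
  by field; rewrite mn gt_eqF.
rewrite bern_var YE.
have -> : (2 * rho / m%:R) ^+ 2 * (m%:R * ((t + rho) / (2 * rho)) * (1 - (t + rho) / (2 * rho)))
    = (rho ^+ 2 - t ^+ 2) / m%:R.
  by field; rewrite mn gt_eqF.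
rewrite ler_pM2r ?invr_gt0 ?ltr0n// gerBl sqr_ge0//.
Qed.

Definition nodeN (m : nat) (K : {ffun 'I_N -> 'I_m.+1}) : pt := \row_j node m (K j).

Definition bernN (m : nat) (K : {ffun 'I_N -> 'I_m.+1}) (x : pt) : R :=
  \prod_j (bern m (K j)).[x 0 j].

Definition cube (x : pt) := forall j, - rho <= x 0 j <= rho.

Lemma bernN_sum m x : \sum_K bernN (m := m) K x = 1.
Proof.
rewrite /bernN -(bigA_distr_bigA (fun j (k : 'I_m.+1) => (bern m k).[x 0 j])).
by rewrite big1// => j _; rewrite bern_sum.
Qed.

Lemma bernN_ge0 m K x : cube x -> 0 <= bernN (m := m) K x.
Proof. by move=> cx; apply: prodr_ge0 => j _; exact: bern_ge0. Qed.

(** The sum over multi-indices factors over the coordinates; every factor other than the one of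
    index [j] is a total mass equal to 1. *)
Lemma bernN_var m j x : cube x -> (0 < m)%N ->
  \sum_K bernN (m := m) K x * (nodeN K 0 j - x 0 j) ^+ 2 <= rho ^+ 2 / m%:R.
Proof.
move=> cx m0.
pose F (i : 'I_N) (k : 'I_m.+1) : R :=
  (bern m k).[x 0 i] * (if i == j then (node m k - x 0 j) ^+ 2 else 1).
have -> : \sum_K bernN (m := m) K x * (nodeN K 0 j - x 0 j) ^+ 2 =
    \sum_(K : {ffun 'I_N -> 'I_m.+1}) \prod_i F i (K i).
  apply: eq_bigr => K _; rewrite /bernN mxE /F big_split/=; congr (_ * _).
  by rewrite (bigD1 j)//= eqxx big1 ?mulr1// => i /negbTE ->.
rewrite -(bigA_distr_bigA F) (bigD1 j)//= [X in _ * X]big1 ?mulr1.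
  by under eq_bigr do rewrite /F eqxx; exact: bern_node_var.
move=> i /negbTE ij.
by under eq_bigr do rewrite /F ij mulr1; exact: bern_sum.
Qed.

(** Chebyshev's argument: uniform continuity handles nodes near [x], and the variance bound makes
    the contribution of distant nodes of order [1 / m]. *)
Lemma bernstein_approx (g : pt -> R) (e : R) : cc g -> 0 < e ->
  exists m, forall x, cube x -> `|\sum_K g (nodeN K) * bernN (m := m) K x - g x| <= e.
Proof.
move=> cg e0; have [M M0 hM] := cc_bounded cg.
have [rho' [_ gu _]] := cg.
have e2 : 0 < e / 2 by lra.
have [d [d0 hd]] := gu _ e2.
have d2 : 0 < d ^+ 2 by apply: exprn_gt0.
(* If some coordinates differ by at least [d], then [C] times the squared distance already exceeds
   the trivial bound [2 * M]. *)
pose C := 2 * M / d ^+ 2.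
have C0 : 0 <= C by rewrite divr_ge0 ?mulr_ge0// ltW.
have close y x : `|g y - g x| <= e / 2 + C * \sum_j (y 0 j - x 0 j) ^+ 2.
  have S0 : 0 <= \sum_j (y 0 j - x 0 j) ^+ 2 by apply: sumr_ge0 => j _; exact: sqr_ge0.
  have [h|/existsNP[j /negP]] := pselect (forall j, `|y 0 j - x 0 j| < d).
    by apply: (@le_trans _ _ (e / 2)); [exact/ltW/hd|rewrite lerDl mulr_ge0].
  rewrite -leNgt => hj.
  apply: (@le_trans _ _ (2 * M)).
    by apply: le_trans (ler_normB _ _) _; have := hM x; have := hM y; lra.
  rewrite ler_wpDl ?(ltW e2)// /C mulrAC ler_pdivlMr// ler_wpM2l ?mulr_ge0//.
  rewrite (bigD1 j)//=; apply: (@le_trans _ _ ((y 0 j - x 0 j) ^+ 2)).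
    by rewrite -[leRHS]real_normK ?num_real// lerXn2r ?nnegrE// ltW.
  by rewrite lerDl; apply: sumr_ge0 => i _; exact: sqr_ge0.
pose T := C * N%:R * rho ^+ 2.
have T0 : 0 <= T by apply: mulr_ge0; [exact: mulr_ge0|exact: sqr_ge0].
pose m := (Num.truncn (T / (e / 2))).+1.
have hm : T / m%:R <= e / 2.
  rewrite ler_pdivrMr ?ltr0n// mulrC -ler_pdivrMr//; apply/ltW.
  by rewrite /m truncnS_gt.
exists m => x cx.
have -> : \sum_K g (nodeN K) * bernN (m := m) K x - g x =
    \sum_K (g (nodeN K) - g x) * bernN (m := m) K x.
  under [RHS]eq_bigr do rewrite mulrBl.
  by rewrite sumrB -mulr_sumr bernN_sum mulr1.
apply: le_trans (ler_norm_sum _ _ _) _.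
apply: (@le_trans _ _ (\sum_K (e / 2 + C * \sum_j (nodeN K 0 j - x 0 j) ^+ 2) * bernN (m := m) K x)).
  apply: ler_sum => K _; rewrite normrM (ger0_norm (bernN_ge0 K cx)).
  by rewrite ler_wpM2r ?bernN_ge0.
under eq_bigr do rewrite mulrDl.
rewrite big_split/= -mulr_sumr bernN_sum mulr1.
suff : \sum_K C * (\sum_j (nodeN K 0 j - x 0 j) ^+ 2) * bernN (m := m) K x <= T / m%:R by lra.
under eq_bigr do rewrite -mulrA mulr_suml.
rewrite -mulr_sumr exchange_big/=.
have -> : T / m%:R = C * (N%:R * (rho ^+ 2 / m%:R)) by rewrite /T !mulrA.
apply: ler_wpM2l => //.
apply: (@le_trans _ _ (\sum_(j < N) rho ^+ 2 / m%:R)).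
  apply: ler_sum => j _; under eq_bigr do rewrite mulrC.
  exact: bernN_var.
by rewrite sumr_const card_ord mulr_natl.
Qed.

End Bernstein.

(** * Integrating polynomial approximations back *)

Section TensorApprox.
Variables (R : realType) (N : nat).
Notation pt := 'rV[R]_N.
Variable rho : R.
Hypothesis rho0 : 0 < rho.
Implicit Types (u v : pt -> R) (x : pt).

(** The antiderivative that vanishes at [- rho]. The coefficient of index 0 before the correction is
    a quotient by zero, hence 0. *)
Definition adp (p : {poly R}) : {poly R} :=
  let P := \poly_(i < (size p).+1) (p`_i.-1 / i%:R) in P - P.[- rho]%:P.

Lemma deriv_adp p : (adp p)^`() = p.
Proof.
apply/polyP => i; rewrite /adp derivB derivC subr0 coef_deriv coef_poly ltnS.
case: ltnP => [_ /=|h]; last by rewrite mul0rn nth_default.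
by rewrite -[LHS]mulr_natr divfK// pnatr_eq0.
Qed.

Lemma adp_root p : (adp p).[- rho] = 0.
Proof. by rewrite /adp hornerD hornerN hornerC subrr. Qed.

Section Tens.
Variables (m : nat).
Notation idx := {ffun 'I_N -> 'I_m.+1}.
Variable cf : idx -> R.

Definition tens (Phi : idx -> 'I_N -> {poly R}) x : R :=
  \sum_K cf K * \prod_j (Phi K j).[x 0 j].

Lemma polyfun_tens Phi : polyfun (tens Phi).
Proof.
apply: polyfun_sum => K; apply: polyfun_mul; first exact: polyfun_cst.
by apply: polyfun_prod => j; exact: polyfun_horner.
Qed.

Lemma dpart_prod i (ps qs : 'I_N -> {poly R}) : (forall j, j != i -> ps j = qs j) ->
  (ps i)^`() = qs i ->
  dpart (R := R) i (fun x => \prod_j (ps j).[x 0 j]) (fun x => \prod_j (qs j).[x 0 j]).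
Proof.
move=> h1 h2 x; apply/is_derive_slice.
pose a := \prod_(j | j != i) (qs j).[x 0 j].
have -> : (fun h : R => \prod_j (ps j).[(h *: ebasis R i + x) 0 j]) =
    (fun h => (ps i).[1 * h + x 0 i] * a).
  apply/funext => h; rewrite (bigD1 i)//=; congr (_.[_] * _); first by rewrite !mxE !eqxx mul1r mulr1.
  apply: eq_bigr => j ji; rewrite (h1 j ji); congr (_.[_]).
  by rewrite !mxE (negbTE ji) andbF mulr0 add0r.
rewrite (bigD1 i)//= -/a -h2.
have i1 : is_derive (0 : R) 1 (fun h : R => (ps i).[1 * h + x 0 i]) ((ps i)^`().[1 * 0 + x 0 i] * 1).
  exact: (@is_derive1_comp _ (horner (ps i)) _ _ _ _ (is_derive_poly (ps i) _)
    (is_derive_affine 1 (x 0 i) 0)).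
have := is_derive1_mul i1 (@is_derive_cst R R R a 0 1).
by rewrite mulr0 mulr0 add0r mulr1 addr0.
Qed.

Lemma dpart_tens i Phi Psi : (forall K j, j != i -> Psi K j = Phi K j) ->
  (forall K, (Psi K i)^`() = Phi K i) -> dpart i (tens Psi) (tens Phi).
Proof.
move=> h1 h2; apply: dpart_sum => K; apply: dpartZ; apply: dpart_prod; [exact: h1|exact: h2].
Qed.

Definition adps (s : seq 'I_N) (Phi : idx -> 'I_N -> {poly R}) : idx -> 'I_N -> {poly R} :=
  fun K j => iter (count_mem j s) adp (Phi K j).

(** Since |x| <= exp k < rho on the support, [v] vanishes on all faces of the cube; this is the
    boundary condition matched by [adp]. *)
Definition vanish_out v := exists k, [/\ smooth v, 0 < k, ann k v & expR k < rho].

Lemma vanish_out_partial i v : vanish_out v -> vanish_out (partial i v).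
Proof.
move=> [k [sv k0 av kr]]; exists k; split; [exact: smooth_pd|exact: k0|exact: ann_partial|exact: kr].
Qed.

Lemma vanish_out_iter s v : vanish_out v -> vanish_out (iter_partial s v).
Proof. by move=> h; elim: s => [|i s IH]; [exact: h|exact: vanish_out_partial IH]. Qed.

Lemma vanish_outE v x j : vanish_out v -> rho <= `|x 0 j| -> v x = 0.
Proof.
move=> [k [_ k0 av kr]] h; apply: av; right; apply: lt_le_trans (nsq_coord_norm (ltW rho0) h).
by rewrite expRM_natl ltrXn2r// ?nnegrE// ?expR_ge0// ltW.
Qed.

(** Integration from the face where the [i]-th coordinate is [- rho] multiplies a uniform error by
    at most the side of the cube. *)
Lemma tens_step i v Phi e : 0 <= e -> vanish_out v ->
  (forall x, cube rho x -> `|tens Phi x - partial i v x| <= e) ->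
  forall x, cube rho x -> `|tens (adps [:: i] Phi) x - v x| <= 2 * rho * e.
Proof.
move=> e0 hv h x cx; have [k [sv _ _ _]] := hv.
have D : dpart i (tens (adps [:: i] Phi)) (tens Phi).
  apply: dpart_tens => [K j ji|K]; rewrite /adps /= addn0.
    by rewrite eq_sym (negbTE ji).
  by rewrite eqxx /= deriv_adp.
have DB := dpartB D (smooth_dpart i sv).
(* The point [y] is the projection of [x] onto that face, where both functions vanish; the segment
   between them stays in the cube. *)
pose l := x 0 i + rho; pose y : pt := x + (- l) *: ebasis R i.
have /andP[x1 x2] := cx i.
have l0 : 0 <= l by rewrite /l; lra.
have l2 : l <= 2 * rho by rewrite /l; lra.
have yi : y 0 i = - rho by rewrite !mxE !eqxx/= /l; ring.
have yx : l *: ebasis R i + y = x.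
  by rewrite /y addrCA -scalerDl addrN scale0r addr0.
have [c /andP[c0 cl]] := mean_value y DB l0; rewrite yx.
have -> : v y = 0 by apply: (vanish_outE (j := i)) => //; rewrite yi normrN gtr0_norm.
have -> : tens (adps [:: i] Phi) y = 0.
  rewrite /tens big1// => K _; rewrite (bigD1 i)//= yi /adps /= eqxx addn0 /= adp_root.
  by rewrite mul0r mulr0.
rewrite subr0 subr0 => ->; rewrite normrM (ger0_norm l0).
apply: ler_pM => //; apply: h => j.
rewrite !mxE eqxx /=; case: eqP => [->|_].
  by rewrite !mulr1; move: cl l2; rewrite /l => cl l2; apply/andP; split; lra.
by have := cx j; rewrite !mulr0 addr0 add0r.
Qed.

Lemma adps_cons i s Phi : adps s (adps [:: i] Phi) = adps (i :: s) Phi.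
Proof.
apply/funext => K; apply/funext => j; rewrite /adps -iterD /= addn0.
by rewrite addnC.
Qed.

Lemma tens_steps s v Phi e : 0 <= e -> vanish_out v ->
  (forall x, cube rho x -> `|tens Phi x - iter_partial s v x| <= e) ->
  forall x, cube rho x -> `|tens (adps s Phi) x - v x| <= (2 * rho) ^+ size s * e.
Proof.
elim: s Phi e => [|i s IH] Phi e e0 hv h x cx.
  by rewrite expr0 mul1r; have := h x cx; rewrite /adps.
rewrite -adps_cons /= exprSr -mulrA; apply: IH => //.
  by rewrite mulr_ge0// mulr_ge0// ltW.
by apply: tens_step => //; exact: vanish_out_iter.
Qed.

End Tens.

Definition twice : seq 'I_N := enum 'I_N ++ enum 'I_N.

Lemma count_twice i : count_mem i twice = 2.
Proof. by rewrite count_cat !count_uniq_mem ?enum_uniq// !mem_enum. Qed.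

Lemma polyfun_smooth p : polyfun p -> smooth (R := R) (N := N) p.
Proof.
elim=> [n q hq|p1 p2 _ h1 _ h2]; first exact: homog_smooth hq.
exact: (smoothD h1 h2).
Qed.

(* Approximate the product of all [d_i^2] applied to [u] uniformly, then integrate
   back twice in every variable; this also controls [u], [d_i u] and [d_i^2 u]. *)
Lemma poly_C2_dense u e : vanish_out u -> 0 < e -> exists2 p, polyfun p &
  forall x, cube rho x -> [/\ `|p x - u x| <= e,
    forall i, `|partial i p x - partial i u x| <= e &
    forall i, `|partial i (partial i p) x - partial i (partial i u) x| <= e].
Proof.
move=> hu e0; have [k [su k0 au _]] := hu.
pose g := iter_partial twice u.
have [k' [sg k0' ag _]] := vanish_out_iter twice hu.
have cg := cc_ann k0' ag (smooth_continuous sg).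
pose A := (1 + 2 * rho) ^+ size twice.
have r0 : 0 < 2 * rho by rewrite mulr_gt0.
have A0 : 0 < A by apply: exprn_gt0; apply: addr_gt0.
have eA : 0 < e / A by exact: divr_gt0.
have [m hm] := bernstein_approx rho0 cg eA.
pose Phi (K : {ffun 'I_N -> 'I_m.+1}) (j : 'I_N) := bern rho m (K j).
pose cf (K : {ffun 'I_N -> 'I_m.+1}) := g (nodeN rho K).
have small s v : (size s <= size twice)%N -> vanish_out v -> iter_partial s v = g ->
    forall x, cube rho x -> `|tens cf (adps s Phi) x - v x| <= e.
  move=> hs hv sg' x cx.
  apply: (@le_trans _ _ ((2 * rho) ^+ size s * (e / A))).
    by apply: tens_steps => //; [exact: ltW|rewrite sg'].
  rewrite mulrCA ler_piMr ?(ltW e0)// ler_pdivrMr// mul1r.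
  apply: (@le_trans _ _ ((1 + 2 * rho) ^+ size s)).
    by rewrite lerXn2r ?nnegrE ?addr_ge0 ?(ltW r0)// lerDr.
  by apply: ler_weXn2l => //; rewrite lerDl ltW.
have perm_rem i : perm_eq (i :: rem i twice) twice.
  by rewrite perm_sym perm_to_rem// -has_pred1 has_count count_twice.
have in_rem i : i \in rem i twice.
  have /permP/(_ (pred1 i)) := perm_rem i; rewrite /= eqxx count_twice => h.
  by rewrite -has_pred1 has_count; move: h; rewrite add1n => -[->].
have perm_rem2 i : perm_eq (i :: rem i (rem i twice)) (rem i twice).
  by rewrite perm_sym perm_to_rem.
have adpsD s t i : perm_eq (i :: s) t -> dpart i (tens cf (adps t Phi)) (tens cf (adps s Phi)).
  move=> /permP hst; apply: dpart_tens => [K j ji|K]; rewrite /adps -hst /=.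
    by rewrite eq_sym (negbTE ji).
  by rewrite eqxx /= deriv_adp.
have pp := polyfun_tens cf (adps twice Phi).
exists (tens cf (adps twice Phi)) => // x cx; split.
- exact: small.
- move=> i; rewrite (dpartE (adpsD _ _ _ (perm_rem i))); apply: small => //.
  + by rewrite -(perm_size (perm_rem i)).
  + exact: vanish_out_partial.
  + by rewrite -iter_partial_rcons; apply: iter_partial_perm => //; rewrite perm_rcons.
- move=> i; rewrite (dpartE (adpsD _ _ _ (perm_rem i))) (dpartE (adpsD _ _ _ (perm_rem2 i))).
  apply: small => //.
  + by rewrite -(perm_size (perm_rem i)) /= -(perm_size (perm_rem2 i)) /= ltnW.
  + by do 2 apply: vanish_out_partial.
  + rewrite -!iter_partial_rcons; apply: iter_partial_perm => //.
    rewrite perm_rcons; apply: perm_trans (perm_rem i); rewrite perm_cons perm_rcons.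
    exact: perm_rem2.
Qed.

End TensorApprox.

(** * The Rellich inequality *)

Section RellichLower.
Variables (R : realType) (N : nat).
Hypothesis N2 : (2 <= N)%N.
Notation pt := 'rV[R]_N.
Implicit Types (f g u p E : pt -> R) (x : pt).

Lemma test_fun_ann u : test_fun u -> exists2 k, 0 < k & ann k u.
Proof.
move=> [_ [r [r' [r0 [rr hu]]]]].
pose k := Num.max 1 (Num.max (- ln r) (ln r')).
have k1 : 1 <= k by rewrite le_max lexx.
have k2 : - ln r <= k by rewrite !le_max lexx orbT.
have k3 : ln r' <= k by rewrite !le_max lexx !orbT.
have r'0 : 0 < r' by lra.
exists k; first by lra.
move=> x hx; apply: hu; case: hx => hx.
  left; rewrite -(@ltr_pXn2r _ 2 isT) ?nnegrE ?enorm_ge0 ?(ltW r0)// enorm_sqr.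
  apply: lt_le_trans hx _; rewrite -(lnK (x := r)) ?posrE// -expRM_natl ler_expR; lra.
right; rewrite -(@ltr_pXn2r _ 2 isT) ?nnegrE ?enorm_ge0 ?(ltW r'0)// enorm_sqr.
apply: le_lt_trans hx; rewrite -(lnK (x := r')) ?posrE// -expRM_natl ler_expR; lra.
Qed.

Section Mop.
Variables (b c : R).

Lemma smooth_mop u : smooth u -> smooth (mop b c u).
Proof.
move=> su.
exact: (smoothD (smoothM (homog_smooth (homog_nsq R N)) (smooth_lap su))
  (smoothD (smoothZ c (smooth_eul su)) (smoothZ (- b) su))).
Qed.

Lemma ann_mop k u : smooth u -> ann k u -> ann k (mop b c u).
Proof.
move=> su au x hx; rewrite /mop (lap_ann su au hx) (eul_ann su au hx) (au x hx).
by rewrite !mulr0 !addr0.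
Qed.

(** With a cut-off for [f] and an approximation error for [E], the coefficients are fixed bounded
    functions, and only [E], its gradient and its pure second derivatives need to be small. *)
Lemma mopM f E x : smooth f -> smooth E -> mop b c (fun x => f x * E x) x =
  mop b c f x * E x + \sum_i (2 * nsq x * partial i f x + c * f x * x 0 i) * partial i E x +
  \sum_i (nsq x * f x) * partial i (partial i E) x.
Proof.
move=> sf sE; rewrite /mop (lapM sf sE) (eulM sf sE).
rewrite -mulr_sumr.
have -> : \sum_i (2 * nsq x * partial i f x + c * f x * x 0 i) * partial i E x =
    2 * nsq x * (\sum_i partial i f x * partial i E x) + c * f x * x_dot_grad E x.
  rewrite /x_dot_grad !mulr_sumr -big_split; apply: eq_bigr => i _ /=.
  by rewrite mulrDl !mulrA.
rewrite -/(laplacian E x).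
move: (\sum_i _) (laplacian f x) (laplacian E x) (x_dot_grad f x) (x_dot_grad E x) => *.
ring.
Qed.

Lemma mopN_cst f : smooth f -> mop b c (fun x => -1 * f x) = (fun x => -1 * mop b c f x).
Proof.
move=> sf; apply/funext => x; rewrite /mop (lapZ (-1) sf) (eulZ (-1) sf).
by move: (laplacian f x) (x_dot_grad f x) => *; ring.
Qed.

(** The approximant is a polynomial times the plateau. As the plateau is 1 on the support of [u],
    the error is the plateau times [u - p]. *)
Lemma annular_density k u : 0 < k -> smooth u -> ann k u ->
  forall e, 0 < e -> exists u', [/\ dec u', smooth u', ann (k + 1) u',
    forall x, `|u x - u' x| <= e & forall x, `|mop b c u x - mop b c u' x| <= e].
Proof.
move=> k0 su au e e0.
have tpl := testR_plat k0.
pose ph := Rad (N := N) (plat k).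
have sph' : smooth ph by exact: smooth_Rad.
have aph : ann (k + 1) ph.
  move=> x [h|h].
    rewrite /ph (Rad_near (k := k + 1)) ?ltW//; first by lra.
    move=> t; rewrite ler_normr => /orP[h'|h'].
      by rewrite /plat [step (k + 1 - t)]step_le0 ?mulr0//; lra.
    by rewrite /plat step_le0 ?mul0r//; lra.
  rewrite /ph (Rad_far (k := k + 1)) ?ltW//; first by lra.
  move=> t; rewrite ler_normr => /orP[h'|h'].
    by rewrite /plat [step (k + 1 - t)]step_le0 ?mulr0//; lra.
  by rewrite /plat step_le0 ?mul0r//; lra.
have k10 : 0 < k + 1 by lra.
(* Large enough that the plateau, supported in |x| <= exp (k + 1), vanishes outside the cube where
   the polynomial is controlled. *)
pose rho : R := expR (k + 2).
have rho0 : 0 < rho by exact: expR_gt0.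
have hu : vanish_out rho u by exists k; split=> //; rewrite /rho ltr_expR; lra.
pose A0 := mop b c ph.
pose A1 (i : 'I_N) x := 2 * nsq x * partial i ph x + c * ph x * x 0 i.
pose A2 x := nsq x * ph x.
have snsq := homog_smooth (homog_nsq R N).
have annA0 : ann (k + 1) A0 := ann_mop sph' aph.
have annA1 i : ann (k + 1) (A1 i).
  by move=> x hx; rewrite /A1 (ann_partial i sph' aph hx) (aph x hx) !mulr0 mul0r addr0.
have annA2 : ann (k + 1) A2 by move=> x hx; rewrite /A2 (aph x hx) mulr0.
have bnd f : smooth f -> ann (k + 1) f -> exists2 M : R, 0 <= M & forall x, `|f x| <= M.
  move=> sf af; exact: (cc_bounded (cc_ann k10 af (smooth_continuous sf))).
have [M M0 hM] := bnd ph sph' aph.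
have [M0' M00 hM0] := bnd A0 (smooth_mop sph') annA0.
have [M2 M20 hM2] := bnd A2 (smoothM snsq sph') annA2.
have hA1 i : exists M : R, 0 <= M /\ forall x, `|A1 i x| <= M.
  have sA1 : smooth (A1 i) := smoothD (smoothM (smoothZ 2 snsq) (smooth_pd i sph'))
    (smoothM (smoothZ c sph') (smooth_coord R i)).
  by have [M' ? ?] := bnd _ sA1 (annA1 i); exists M'.
have [M1 hM1] := choice hA1.
(* The sum of all coefficient bounds, so that accuracy [e / S] for the polynomial gives [e] for both
   [u] and [mop b c u]. *)
pose S := 1 + M + M0' + \sum_i M1 i + \sum_(i < N) M2.
have S1 : 0 <= \sum_i M1 i by apply: sumr_ge0 => i _; case: (hM1 i).
have S2 : 0 <= \sum_(i < N) M2 by apply: sumr_ge0.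
have S0 : 0 < S by rewrite /S; lra.
have eS : 0 < e / S by exact: divr_gt0.
have [p pp hp] := poly_C2_dense rho0 hu eS.
have sp := polyfun_smooth pp.
have dp := dec_polyfun N2 tpl pp.
have su' : smooth (fun x => ph x * p x) := smoothM sph' sp.
exists (fun x => ph x * p x).
have spn := smoothZ (-1) sp.
have sE := smoothD su spn.
pose E x := u x + -1 * p x.
have diff : (fun x => ph x * E x) = (fun x => u x + -1 * (ph x * p x)).
  by apply/funext => x; rewrite /E mulrDr (ann_plat x k0 au); ring.
have cubeP x : ~ cube rho x -> expR (2 * (k + 1)) < nsq x.
  move=> /existsNP[j /negP]; rewrite -ler_norml -ltNge => h.
  apply: lt_le_trans (nsq_coord_norm (ltW rho0) (ltW h)).
  rewrite /rho -expRM_natl ltr_expR; lra.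
have [Ee EeD EeDD] : [/\ forall x, cube rho x -> `|E x| <= e / S,
    forall x, cube rho x -> forall i, `|partial i E x| <= e / S &
    forall x, cube rho x -> forall i, `|partial i (partial i E) x| <= e / S].
  split=> x cx; have [h1 h2 h3] := hp x cx.
  - by rewrite /E mulN1r distrC.
  - move=> i; rewrite /E (partialD i su spn) (partialZ i (-1) sp) mulN1r distrC; exact: h2.
  - move=> i; rewrite /E (partialD i su spn) (partialZ i (-1) sp).
    rewrite (partialD i (smooth_pd i su) (smoothZ (-1) (smooth_pd i sp))).
    by rewrite (partialZ i (-1) (smooth_pd i sp)) mulN1r distrC; exact: h3.
split.
- exact: dp.
- exact: su'.
- exact: annMl.
- move=> x.
  have -> : u x - ph x * p x = ph x * E x.
    by rewrite (congr1 (fun F => F x) diff); ring.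
  have [cx|/cubeP cx] := pselect (cube rho x); last first.
    by rewrite (aph x) ?mul0r ?normr0 ?ltW//; right.
  rewrite normrM; apply: (@le_trans _ _ (M * (e / S))).
    by apply: ler_pM => //; exact: Ee.
  rewrite mulrCA ler_piMr ?(ltW e0)// ler_pdivrMr// mul1r /S; lra.
- move=> x.
  have -> : mop b c u x - mop b c (fun x => ph x * p x) x = mop b c (fun x => ph x * E x) x.
    by rewrite diff (mopD b c su (smoothZ (-1) su')) (mopN_cst su') mulN1r.
  rewrite (mopM x sph' sE).
  have [cx|/cubeP cx] := pselect (cube rho x); last first.
    have hx : nsq x < expR (- (2 * (k + 1))) \/ expR (2 * (k + 1)) < nsq x by right.
    rewrite -/A0 (annA0 x hx) mul0r add0r big1 => [|i _]; last by rewrite -/(A1 i x) (annA1 i x hx) mul0r.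
    rewrite big1 => [|i _]; last by rewrite -/(A2 x) (annA2 x hx) mul0r.
    by rewrite addr0 normr0 ltW.
  have b0 : `|A0 x * E x| <= M0' * (e / S) by rewrite normrM; apply: ler_pM => //; exact: Ee.
  have b1 : `|\sum_i A1 i x * partial i E x| <= (\sum_i M1 i) * (e / S).
    rewrite mulr_suml; apply: le_trans (ler_norm_sum _ _ _) _; apply: ler_sum => i _.
    rewrite normrM; apply: ler_pM; [exact: normr_ge0|exact: normr_ge0|exact: (hM1 i).2|exact: EeD].
  have b2 : `|\sum_i A2 x * partial i (partial i E) x| <= (\sum_(i < N) M2) * (e / S).
    rewrite mulr_suml; apply: le_trans (ler_norm_sum _ _ _) _; apply: ler_sum => i _.
    rewrite normrM; apply: ler_pM; [exact: normr_ge0|exact: normr_ge0|exact: hM2|exact: EeDD].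
  apply: (@le_trans _ _ ((M0' + \sum_i M1 i + \sum_(i < N) M2) * (e / S))).
    rewrite [leRHS]mulrDl [X in _ <= X + _]mulrDl.
    apply: le_trans (ler_normD _ _) _; apply: lerD; last exact: b2.
    by apply: le_trans (ler_normD _ _) _; apply: lerD; [exact: b0|exact: b1].
  rewrite mulrCA ler_piMr ?(ltW e0)// ler_pdivrMr// mul1r /S; lra.
Qed.

End Mop.

(** Factor f^2 - g^2 as (f - g) (f + g); since [e <= 1], the second factor is at most [2 * M + 1],
    and the plateau dominates the indicator of the annulus. *)
Lemma ip_close (be : R) k f g (M e : R) : 0 < k -> continuous f -> continuous g ->
  ann k f -> ann k g -> (forall x, `|f x| <= M) -> 0 <= e <= 1 ->
  (forall x, `|f x - g x| <= e) ->
  `|ip be f f - ip be g g| <= e * (2 * M + 1) * intN (fun x => wt be x * Rad (plat k) x).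
Proof.
move=> k0 cf cg af ag hM /andP[e0 e1] hfg.
have acf : ac f by split=> //; exists k.
have acg : ac g by split=> //; exists k.
have cW : cc (fun x : pt => wt be x * Rad (plat k) x).
  have -> : (fun x : pt => wt be x * Rad (plat k) x) =
    (fun x => Rad (fun t => expR (be * t) * plat k t) x * 1).
    by apply/funext => x; rewrite wt_Rad mulr1.
  by apply: cc_Rad => [|x]; [exact: testR_exp (testR_plat k0)|exact: cst_continuous].
have c1 := cc_ip be acf acf; have c2 := cc_ip be acg acg.
pose T := e * (2 * M + 1).
have key (f1 f2 : pt -> R) : ann k f1 -> ann k f2 -> (forall x, `|f1 x - f2 x| <= e) ->
   (forall x, `|f1 x + f2 x| <= 2 * M + 1) -> ac f1 -> ac f2 ->
   ip be f1 f1 <= ip be f2 f2 + T * intN (fun x => wt be x * Rad (plat k) x).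
  move=> a1 a2 h1 h2 ac1 ac2.
  rewrite /ip -(intN_Z _ cW) -(intN_D (cc_ip be ac2 ac2) (ccZ _ cW)).
  apply: intN_le; [exact: cc_ip|apply: ccD; [exact: cc_ip|exact: ccZ]|move=> x].
  have -> : wt be x * (f2 x * f2 x) + T * (wt be x * Rad (plat k) x) =
    wt be x * (f2 x * f2 x + T * Rad (plat k) x) by ring.
  apply: ler_wpM2l; first exact: wt_ge0.
  have pl0 : 0 <= Rad (plat k) x.
    rewrite /Rad; case: ifP => // _; rewrite /plat mulr_ge0//.
      by case/andP: (step_itv (ln (nsq x) / 2 + k + 1)).
    by case/andP: (step_itv (k + 1 - ln (nsq x) / 2)).
  have T0 : 0 <= T.
    by rewrite mulr_ge0//; have := hM 0; have := normr_ge0 (f 0); lra.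
  have H : f1 x * f1 x - f2 x * f2 x <= T.
    have -> : f1 x * f1 x - f2 x * f2 x = (f1 x - f2 x) * (f1 x + f2 x) by ring.
    by apply: le_trans (ler_norm _) _; rewrite normrM; apply: ler_pM.
  have [h3|h3] := ltP (nsq x) (expR (- (2 * k))).
    by rewrite (a1 x (or_introl h3)) (a2 x (or_introl h3)) !mulr0 add0r mulr_ge0.
  have [h4|h4] := ltP (expR (2 * k)) (nsq x).
    by rewrite (a1 x (or_intror h4)) (a2 x (or_intror h4)) !mulr0 add0r mulr_ge0.
  by rewrite Rad_plat// mulr1; lra.
have hs x : `|f x + g x| <= 2 * M + 1.
  have -> : f x + g x = 2 * f x - (f x - g x) by ring.
  apply: le_trans (ler_normB _ _) _; rewrite normrM (gtr0_norm (ltr0n _ 2)).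
  have := hM x; have := hfg x; lra.
have k1 := key f g af ag hfg hs acf acg.
have k2 : ip be g g <= ip be f f + T * intN (fun x => wt be x * Rad (plat k) x).
  by apply: key => // x; [rewrite distrC|rewrite addrC].
rewrite ler_norml -/T; apply/andP; split; lra.
Qed.

Lemma ip_rellich_lower (alpha b c K : R) u : smooth u -> (exists2 k, 0 < k & ann k u) ->
  (forall n, K <= Cn2 N alpha b c n) ->
  K * ip (2 * alpha - 4) u u <= ip (2 * alpha - 4) (mop b c u) (mop b c u).
Proof.
move=> su [k k0 au] hK; set be := 2 * alpha - 4.
have k10 : 0 < k + 1 by lra.
have kk : k <= k + 1 by lra.
have au1 := ann_widen kk au.
have sm := smooth_mop b c su; have am := ann_mop b c su au1.
have [M M0 hM] := cc_bounded (cc_ann k10 au1 (smooth_continuous su)).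
have [M' M0' hM'] := cc_bounded (cc_ann k10 am (smooth_continuous sm)).
set W := intN (fun x : pt => wt be x * Rad (plat (k + 1)) x).
(* The combined loss on the two sides per unit of [e]; the absolute value is there because [K] may
   have any sign. *)
pose C := `|K| * ((2 * M + 1) * W) + (2 * M' + 1) * W.
suff H e : 0 < e -> e <= 1 -> K * ip be u u <= ip be (mop b c u) (mop b c u) + e * C.
  apply/ler_addgt0Pl => e e0; rewrite addrC.
  pose d := Num.min 1 (e / (`|C| + 1)).
  have C1 : 0 < `|C| + 1 by have := normr_ge0 C; lra.
  have d0 : 0 < d by rewrite lt_min ltr01 divr_gt0.
  have d1 : d <= 1 by rewrite ge_min lexx.
  apply: le_trans (H d d0 d1) _; rewrite lerD2l.
  apply: (@le_trans _ _ (d * (`|C| + 1))).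
    by rewrite ler_wpM2l ?(ltW d0)//; have := ler_norm C; lra.
  by rewrite -ler_pdivlMr// ge_min lexx orbT.
move=> e0 e1.
have [u' [du su' au' h1 h2]] := annular_density b c k0 su au e0.
have eI : 0 <= e <= 1 by rewrite ltW.
have L := dec_bound N2 hK du.
have c1 := ip_close be k10 (smooth_continuous su) (smooth_continuous su') au1 au' hM eI h1.
have c2 := ip_close be k10 (smooth_continuous sm) (smooth_continuous (smooth_mop b c su')) am
  (ann_mop b c su' au') hM' eI h2.
rewrite -/W in c1 c2; rewrite -/be in L.
move: c1 c2 L.
move: (ip be u u) (ip be u' u') (ip be (mop b c u) _) (ip be (mop b c u') _) => a a' m m'.
move=> c1 c2 L.
have c3 : K * (a - a') <= `|K| * (e * (2 * M + 1) * W).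
  by apply: le_trans (ler_norm _) _; rewrite normrM ler_wpM2l.
have c4 : m' - m <= e * (2 * M' + 1) * W.
  by apply: le_trans c2; rewrite distrC ler_norm.
have -> : e * C = `|K| * (e * (2 * M + 1) * W) + e * (2 * M' + 1) * W by rewrite /C; ring.
rewrite mulrBr in c3; lra.
Qed.

(** Away from the origin |x|^(2 alpha) |L u|^2 = |x|^(2 alpha - 4) (|x|^2 L u)^2, so both sides
    become norms for one weight. *)
Lemma rellichE (alpha b c K : R) u : test_fun u -> rellich_ineq alpha b c K u <->
  K * ip (2 * alpha - 4) u u <= ip (2 * alpha - 4) (mop b c u) (mop b c u).
Proof.
move=> tu; have [k k0 au] := test_fun_ann tu; have su := tu.1.
set be := 2 * alpha - 4.
have acu : ac u by split; [exact: (smooth_continuous su)|exists k].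
have acm : ac (mop b c u).
  split; first exact: (smooth_continuous (smooth_mop b c su)).
  by exists k => //; exact: ann_mop.
rewrite /rellich_ineq.
have -> : (fun x => (wt (2 * alpha - 4) x * u x ^+ 2)%R) = (fun x => wt be x * (u x * u x)).
  by apply/funext => x; rewrite expr2.
have -> : (fun x => (wt (2 * alpha) x * Lop b c u x ^+ 2)%R) =
    (fun x => wt be x * (mop b c u x * mop b c u x)).
  (* At the origin [Lop] divides by zero, but [u] and its derivatives vanish there, so both sides
     are 0. *)
  apply/funext => x; have [q0|q0] := nsq0Vpos x.
    have hx : nsq x < expR (- (2 * k)) \/ expR (2 * k) < nsq x by left; rewrite q0 expR_gt0.
    rewrite (ann_mop b c su au hx) mulr0 mulr0 /Lop enorm_sqr q0 (lap_ann su au hx) (au x hx).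
    by rewrite invr0 !mulr0 addr0 subr0 expr0n mulr0.
  have mE : mop b c u x = nsq x * Lop b c u x.
    rewrite /mop /Lop enorm_sqr.
    move: (laplacian u x) (x_dot_grad u x) (u x) => A B C.
    by field; rewrite gt_eqF.
  have -> : wt (2 * alpha) x = wt be x * nsq x ^+ 2.
    rewrite /wt -enorm_sqr -exprM -powR_mulrn ?enorm_ge0// -powRD.
      by congr (powR _ _); rewrite /be; ring.
    by apply/implyP => _; rewrite gt_eqF// enorm_gt0.
  by rewrite mE; ring.
rewrite (integral_RN_intN (cc_ip be acu acu)) (integral_RN_intN (cc_ip be acm acm)).
by rewrite -EFinM lee_fin.
Qed.

Lemma rellich_lower (alpha b c K : R) u : test_fun u ->
  (forall n, K <= Cn2 N alpha b c n) -> rellich_ineq alpha b c K u.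
Proof.
move=> tu hK; apply/(rellichE _ _ _ _ tu).
by apply: ip_rellich_lower => //; [exact: tu.1|exact: test_fun_ann].
Qed.

End RellichLower.

(** * Sharpness *)

Section PlanarHarmonic.
Variables (R : realType) (N : nat).
Hypothesis N2 : (2 <= N)%N.
Notation pt := 'rV[R]_N.

Let i0 : 'I_N := Ordinal (ltnW N2).
Let i1 : 'I_N := Ordinal N2.

(* The real and imaginary parts [p], [q] of [(x_0 + i x_1)^n], with their
   Cauchy-Riemann equations. *)
Lemma planar_harmonics (n : nat) : exists p q : pt -> R,
  [/\ harmonic_homog n p, harmonic_homog n q,
      partial i0 p = partial i1 q, partial i1 p = (fun x => - partial i0 q x) &
      p (ebasis R i0) = 1 /\ q (ebasis R i0) = 0].
Proof.
have i01 : (i0 == i1) = false by [].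
have i10 : (i1 == i0) = false by [].
elim: n => [|n [p [q [[hp lp] [hq lq] cr1 cr2 [p1 q0]]]]].
  exists (fun=> 1), (fun=> 0); split=> //.
  - by split; [exact: homog_cst|exact: lap_cst].
  - by split; [exact: homog_cst|exact: lap_cst].
  - by rewrite !partial_cst.
  - by rewrite !partial_cst; apply/funext => x; rewrite oppr0.
have sp := homog_smooth hp; have sq := homog_smooth hq.
have c0 := smooth_coord R i0; have c1 := smooth_coord R i1.
have sN := smoothZ (-1) (smoothM c1 sq).
have pd i : partial i (fun x : pt => x 0 i0 * p x + -1 * (x 0 i1 * q x)) =
    (fun x => (i == i0)%:R * p x + x 0 i0 * partial i p x +
       -1 * ((i == i1)%:R * q x + x 0 i1 * partial i q x)).
  rewrite (partialD i (smoothM c0 sp) sN) (partialM i c0 sp).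
  by rewrite (partialZ i (-1) (smoothM c1 sq)) (partialM i c1 sq) !partial_coord.
have qd i : partial i (fun x : pt => x 0 i1 * p x + x 0 i0 * q x) =
    (fun x => (i == i1)%:R * p x + x 0 i1 * partial i p x +
       ((i == i0)%:R * q x + x 0 i0 * partial i q x)).
  rewrite (partialD i (smoothM c1 sp) (smoothM c0 sq)) (partialM i c1 sp).
  by rewrite (partialM i c0 sq) !partial_coord.
exists (fun x : pt => x 0 i0 * p x + -1 * (x 0 i1 * q x)), (fun x : pt => x 0 i1 * p x + x 0 i0 * q x).
split.
- split.
    exact: (homog_add (homog_coord i0 hp) (homogZ (-1) (homog_coord i1 hq))).
  rewrite (lapD (smoothM c0 sp) sN) (lapZ (-1) (smoothM c1 sq)).
  rewrite (lap_coordM i0 sp) (lap_coordM i1 sq) lp lq cr1.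
  by apply/funext => x; ring.
- split; first exact: (homog_add (homog_coord i1 hp) (homog_coord i0 hq)).
  rewrite (lapD (smoothM c1 sp) (smoothM c0 sq)).
  rewrite (lap_coordM i1 sp) (lap_coordM i0 sq) lp lq cr2.
  by apply/funext => x; ring.
- rewrite pd qd cr1 cr2 !eqxx i01 i10 /=; apply/funext => x.
  by move: (partial i1 q x) (partial i0 q x) (p x) (q x) => *; ring.
- rewrite pd qd cr1 cr2 !eqxx i01 i10 /=; apply/funext => x.
  by move: (partial i1 q x) (partial i0 q x) (p x) (q x) => *; ring.
- by rewrite p1 q0 !mxE !eqxx; split; rewrite /=; ring.
Qed.

End PlanarHarmonic.

Section Sharpness.
Variables (R : realType) (N : nat).
Hypothesis N2 : (2 <= N)%N.
Notation pt := 'rV[R]_N.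
Variables (alpha b c K : R) (n : nat) (h : pt -> R) (e0 : pt).
Hypothesis hh : harmonic_homog n h.
Hypothesis he0 : h e0 = 1.
Hypothesis ne0 : nsq e0 = 1.
Implicit Types f g : R -> R.

Let be : R := 2 * alpha - 4.
Let sg : R := (N%:R + be) / 2.
Let B : R := 1 - alpha + c / 2.
Let mu : R := b + lambda R N n + gamma2 N alpha c.
Let M0 : R := - (N%:R + 2 * n%:R).

Hypothesis ineq : forall u : pt -> R, test_fun u ->
  K * ip be u u <= ip be (mop b c u) (mop b c u).

Lemma homog_scale k (p : pt -> R) (a : R) x : homog k p -> p (a *: x) = a ^+ k * p x.
Proof.
elim=> [d|l|l i q _ IH|l p1 p2 _ h1 _ h2].
- by rewrite mul1r.
- by rewrite mulr0.
- by rewrite IH mxE exprS; ring.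
- by rewrite h1 h2 mulrDr.
Qed.

Definition mfun f : pt -> R := fun x => Rad (fun t => expR (M0 * t) * f t) x * (h x * h x).

(* The measure [|x|^(- N - 2 n) h^2 dx] is dilation invariant, so [mm] is invariant
   under translations of [ln |x|]. *)
Definition mm f : R := intN (mfun f).

Let sh : smooth h := homog_smooth hh.1.

Lemma cc_mfun f : testR f -> cc (mfun f).
Proof.
move=> tf; apply: cc_Rad; first exact: testR_exp.
exact: (smooth_continuous (smoothM sh sh)).
Qed.

Lemma mmD f g : testR f -> testR g -> mm (fun t => f t + g t) = mm f + mm g.
Proof.
move=> tf tg; rewrite /mm -(intN_D (cc_mfun tf) (cc_mfun tg)); congr intN.
apply/funext => x; rewrite /mfun -mulrDl RadD; congr (Rad _ _ * _).
by apply/funext => t; rewrite mulrDr.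
Qed.

Lemma mmZ a f : testR f -> mm (fun t => a * f t) = a * mm f.
Proof.
move=> tf; rewrite /mm -(intN_Z _ (cc_mfun tf)); congr intN.
apply/funext => x; rewrite /mfun [RHS]mulrA RadZ; congr (Rad _ _ * _).
by apply/funext => t; rewrite mulrCA.
Qed.

Lemma mm_le f g : testR f -> testR g -> (forall t, f t <= g t) -> mm f <= mm g.
Proof.
move=> tf tg fg; apply: intN_le; [exact: cc_mfun|exact: cc_mfun|move=> x].
rewrite /mfun ler_wpM2r -?expr2 ?sqr_ge0// /Rad; case: ifP => // _.
by rewrite ler_wpM2l// expR_ge0.
Qed.

(** The point exp(t0) e0 has logarithmic radius [t0], and by homogeneity [h] is positive there. *)
Lemma mm_gt0 f (t0 : R) : testR f -> (forall t, 0 <= f t) -> 0 < f t0 -> 0 < mm f.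
Proof.
move=> tf f0 ft0; apply: (@intN_gt0 R N (mfun f) (expR t0 *: e0)); first exact: cc_mfun.
  move=> x; rewrite /mfun mulr_ge0// -?expr2 ?sqr_ge0// /Rad; case: ifP => // _.
  by rewrite mulr_ge0// expR_ge0.
have q : nsq (expR t0 *: e0) = expR (2 * t0).
  rewrite (homog_scale _ _ (homog_nsq R N)) ne0 mulr1; exact: (esym (expRM_natl 2 t0)).
rewrite /mfun (homog_scale _ _ hh.1) he0 mulr1 /Rad q expR_gt0 expRK.
have -> : 2 * t0 / 2 = t0 by lra.
by rewrite !mulr_gt0// ?exprn_gt0// expR_gt0.
Qed.

(** The infinitesimal form of translation invariance: the Euler field acts on [mfun f] as - N plus
    differentiation of [f], and - N is exactly what the divergence theorem absorbs. *)
Lemma mm_d1 f f' : testR f -> testR f' -> d1 f f' -> mm f' = 0.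
Proof.
move=> tf tf' D.
have tF := testR_exp M0 tf.
have [k k0 ak] := @ann_Rad R N _ tF.
have shh := smoothM sh sh.
have := intN_eul_ann k0 (smoothM (smooth_Rad tF) shh) (annMl _ ak).
rewrite (eulM (smooth_Rad tF) shh) (eul_Rad N tF (d1M (d1_exp M0) D)) (eulM sh sh) (homog_eul hh.1).
rewrite -/(mfun f) -/(mm f).
have -> : (fun x => Rad (fun t => M0 * expR (M0 * t) * f t + expR (M0 * t) * f' t) x * (h x * h x)
   + Rad (fun t => expR (M0 * t) * f t) x * (n%:R * h x * h x + h x * (n%:R * h x)))
   = (fun x => (M0 + 2 * n%:R) * mfun f x + mfun f' x).
  apply/funext => x; rewrite /mfun -RadD.
  have -> : Rad (fun t => M0 * expR (M0 * t) * f t) x = M0 * Rad (fun t => expR (M0 * t) * f t) x.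
    by rewrite RadZ; congr (Rad _ _); apply/funext => t; rewrite mulrA.
  by move: (Rad _ x) (Rad _ x) (h x) => *; ring.
rewrite (intN_D (ccZ _ (cc_mfun tf)) (cc_mfun tf')) (intN_Z _ (cc_mfun tf)) -/(mm f) -/(mm f').
have -> : M0 + 2 * n%:R = - N%:R by rewrite /M0; ring.
by move/(canRL (addKr _)) => ->; ring.
Qed.

(** Under the dilation by exp s, the factors from h^2 and from the power [M0] combine to exp(- N s),
    the Jacobian factor of [intN_affine]. *)
Lemma mm_shift f (s : R) : testR f -> mm (fun t => f (t + s)) = mm f.
Proof.
move=> tf; have tfs := testR_shift s tf.
have a0 := expR_gt0 s.
have := intN_affine (0 : pt) a0 (cc_mfun tf).
have -> : (fun x => mfun f (expR s *: x + 0)) =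
    (fun x => (expR s)^-1 ^+ N * mfun (fun t => f (t + s)) x).
  apply/funext => x; rewrite addr0 /mfun (homog_scale _ _ hh.1) /Rad.
  have q : nsq (expR s *: x) = expR (2 * s) * nsq x.
    rewrite (homog_scale _ _ (homog_nsq R N)); congr (_ * _); exact: (esym (expRM_natl 2 s)).
  rewrite q pmulr_rgt0 ?expR_gt0//; case: ifP => q0; last by rewrite !mul0r mulr0.
  rewrite lnM ?posrE ?expR_gt0// expRK.
  have -> : (2 * s + ln (nsq x)) / 2 = ln (nsq x) / 2 + s by lra.
  have -> : expR (M0 * (ln (nsq x) / 2 + s)) =
      (expR s)^-1 ^+ N * ((expR s)^-1 ^+ n * (expR s)^-1 ^+ n) * expR (M0 * (ln (nsq x) / 2)).
    rewrite mulrDr expRD mulrC; congr (_ * _).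
    rewrite /M0 -!expRN -!expRM_natl -!expRD; congr expR; ring.
  have u : (expR s)^-1 ^+ n * expR s ^+ n = 1 by rewrite -exprMn mulVf ?expr1n// gt_eqF.
  move: u; move: ((expR s)^-1 ^+ n) (expR s ^+ n) ((expR s)^-1 ^+ N) => A A' C AA.
  move: (expR _) (f _) (h x) => E F H.
  transitivity (C * (A * A') * (A * A') * E * F * (H * H)); first by ring.
  by rewrite AA; ring.
rewrite (intN_Z _ (cc_mfun tfs)) => /mulfI; apply.
by rewrite expf_neq0// invr_neq0// gt_eqF.
Qed.

(** The exponent makes D act as d/dt on [g]: Euler's field contributes [n] through [h], and D adds
    [sg]. The weighted norm of [ufun g] is then the [mm] norm of [g]. *)
Definition ufun g : pt -> R := fun x => Rad (fun t => expR (- (n%:R + sg) * t) * g t) x * h x.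

Lemma sph_ufun g : testR g -> sph n (ufun g).
Proof. by move=> tg; exact: (sph_base (testR_exp _ tg) hh). Qed.

Lemma eulD_ufun g g' : testR g -> d1 g g' -> eulD_op be (ufun g) = ufun g'.
Proof.
move=> tg D; rewrite /eulD_op (eul_RadM (testR_exp _ tg) (d1M (d1_exp _) D) hh).
apply/funext => x; rewrite /ufun mulrA -mulrDl RadZ RadD; congr (Rad _ _ * _).
by apply/funext => t; rewrite -/sg; ring.
Qed.

Lemma ip_ufun g : testR g -> ip be (ufun g) (ufun g) = mm (fun t => g t * g t).
Proof.
move=> tg; rewrite /ip /mm; congr intN; apply/funext => x; rewrite /ufun /mfun.
rewrite mulrACA RadM (mulrA (wt be x)) wt_Rad; congr (Rad _ _ * _).
apply/funext => t; have -> : M0 = be + - (n%:R + sg) + - (n%:R + sg).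
  by rewrite /M0 /sg; field.
by rewrite !mulrDl !expRD; ring.
Qed.

Lemma mop_ufun g g' g'' : testR g -> testR g' -> d1 g g' -> d1 g' g'' ->
  mop b c (ufun g) = ufun (fun t => g'' t + (2 * B * g' t + - mu * g t)).
Proof.
move=> tg tg' D D'; rewrite (mop_sph alpha b c (sph_ufun tg)) -/be -/B -/mu.
rewrite (eulD_ufun tg D) (eulD_ufun tg' D'); apply/funext => x.
rewrite /ufun !mulrA !RadZ -!mulrDl !RadD; congr (Rad _ _ * _).
by apply/funext => t; ring.
Qed.

Lemma mm_ineq g g' g'' : testR g -> testR g' -> testR g'' -> d1 g g' -> d1 g' g'' ->
  K * mm (fun t => g t * g t) <=
  mm (fun t => (g'' t + (2 * B * g' t + - mu * g t)) * (g'' t + (2 * B * g' t + - mu * g t))).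
Proof.
move=> tg tg' tg'' D D'.
have tt : testR (fun t => g'' t + (2 * B * g' t + - mu * g t)).
  by apply: testRD => //; apply: testRD; exact: testRZ.
rewrite -(ip_ufun tg) -(ip_ufun tt) -(mop_ufun tg tg' D D'); apply: ineq.
exact: (test_fun_Rad (testR_exp _ tg) sh).
Qed.

Lemma testRMM f g : testR f -> testR g -> testR (fun t => f t * g t).
Proof. by move=> tf; apply: testRM; exact: tf.1. Qed.

Lemma d1Z (a : R) f f' : d1 f f' -> d1 (fun t => a * f t) (fun t => a * f' t).
Proof. by move=> D; apply: d1_ext (d1M (d1_cst a) D) => // t; rewrite mul0r add0r. Qed.

Lemma d1_affine (a s : R) : d1 (fun t : R => a * t + s) (fun=> a).
Proof. by move=> t; exact: is_derive_affine. Qed.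

Lemma d1_shift f f' (s : R) : d1 f f' -> d1 (fun t => f (t + s)) (fun t => f' (t + s)).
Proof.
move=> D; have := d1_comp D (d1_affine 1 s).
by apply: d1_ext => t; rewrite mul1r ?mulr1.
Qed.

(** The squared modulus of - xi^2 + 2 i B xi - mu, the value of D^2 + 2 B D - mu at D = i xi. *)
Definition symbol (xi : R) : R := (mu + xi ^+ 2) ^+ 2 + 4 * B ^+ 2 * xi ^+ 2.

(* Testing with the real and imaginary parts of [phi t * exp (i xi t)] and
   adding up makes the Fourier symbol appear. *)
Lemma symbol_ineq (xi : R) phi phi1 phi2 :
  testR phi -> testR phi1 -> testR phi2 -> d1 phi phi1 -> d1 phi1 phi2 ->
  K * mm (fun t => phi t * phi t) <= symbol xi * mm (fun t => phi t * phi t) +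
    (mm (fun t => phi2 t * phi2 t) +
     (4 * B ^+ 2 + 4 * xi ^+ 2 + 2 * (mu + xi ^+ 2)) * mm (fun t => phi1 t * phi1 t)).
Proof.
move=> t0 t1 t2 D1 D2.
pose C t := cos (xi * t + 0); pose S t := sin (xi * t + 0).
have sC : smooth1 C.
  apply: sm1_gen_smooth1; apply: (@sm1_comp _ cos (fun t => xi * t + 0)); first exact: sm1_cos.
  exact: sm1_base (smooth1_affine xi 0).
have sS : smooth1 S.
  apply: sm1_gen_smooth1; apply: (@sm1_comp _ sin (fun t => xi * t + 0)); first exact: sm1_sin.
  exact: sm1_base (smooth1_affine xi 0).
have DC : d1 C (fun t => - xi * S t).
  have dcos : d1 (@cos R) (fun t => - sin t) by move=> t; exact: is_derive_cos.
  by apply: d1_ext (d1_comp dcos (d1_affine xi 0)) => t //; rewrite /S; ring.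
have DS : d1 S (fun t => xi * C t).
  have dsin : d1 (@sin R) cos by move=> t; exact: is_derive_sin.
  by apply: d1_ext (d1_comp dsin (d1_affine xi 0)) => t //; rewrite /C; ring.
have CS t : C t * C t + S t * S t = 1 by rewrite -!expr2 /C /S cos2Dsin2.
have tC f : testR f -> testR (fun t => C t * f t) by exact: testRM.
have tS f : testR f -> testR (fun t => S t * f t) by exact: testRM.
pose g t := C t * phi t; pose g' t := C t * phi1 t + - xi * (S t * phi t).
pose k t := S t * phi t; pose k' t := S t * phi1 t + xi * (C t * phi t).
pose g'' t := C t * phi2 t + (- (xi ^+ 2) * (C t * phi t) + - (2 * xi) * (S t * phi1 t)).
pose k'' t := S t * phi2 t + (- (xi ^+ 2) * (S t * phi t) + 2 * xi * (C t * phi1 t)).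
have tg : testR g by exact: tC.
have tk : testR k by exact: tS.
have tg' : testR g' by apply: testRD; [exact: tC|apply/testRZ/tS].
have tk' : testR k' by apply: testRD; [exact: tS|apply/testRZ/tC].
have tg'' : testR g''.
  apply: testRD; [exact: tC|apply: testRD; [apply/testRZ/tC => //|apply/testRZ/tS => //]].
have tk'' : testR k''.
  apply: testRD; [exact: tS|apply: testRD; [apply/testRZ/tS => //|apply/testRZ/tC => //]].
have Dg : d1 g g' by apply: d1_ext (d1M DC D1) => t //; rewrite /g'; ring.
have Dk : d1 k k' by apply: d1_ext (d1M DS D1) => t //; rewrite /k'; ring.
have Dg' : d1 g' g''.
  by apply: d1_ext (d1D (d1M DC D2) (d1Z (- xi) (d1M DS D1))) => t //; rewrite /g''; ring.
have Dk' : d1 k' k''.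
  by apply: d1_ext (d1D (d1M DS D2) (d1Z xi (d1M DC D1))) => t //; rewrite /k''; ring.
have i1 := mm_ineq tg tg' tg'' Dg Dg'.
have i2 := mm_ineq tk tk' tk'' Dk Dk'.
pose X t := g'' t + (2 * B * g' t + - mu * g t).
pose Y t := k'' t + (2 * B * k' t + - mu * k t).
have tX : testR X by apply: testRD => //; apply: testRD; exact: testRZ.
have tY : testR Y by apply: testRD => //; apply: testRD; exact: testRZ.
have t00 := testRMM t0 t0; have t11 := testRMM t1 t1; have t22 := testRMM t2 t2.
have t01 := testRMM t0 t1; have t12 := testRMM t1 t2; have t02 := testRMM t0 t2.
pose ka : R := - (2 * B * (mu + xi ^+ 2)) + 4 * B * xi ^+ 2.
pose W t := 2 * B * (phi1 t * phi1 t) + (- (2 * (mu + xi ^+ 2)) * (phi t * phi1 t) +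
  ka * (phi t * phi t)).
pose W' t := 2 * B * (phi2 t * phi1 t + phi1 t * phi2 t) +
  (- (2 * (mu + xi ^+ 2)) * (phi1 t * phi1 t + phi t * phi2 t) +
   ka * (phi1 t * phi t + phi t * phi1 t)).
have tW : testR W by apply: testRD; [exact: testRZ|apply: testRD; exact: testRZ].
have DW : d1 W W' by exact: (d1D (d1Z _ (d1M D2 D2)) (d1D (d1Z _ (d1M D1 D2)) (d1Z _ (d1M D1 D1)))).
have tW' : testR W'.
  apply: testRD; first by apply: testRZ; apply: testRD; exact: testRMM.
  by apply: testRD; apply: testRZ; apply: testRD; exact: testRMM.
have mW := mm_d1 tW tW' DW.
have E1 : mm (fun t => g t * g t) + mm (fun t => k t * k t) = mm (fun t => phi t * phi t).
  rewrite -mmD; [|exact: testRMM|exact: testRMM]; congr mm; apply/funext => t.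
  by rewrite -[RHS]mul1r -(CS t) /g /k; ring.
have E2 : mm (fun t => X t * X t) + mm (fun t => Y t * Y t) =
    symbol xi * mm (fun t => phi t * phi t) + (mm (fun t => phi2 t * phi2 t) +
     (4 * B ^+ 2 + 4 * xi ^+ 2 + 2 * (mu + xi ^+ 2)) * mm (fun t => phi1 t * phi1 t)).
  rewrite -mmD; [|exact: testRMM|exact: testRMM].
  rewrite -(mmZ (symbol xi) t00) -(mmZ (4 * B ^+ 2 + 4 * xi ^+ 2 + 2 * (mu + xi ^+ 2)) t11).
  rewrite -(mmD t22 (testRZ _ t11)) -(mmD (testRZ _ t00) (testRD t22 (testRZ _ t11))).
  rewrite -[RHS]addr0 -mW -mmD//; last by apply: testRD; [exact: testRZ|apply: testRD => //; exact: testRZ].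
  congr mm; apply/funext => t.
  pose P := phi2 t - xi ^+ 2 * phi t + 2 * B * phi1 t - mu * phi t.
  pose Q := 2 * xi * phi1 t + 2 * B * xi * phi t.
  transitivity ((C t * C t + S t * S t) * (P * P + Q * Q)).
    by rewrite /X /Y /g /g' /g'' /k /k' /k'' /P /Q; ring.
  by rewrite CS /P /Q /W' /symbol /ka; ring.
by rewrite -E2 -E1 mulrDr; apply: lerD.
Qed.

(** The transition function is not compactly supported, but it is locally constant away from
    [0, 1]. *)
Lemma step_d1 : exists S1 : R -> R, testR S1 /\ d1 (@step R) S1.
Proof.
have [S1 [sS1 D]] := smooth1_d1 (@smooth1_step R).
exists S1; split=> //; split=> //; exists 2; split=> // t ht.
have near_cst (a : R) : (\forall s \near t, step s = a) -> S1 t = 0.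
  move=> ha; have H : is_derive t 1 (@step R) 0.
    apply: near_eq_is_derive (is_derive_cst a _ _).
    by move: ha; apply: filterS => s ->.
  by case: (D t) => _ <-; case: H.
move: ht; rewrite ler_normr => /orP[h1|h1].
  apply: (near_cst 1); have t1 : 1 < t by lra.
  by have := lt_nbhsr t1; apply: filterS => s /= hs; rewrite step_ge1// ltW.
apply: (near_cst 0); have t1 : t < 0 by lra.
by have := lt_nbhsl t1; apply: filterS => s /= hs; rewrite step_le0// ltW.
Qed.

(* A plateau of length about [k], whose derivatives live near [0] and [k]. *)
Definition bumpk (k : nat) (t : R) : R := step t + -1 * step (t + - k%:R).

Lemma testR_bumpk k : testR (bumpk k).
Proof.
split.
  apply: sm1_gen_smooth1; apply: sm1_add; first exact: sm1_base (smooth1_step R).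
  apply: sm1_mul; first exact: sm1_cst.
  apply: (@sm1_comp _ (@step R) (fun t => t + - k%:R)); first exact: sm1_base (smooth1_step R).
  by apply: sm1_add; [exact: sm1_id|exact: sm1_cst].
have k0 := ler0n R k.
exists (k%:R + 1); split; first by lra.
move=> t; rewrite ler_normr => /orP[h1|h1]; rewrite /bumpk.
  by rewrite !step_ge1; [ring|lra|lra].
by rewrite !step_le0; [ring|lra|lra].
Qed.

(** From (a - b)^2 <= 2 a^2 + 2 b^2 and shift invariance. It bounds the derivatives of [bumpk k]
    independently of [k]. *)
Lemma mm_diff_le f (s : R) : testR f ->
  mm (fun t => (f t + -1 * f (t + s)) * (f t + -1 * f (t + s))) <= 4 * mm (fun t => f t * f t).
Proof.
move=> tf; have tff := testRMM tf tf.
have tfs := testR_shift s tf; have tffs := testR_shift s tff.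
have td : testR (fun t => f t + -1 * f (t + s)) by apply: testRD => //; exact: testRZ.
have -> : 4 * mm (fun t => f t * f t) =
    mm (fun t => 2 * (f t * f t) + 2 * (f (t + s) * f (t + s))).
  rewrite (mmD (testRZ 2 tff) (testRZ 2 tffs)) (mmZ 2 tff) (mmZ 2 tffs) (mm_shift s tff).
  by ring.
apply: mm_le => [||t]; first exact: testRMM.
  by apply: testRD; exact: testRZ.
have := sqr_ge0 (f t + f (t + s)); rewrite expr2; lra.
Qed.

Lemma bumpk_ge0 k t : 0 <= bumpk k t.
Proof.
have s0 := step_itv t; have s1 := step_itv (t + - k%:R).
case: k s1 => [|k] s1; first by rewrite /bumpk oppr0 addr0; lra.
have k1 : (1 : R) <= k.+1%:R by rewrite ler1n.
rewrite /bumpk; have [h1|h1] := lerP 1 t; first by rewrite (step_ge1 h1); lra.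
rewrite (@step_le0 _ (t + - k.+1%:R)); lra.
Qed.

(** [bumpk k.+1] is [bumpk k] plus a translate of [bumpk 1]; both are nonnegative, so the square of
    the sum dominates the sum of squares. *)
Lemma mm_bumpk k : k%:R * mm (fun t => bumpk 1 t * bumpk 1 t) <= mm (fun t => bumpk k t * bumpk k t).
Proof.
have t1 := testR_bumpk 1; have t11 := testRMM t1 t1.
elim: k => [|k IH].
  have -> : (fun t => bumpk 0 t * bumpk 0 t) = (fun t => 0 * (bumpk 1 t * bumpk 1 t)).
    by apply/funext => t; rewrite /bumpk oppr0 addr0; ring.
  by rewrite (mmZ 0 t11).
have tk := testR_bumpk k; have tkk := testRMM tk tk.
have tS := testR_bumpk k.+1.
have ts := testR_shift (- k%:R) t11.
rewrite -natr1 mulrDl mul1r -{2}(mm_shift (- k%:R) t11).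
apply: le_trans (_ : mm (fun t => bumpk k t * bumpk k t +
    bumpk 1 (t + - k%:R) * bumpk 1 (t + - k%:R)) <= _); first by rewrite (mmD tkk ts) lerD2r.
apply: mm_le => [||t]; [exact: testRD|exact: testRMM|].
have -> : bumpk k.+1 t = bumpk k t + bumpk 1 (t + - k%:R).
  rewrite /bumpk; have -> : t + - k.+1%:R = t + - k%:R + - 1%:R by rewrite -natr1; ring.
  ring.
have h1 := bumpk_ge0 k t; have h2 := bumpk_ge0 1 (t + - k%:R).
have := mulr_ge0 h1 h2; lra.
Qed.

(** In [symbol_ineq] for [bumpk k] the main terms grow at least linearly in [k] while the error
    terms stay bounded by [Q]; a positive excess [K - symbol xi] is contradictory for large [k]. *)
Lemma sharp_bound (xi : R) : K <= symbol xi.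
Proof.
rewrite leNgt; apply/negP => lt.
have [S1 [tS1 DS1]] := step_d1; have [S2 [tS2 DS2]] := testR_d1 tS1.
pose C1 : R := 4 * B ^+ 2 + 4 * xi ^+ 2 + 2 * (mu + xi ^+ 2).
pose a1 := mm (fun t => bumpk 1 t * bumpk 1 t).
have tb := testR_bumpk 1.
have a10 : 0 < a1.
  apply: (@mm_gt0 _ 1); first exact: testRMM.
    by move=> t; rewrite -expr2 sqr_ge0.
  by rewrite /bumpk subrr (@step_ge1 _ 1)// step_le0//; lra.
pose Q := 4 * mm (fun t => S2 t * S2 t) + `|C1| * (4 * mm (fun t => S1 t * S1 t)).
have H k : (K - symbol xi) * (k%:R * a1) <= Q.
  have tk := testR_bumpk k.
  have t1 : testR (fun t => S1 t + -1 * S1 (t + - k%:R)).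
    by apply: testRD => //; apply: testRZ; exact: testR_shift.
  have t2 : testR (fun t => S2 t + -1 * S2 (t + - k%:R)).
    by apply: testRD => //; apply: testRZ; exact: testR_shift.
  have D1 : d1 (bumpk k) (fun t => S1 t + -1 * S1 (t + - k%:R)).
    exact: (d1D DS1 (d1Z (-1) (d1_shift (- k%:R) DS1))).
  have D2 : d1 (fun t => S1 t + -1 * S1 (t + - k%:R)) (fun t => S2 t + -1 * S2 (t + - k%:R)).
    exact: (d1D DS2 (d1Z (-1) (d1_shift (- k%:R) DS2))).
  have := symbol_ineq xi tk t1 t2 D1 D2; rewrite -/C1.
  have b1 := mm_diff_le (- k%:R) tS1; have b2 := mm_diff_le (- k%:R) tS2.
  have lb := mm_bumpk k; rewrite -/a1 in lb.
  move: b1 b2 lb; set m1 := mm _; set q1 := mm _; set m2 := mm _; set q2 := mm _; set m0 := mm _.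
  move=> b1 b2 lb le0.
  have m10 : 0 <= m1.
    rewrite /m1 -[0](mul0r (mm (fun t => S1 t * S1 t))) -(mmZ 0 (testRMM tS1 tS1)).
    apply: mm_le => [||t]; [exact: testRZ (testRMM tS1 tS1)|exact: testRMM|].
    by rewrite mul0r -expr2 sqr_ge0.
  have c1 : C1 * m1 <= `|C1| * (4 * q1).
    by apply: (@le_trans _ _ (`|C1| * m1)); [rewrite ler_wpM2r// ler_norm|rewrite ler_wpM2l].
  have c2 : (K - symbol xi) * (k%:R * a1) <= (K - symbol xi) * m0 by rewrite ler_pM2l// subr_gt0.
  apply: le_trans c2 _; rewrite /Q -/q1 -/q2 mulrBl; lra.
have d0 : 0 < (K - symbol xi) * a1 by rewrite mulr_gt0// subr_gt0.
have := H (Num.truncn (Q / ((K - symbol xi) * a1))).+1.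
rewrite mulrCA -ler_pdivlMr// => h'.
have := truncnS_gt (Q / ((K - symbol xi) * a1)); lra.
Qed.

End Sharpness.

(** * The parabola, the symbol and the optimal constant *)

Section Assembly.
Variables (R : realType) (N : nat).
Hypothesis N2 : (2 <= N)%N.
Variables (alpha b c : R).

Let B : R := 1 - alpha + c / 2.
Let mu (n : nat) : R := b + lambda R N n + gamma2 N alpha c.

Lemma rellich_sharp (K : R) (n : nat) (xi : R) :
  (forall u : 'rV[R]_N -> R, test_fun u -> rellich_ineq alpha b c K u) ->
  K <= (mu n + xi ^+ 2) ^+ 2 + 4 * B ^+ 2 * xi ^+ 2.
Proof.
move=> H; have [h [_ [hh _ _ _ [h1 _]]]] := planar_harmonics R N2 n.
apply: (sharp_bound hh h1) => [|u tu].
  rewrite /nsq (bigD1 (Ordinal (ltnW N2)))//= big1 => [|j /negbTE hj].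
    by rewrite !mxE !eqxx expr1n addr0.
  by rewrite !mxE hj andbF expr0n.
exact: (rellichE alpha b c K tu).1 (H u tu).
Qed.

(** The real part of the parabola equation is mu + xi^2 = 0 and its imaginary part is 2 B xi = 0:
    together they say that the symbol vanishes at xi. *)
Lemma P2E (n : nat) : P2 N alpha c (Complex (b + lambda R N n) 0) <->
  exists xi : R, mu n + xi ^+ 2 = 0 /\ B * xi = 0.
Proof.
split=> -[xi].
  move=> [E1 E2]; exists xi; split; first by rewrite /mu E1; ring.
  have : xi * (2 * B) = 0 by rewrite E2 /B; field.
  lra.
move=> [E1 E2]; exists xi; congr Complex; first by move: E1; rewrite /mu => E; lra.
have -> : xi * (2 - 2 * alpha + c) = 2 * (B * xi) by rewrite /B; field.
by rewrite E2 mulr0.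
Qed.

(** The minimising frequency: 0 in the first case, xi^2 = - (mu + 2 B^2) in the second. That the
    value is attained is all that sharpness requires. *)
Lemma Cn2_symbol (n : nat) : exists xi : R,
  Cn2 N alpha b c n = (mu n + xi ^+ 2) ^+ 2 + 4 * B ^+ 2 * xi ^+ 2.
Proof.
rewrite Cn2E -/B -/(mu n); case: ifPn => h; first by exists 0; ring.
exists (Num.sqrt (- (mu n + 2 * B ^+ 2))); rewrite sqr_sqrtr; first by ring.
by rewrite oppr_ge0 ltW// ltNge.
Qed.

Lemma Cn2_gt0 (n : nat) : ~ P2 N alpha c (Complex (b + lambda R N n) 0) ->
  0 < Cn2 N alpha b c n.
Proof.
move=> h; have [xi E] := Cn2_symbol n; rewrite E.
have g0 : 0 <= (mu n + xi ^+ 2) ^+ 2 + 4 * B ^+ 2 * xi ^+ 2.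
  by rewrite addr_ge0 ?sqr_ge0// mulr_ge0 ?sqr_ge0// mulr_ge0 ?sqr_ge0.
rewrite lt_neqAle g0 andbT eq_sym; apply/negP => /eqP E0; apply: h; apply/P2E; exists xi.
have h1 := sqr_ge0 (mu n + xi ^+ 2); have h2 := sqr_ge0 (B * xi).
have e : 4 * B ^+ 2 * xi ^+ 2 = 4 * (B * xi) ^+ 2 by ring.
rewrite e in E0.
by split; apply/eqP; rewrite -sqrf_eq0; apply/eqP; lra.
Qed.

Lemma lambda_ge (n : nat) : n%:R <= lambda R N n.
Proof.
have n0 := ler0n R n; rewrite /lambda; case: n n0 => [|n] n0; first by rewrite mul0r.
have N0 : (2 : R) <= N%:R by rewrite ler_nat.
have n1 : (1 : R) <= n.+1%:R by rewrite ler1n.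
rewrite ler_peMr//; lra.
Qed.

(** As lambda_n >= n, such an [n] falls in the first branch with mu at least 1 and at least C_0^2,
    and mu^2 >= mu. The minimum is thereby a minimum over finitely many degrees. *)
Lemma Cn2_large (n : nat) : 1 + `|Cn2 N alpha b c 0| + `|b| + `|gamma2 N alpha c| <= n%:R ->
  Cn2 N alpha b c 0 <= Cn2 N alpha b c n.
Proof.
move=> hn; have ln := lambda_ge n.
have m1 : 1 + `|Cn2 N alpha b c 0| <= mu n.
  have := ler_norm (- b); have := ler_norm (- gamma2 N alpha c); rewrite !normrN /mu; lra.
have n0 := normr_ge0 (Cn2 N alpha b c 0); have nn := ler_norm (Cn2 N alpha b c 0).
have B0 := sqr_ge0 B.
rewrite [leRHS]Cn2E -/B -/(mu n) ifT; last by lra.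
apply: (@le_trans _ _ (mu n)); first by lra.
by rewrite expr2 ler_peMl; lra.
Qed.

Lemma Cn2_has_min : exists n0, forall n, Cn2 N alpha b c n0 <= Cn2 N alpha b c n.
Proof.
set C := 1 + `|Cn2 N alpha b c 0| + `|b| + `|gamma2 N alpha c|.
pose M := (Num.truncn C).+1.
have [n0 hn0] : exists n0, forall n, (n <= M)%N -> Cn2 N alpha b c n0 <= Cn2 N alpha b c n.
  elim: M => [|M [n0 IH]]; first by exists 0%N => n; rewrite leqn0 => /eqP ->.
  have [h|h] := leP (Cn2 N alpha b c n0) (Cn2 N alpha b c M.+1).
    by exists n0 => n; rewrite leq_eqVlt => /orP[/eqP ->//|]; exact: IH.
  exists M.+1 => n; rewrite leq_eqVlt => /orP[/eqP ->//|nM].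
  exact: le_trans (ltW h) (IH n nM).
exists n0 => n; case: (leqP n M) => [|Mn]; first exact: hn0.
apply: (le_trans (hn0 0%N isT)); apply: Cn2_large.
apply: (@le_trans _ _ M%:R); last by rewrite ler_nat ltnW.
exact/ltW/truncnS_gt.
Qed.

End Assembly.
Theorem mainTheorem1 (R : realType) (N : nat) (alpha b c : R) :
  (2 <= N)%N ->
  ((exists C : R, 0 < C /\
      forall u : 'rV[R]_N -> R, test_fun u -> rellich_ineq alpha b c (C ^+ 2) u)
   <-> (forall n : nat, ~ P2 N alpha c (Complex (b + lambda R N n) 0)))
  /\
  ((forall n : nat, ~ P2 N alpha c (Complex (b + lambda R N n) 0)) ->
   exists n0 : nat,
     (forall n : nat, Cn2 N alpha b c n0 <= Cn2 N alpha b c n) /\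
     0 < Cn2 N alpha b c n0 /\
     (forall u : 'rV[R]_N -> R, test_fun u -> rellich_ineq alpha b c (Cn2 N alpha b c n0) u) /\
     (forall K : R,
        (forall u : 'rV[R]_N -> R, test_fun u -> rellich_ineq alpha b c K u) ->
        K <= Cn2 N alpha b c n0)).
Proof.
move=> N2.
have sharp K : (forall u : 'rV[R]_N -> R, test_fun u -> rellich_ineq alpha b c K u) ->
    forall n, K <= Cn2 N alpha b c n.
  by move=> H n; have [xi ->] := Cn2_symbol N alpha b c n; exact: rellich_sharp.
have opt : (forall n : nat, ~ P2 N alpha c (Complex (b + lambda R N n) 0)) ->
   exists n0 : nat,
     (forall n : nat, Cn2 N alpha b c n0 <= Cn2 N alpha b c n) /\
     0 < Cn2 N alpha b c n0 /\
     (forall u : 'rV[R]_N -> R, test_fun u -> rellich_ineq alpha b c (Cn2 N alpha b c n0) u) /\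
     (forall K : R,
        (forall u : 'rV[R]_N -> R, test_fun u -> rellich_ineq alpha b c K u) ->
        K <= Cn2 N alpha b c n0).
  move=> H; have [n0 hn0] := Cn2_has_min N2 alpha b c.
  exists n0; split; first exact: hn0.
  split; first exact: Cn2_gt0.
  split=> [u tu|K hK]; first exact: rellich_lower.
  exact: sharp.
split; last exact: opt.
split=> [[C [C0 hC]] n|/opt[n0 [_ [g0 [hK _]]]]].
  (* On the parabola the symbol has a zero, and the sharp bound would give [C ^+ 2 <= 0]. *)
  move=> /P2E[xi [E1 E2]]; have := rellich_sharp N2 n xi hC.
  rewrite E1 expr0n add0r -mulrA -exprMn E2 expr0n mulr0 leNgt exprn_gt0//.
exists (Num.sqrt (Cn2 N alpha b c n0)); split; first by rewrite sqrtr_gt0.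
by rewrite sqr_sqrtr ?(ltW g0).
Qed.
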